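(* Let $G$ be a directed graph such that every connected component of $G$ is strongly connected. Then for every bounded derivation $\delta\colon\mathcal{A}_G\to\mathfrak{L}_G$, there exists $T\in\mathfrak{L}_G$ such that $\delta=\delta_T$ and $\|T\|\leq\|\delta\|$.
   Context: A directed graph $G=(\mathcal{V},\mathcal{E},s,r)$ has a vertex set $\mathcal{V}$ and an edge set $\mathcal{E}$ (each of arbitrary cardinality, countable or uncountable; loops and multiple edges allowed) and source and range maps $s,r\colon\mathcal{E}\to\mathcal{V}$; an edge $e$ is an arrow from $s(e)$ to $r(e)$. $\mathbb{F}_G^+$ denotes the set of all directed paths of finite length: vertices $v$ are paths of length $0$ with $r(v)=s(v)=v$, and a path of length $n\geq1$ is $p=e_1e_2\cdots e_n$ with $s(e_j)=r(e_{j+1})$, $r(p)=r(e_1)$, $s(p)=s(e_n)$. If $s(p_1)=r(p_2)$ the product $p_1p_2$ is the concatenated path. Let $\mathcal{H}_G=\ell^2(\mathbb{F}_G^+)$ with orthonormal basis $\{\xi_w\colon w\in\mathbb{F}_G^+\}$. For $e\in\mathcal{E}$, $L_e\xi_w=\xi_{ew}$ if $r(w)=s(e)$ and $0$ otherwise; for $x\in\mathcal{V}$, $L_x\xi_w=\xi_w$ if $r(w)=x$ and $0$ otherwise. $\mathfrak{L}_G$ (the left free semigroupoid algebra) is the weak-operator closed algebra, and $\mathcal{A}_G$ (the tensor algebra) the norm-closed algebra, generated by $\{L_e,L_x\colon e\in\mathcal{E},x\in\mathcal{V}\}$ in $B(\mathcal{H}_G)$. For a Banach algebra $\mathcal{A}$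 and a Banach $\mathcal{A}$-bimodule $\mathcal{X}$, a derivation is a linear map $\delta\colon\mathcal{A}\to\mathcal{X}$ with $\delta(AB)=\delta(A)B+A\delta(B)$; for $T\in\mathcal{X}$, $\delta_T(A)=AT-TA$. $G$ is strongly connected if for any vertices $x,y$ there is a directed path from $x$ to $y$ (in particular a single vertex with no edge is strongly connected). Connected components are those of the underlying undirected graph. *)

(* Defs.v *)
From HB Require Import structures.
From mathcomp Require Import all_boot all_order all_algebra.
From mathcomp Require Import all_classical all_reals all_analysis.
From mathcomp Require Import finmap complex summability.
From Stdlib Require Import Relation_Operators.
From mathcomp Require Import ring lra.

Set Implicit Arguments.
Unset Strict Implicit.
Unset Printing Implicit Defensive.

Import Order.TTheory GRing.Theory Num.Theory.
Import numFieldNormedType.Exports.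
Import Normc.

Local Open Scope classical_set_scope.
Local Open Scope ring_scope.

Section square_summable.
Context {R : realType} {I : choiceType}.
Implicit Types f g : I -> R[i].

Definition sqsum f : \bar R := \esum_(i in [set: I]) ((normc (f i)) ^+ 2)%:E.

Definition square_summable : {pred I -> R[i]} :=
  [pred f | (sqsum f < +oo)%E].

Lemma normc_ge0 (z : R[i]) : 0 <= normc z.
Proof. by case: z => a b; rewrite sqrtr_ge0. Qed.

Lemma sqsum_ge0 f : (0 <= sqsum f)%E.
Proof. by apply: esum_ge0 => i _; rewrite lee_fin sqr_ge0. Qed.

Lemma sqsumK f : f \in square_summable -> ((fine (sqsum f))%:E = sqsum f)%E.
Proof. by move=> h; rewrite fineK// ge0_fin_numE ?sqsum_ge0. Qed.

Lemma le_esumZ (c : R) (h : I -> R) : 0 <= c -> (forall i, 0 <= h i) ->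
  (\esum_(i in [set: I]) (c * h i)%:E <=
   c%:E * \esum_(i in [set: I]) (h i)%:E)%E.
Proof.
move=> c0 h0; apply: ge_ereal_sup => _ [X [finX XT] <-].
under eq_fsbigr do rewrite EFinM.
rewrite -ge0_mule_fsumr; last by move=> i; rewrite lee_fin.
apply: lee_wpmul2l; first by rewrite lee_fin.
by apply: ereal_sup_ubound; exists X.
Qed.

Lemma esumZ (c : R) (h : I -> R) : 0 <= c -> (forall i, 0 <= h i) ->
  (\esum_(i in [set: I]) (c * h i)%:E =
   c%:E * \esum_(i in [set: I]) (h i)%:E)%E.
Proof.
move=> c0 h0; apply/eqP; rewrite eq_le le_esumZ//=.
have [->|cn0] := eqVneq c 0.
  by rewrite mul0e; apply: esum_ge0 => i _; rewrite mul0r.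
have cp : 0 < c by rewrite lt_def cn0.
rewrite -lee_pdivlMl//; apply: le_trans; last first.
  by apply: le_esumZ; rewrite ?invr_ge0// => i; rewrite mulr_ge0.
by apply: le_esum => i _; rewrite lee_fin mulKf.
Qed.

Lemma sqsumZ (a : R[i]) f : sqsum (a *: f) = ((normc a ^+ 2)%:E * sqsum f)%E.
Proof.
rewrite /sqsum -esumZ ?sqr_ge0//; last by move=> i; rewrite sqr_ge0.
by apply: eq_esum => i _; rewrite -exprMn -normcM.
Qed.

Lemma sqr_normcD_le (t : R) (a b : R[i]) : 0 < t < 1 ->
  normc (a + b) ^+ 2 <= t^-1 * normc a ^+ 2 + (1 - t)^-1 * normc b ^+ 2.
Proof.
move=> /andP[t0 t1]; set x := normc a; set y := normc b.
have s0 : 0 < 1 - t by rewrite subr_gt0.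
apply: (@le_trans _ _ ((x + y) ^+ 2)).
  by rewrite lerXn2r ?nnegrE ?addr_ge0 ?normc_ge0// le_normcD.
rewrite -subr_ge0 (_ : _ - _ = ((1 - t) * x - t * y) ^+ 2 / (t * (1 - t))).
  by rewrite divr_ge0 ?sqr_ge0// mulr_ge0 ?ltW.
by field; rewrite !gt_eqF.
Qed.

Lemma le_sqsumD (t : R) f g : 0 < t < 1 ->
  (sqsum (f + g)%R <= t^-1%:E * sqsum f + (1 - t)^-1%:E * sqsum g)%E.
Proof.
move=> t01; have /andP[t0 t1] := t01.
have s0 : 0 < 1 - t by rewrite subr_gt0.
rewrite /sqsum -!esumZ ?invr_ge0 ?(ltW t0) ?(ltW s0)//;
  try by move=> i; rewrite sqr_ge0.
rewrite -esumD; first last.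
- by move=> i _; rewrite lee_fin mulr_ge0 ?sqr_ge0// invr_ge0 ltW.
- by move=> i _; rewrite lee_fin mulr_ge0 ?sqr_ge0// invr_ge0 ltW.
by apply: le_esum => i _; rewrite lee_fin sqr_normcD_le.
Qed.

Lemma square_summable_submod : submod_closed square_summable.
Proof.
split=> [|a f g].
  rewrite inE /sqsum esum1 ?ltry// => i _.
  by rewrite (normc0 R) expr0n.
rewrite !inE => fI gI.
have h : 0 < (2^-1 : R) < 1 by rewrite invr_gt0 invf_lt1 ?ltr1n ?ltr0n.
apply: le_lt_trans (le_sqsumD (a *: f) g h) _.
rewrite sqsumZ lte_add_pinfty//.
  by rewrite -(sqsumK fI) -!EFinM ltry.
by rewrite -(sqsumK gI) -!EFinM ltry.
Qed.

HB.instance Definition _ := GRing.isSubmodClosed.Build R[i] (I -> R[i])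
  square_summable square_summable_submod.

End square_summable.

Record ell2 (R : realType) (I : choiceType) := Ell2 {
  ell2_fun :> I -> R[i];
  ell2P : ell2_fun \in square_summable }.
HB.instance Definition _ R I := [isSub for @ell2_fun R I].
HB.instance Definition _ R I := [Choice of ell2 R I by <:].
HB.instance Definition _ R I := [SubChoice_isSubLmodule of ell2 R I by <:].

Section ell2_norm.
Context {R : realType} {I : choiceType}.
Implicit Types f g : ell2 R I.

Definition l2norm f : R := Num.sqrt (fine (sqsum f)).

Lemma l2norm_ge0 f : 0 <= l2norm f.
Proof. exact: sqrtr_ge0. Qed.

Lemma sqr_l2norm f : ((l2norm f ^+ 2)%:E = sqsum f)%E.
Proof. by rewrite sqr_sqrtr ?fine_ge0 ?sqsum_ge0// sqsumK// ell2P. Qed.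

Lemma l2normZ (a : R[i]) f : l2norm (a *: f) = normc a * l2norm f.
Proof.
apply/eqP; rewrite -(@eqrXn2 _ 2)// ?mulr_ge0 ?l2norm_ge0 ?normc_ge0//.
apply/eqP/EFin_inj.
by rewrite (sqr_l2norm (a *: f)) exprMn EFinM (sqr_l2norm f) -sqsumZ.
Qed.

Lemma l2norm_eq0 f : l2norm f = 0 -> f = 0.
Proof.
move=> f0; apply/val_inj/funext => i /=; apply: eq0_normc; apply/eqP.
rewrite -sqrf_eq0 eq_le sqr_ge0 andbT -lee_fin.
have <- : (sqsum f = 0%:E)%E by rewrite -sqr_l2norm f0 expr0n.
apply: esum_ge; exists [set i]; first by split.
by rewrite fsbig_set1.
Qed.

Lemma l2normD f g : l2norm (f + g) <= l2norm f + l2norm g.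
Proof.
have [f0|f0] := eqVneq (l2norm f) 0.
  by rewrite (l2norm_eq0 f0) add0r lerDr l2norm_ge0.
have [g0|g0] := eqVneq (l2norm g) 0.
  by rewrite (l2norm_eq0 g0) addr0 lerDl l2norm_ge0.
have x0 : 0 < l2norm f by rewrite lt_def f0 l2norm_ge0.
have y0 : 0 < l2norm g by rewrite lt_def g0 l2norm_ge0.
rewrite -(@ler_pXn2r _ 2)// ?nnegrE ?addr_ge0 ?l2norm_ge0//.
have t01 : 0 < l2norm f / (l2norm f + l2norm g) < 1.
  rewrite divr_gt0 ?addr_gt0//= ltr_pdivrMr ?addr_gt0// mul1r.
  by rewrite ltrDl.
rewrite -lee_fin sqr_l2norm.
apply: le_trans (le_sqsumD f g t01) _.
rewrite -!sqr_l2norm -!EFinM -EFinD lee_fin le_eqVlt; apply/orP; left.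
apply/eqP; field.
by rewrite f0 andbT (addrC (l2norm f)) addrK g0 gt_eqF ?addr_gt0.
Qed.

Let norm f : R[i] := (l2norm f)%:C%C.

Let norm_triangle f g : norm (f + g) <= norm f + norm g.
Proof. by rewrite /norm -rmorphD/= lecR l2normD. Qed.

Let norm_homogeneous (a : R[i]) f : norm (a *: f) = `|a| * norm f.
Proof. by rewrite /norm l2normZ rmorphM. Qed.

Let norm_separated f : norm f = 0 -> f = 0.
Proof. by move=> [] /l2norm_eq0. Qed.

HB.instance Definition _ := Lmodule_isNormed.Build R[i] (ell2 R I)
  norm_triangle norm_homogeneous norm_separated.

End ell2_norm.

#[export] Existing Instance totally_filter.

Section inner_product.
Context {R : realType} {I : choiceType}.
Implicit Types f g : ell2 R I.

(* [summability.sum] is the unconditional sum: the limit of the net of finite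
   partial sums. It converges here by [cvg_inner] below. *)
Definition inner f g : R[i] := sum (fun i => f i * (g i)^* : R[i]^o).

Lemma cvg_partial_sum_sqr f :
  partial_sum (fun i => ((normc (f i)) ^+ 2)%:C%C : R[i]^o) @ totally -->
  ((l2norm f ^+ 2)%:C%C : R[i]^o).
Proof.
apply/cvgrPdist_lt => eps eps0.
have [e e0 ->] : exists2 e : R, 0 < e & eps = e%:C%C.
  have /complex_realP[e epsE] := gtr0_real eps0.
  by exists e => //; rewrite -ltcR -epsE.
have psE (A : {fset I}) :
    partial_sum (fun i => ((normc (f i)) ^+ 2)%:C%C : R[i]^o) A =
    (\sum_(i <- A) normc (f i) ^+ 2)%:C%C.
  by rewrite /partial_sum rmorph_sum/= (big_seq_fsetE _ A predT).
have ub (A : {fset I}) : \sum_(i <- A) normc (f i) ^+ 2 <= l2norm f ^+ 2.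
  rewrite -lee_fin sqr_l2norm -sumEFin; apply: esum_ge; exists [set` A] => //.
  by rewrite fsbig_finite// set_fsetK.
have [X Xe] : exists X : {fset I}, l2norm f ^+ 2 - e < \sum_(i <- X) normc (f i) ^+ 2.
  have : ((l2norm f ^+ 2 - e)%:E < sqsum f)%E.
    by rewrite -sqr_l2norm lte_fin ltrBlDr ltrDl.
  move=> /ereal_sup_gt[_ [X [finX _] <-]] Xe; exists (fset_set X).
  by rewrite -lte_fin -sumEFin -fsbig_finite.
exists X => // A XA; rewrite psE -rmorphB normc_def/= expr0n addr0 sqrtr_sqr.
rewrite ltcR ger0_norm ?subr_ge0// ltrBlDr -ltrBlDl (lt_le_trans Xe)//.
have XAs : {subset X <= A} by apply/fsubsetP.
rewrite [leRHS](big_fsetID _ (mem X))/= [X in _ <= X + _](_ : _ = \sum_(i <- X) normc (f i) ^+ 2).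
  by rewrite lerDl sumr_ge0// => i _; rewrite sqr_ge0.
congr (\big[_/_]_(i <- enum_fset _) _); apply/fsetP => i.
by rewrite !inE/= andb_idl//; exact: XAs.
Qed.

Lemma inner_polarization (x y : R[i]) : x * y^* =
  4^-1 * ((normc (x + y) ^+ 2)%:C%C - (normc (x - y) ^+ 2)%:C%C
    + 'i * ((normc (x + 'i *: (y : R[i]^o)) ^+ 2)%:C%C
            - (normc (x - 'i *: (y : R[i]^o)) ^+ 2)%:C%C)).
Proof.
have nE (z : R[i]) : (normc z ^+ 2)%:C%C = z * z^* by rewrite rmorphXn/= -sqr_normc.
rewrite !nE !rmorphD !rmorphN !rmorphM/= conjCi.
have i2 : 'i * 'i = -1 :> R[i] by rewrite -expr2 sqrCi.
rewrite /GRing.scale/=.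
apply: (@mulfI _ 4); first by rewrite pnatr_eq0.
rewrite [RHS]mulrA divff ?pnatr_eq0// mul1r.
have -> : 4 * (x * y^*) = 2 * (x * y^* + y * x^*) + 2 * (x * y^* - y * x^*) :> R[i] by ring.
have -> : 2 * (x * y^* - y * x^*) = - ('i * 'i) * 2 * (x * y^* - y * x^*) :> R[i].
  by rewrite i2; ring.
by ring.
Qed.

Lemma cvg_inner f g :
  partial_sum (fun i => f i * (g i)^* : R[i]^o) @ totally -->
  (inner f g : R[i]^o).
Proof.
suff : cvg (partial_sum (fun i => f i * (g i)^* : R[i]^o) @ totally) by [].
pose P (h : ell2 R I) : {fset I} -> R[i]^o :=
  partial_sum (fun i => ((normc (h i)) ^+ 2)%:C%C : R[i]^o).
have Pc h : cvg (P h @ totally).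
  by apply/cvg_ex; exists ((l2norm h ^+ 2)%:C%C); exact: cvg_partial_sum_sqr.
have -> : partial_sum (fun i => f i * (g i)^* : R[i]^o) =
    4^-1 \*: ((P (f + g) - P (f - g)) +
             ('i : R[i]) \*: (P (f + 'i *: g) - P (f - 'i *: g))).
  apply/funext => A; rewrite /P /partial_sum /= !fctE.
  rewrite /= -!sumrB scaler_sumr -big_split/= scaler_sumr.
  by apply: eq_bigr => i _; exact: inner_polarization.
apply: is_cvgZl_tmp; apply: is_cvgD; first exact: is_cvgB.
by apply: is_cvgZl_tmp; exact: is_cvgB.
Qed.

Lemma inner_self f : inner f f = (l2norm f ^+ 2)%:C%C.
Proof.
rewrite /inner /sum; under eq_fun do rewrite -sqr_normc.
apply: (cvg_lim (@norm_hausdorff _ (R[i]^o))).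
rewrite (_ : partial_sum _ = partial_sum
  (fun i => ((normc (f i)) ^+ 2)%:C%C : R[i]^o)); last first.
  by congr partial_sum; apply/funext => i; rewrite rmorphXn.
exact: cvg_partial_sum_sqr.
Qed.

End inner_product.

Section bounded_linear.
Context {R : realType} {I : choiceType}.
Local Notation H := (ell2 R I).

Definition bounded_linear : {pred H -> H} := mem [set T : H -> H |
  linear T /\ exists M : R, forall f, l2norm (T f) <= M * l2norm f].

Lemma bounded_linearP (T : H -> H) : T \in bounded_linear <->
  linear T /\ exists M : R, forall f, l2norm (T f) <= M * l2norm f.
Proof. by split=> [|h]; rewrite ?inE// in_setE. Qed.

Lemma bounded_linear_submod : submod_closed bounded_linear.
Proof.
split=> [|a S T /bounded_linearP[linS [M SM]] /bounded_linearP[linT [N TN]]].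
  apply/bounded_linearP; split=> [b f g|]; first by rewrite scaler0 addr0.
  exists 0 => f; rewrite mul0r (_ : l2norm _ = 0)//.
  by have := l2normZ 0 f; rewrite scale0r (normc0 R) mul0r.
apply/bounded_linearP; split=> [b f g|].
  rewrite /= !fctE linS linT !scalerDr !scalerA (mulrC b a) -!addrA.
  by congr (_ + _); rewrite addrCA.
exists (normc a * M + N) => f.
rewrite /= mulrDl; apply: le_trans (l2normD _ _) _.
by rewrite lerD// l2normZ -mulrA ler_wpM2l ?normc_ge0.
Qed.

HB.instance Definition _ := GRing.isSubmodClosed.Build R[i] (H -> H)
  bounded_linear bounded_linear_submod.

End bounded_linear.

Record bop (R : realType) (I : choiceType) := BOp {
  bop_fun :> ell2 R I -> ell2 R I;
  bopP : bop_fun \in bounded_linear }.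
HB.instance Definition _ R I := [isSub for @bop_fun R I].
HB.instance Definition _ R I := [Choice of bop R I by <:].
HB.instance Definition _ R I := [SubChoice_isSubLmodule of bop R I by <:].

Section operator_norm.
Context {R : realType} {I : choiceType}.
Implicit Types S T : bop R I.

Lemma bop_linear T : linear T.
Proof. by have /bounded_linearP[] := bopP T. Qed.

HB.instance Definition _ T :=
  GRing.isLinear.Build R[i] (ell2 R I) (ell2 R I) *:%R T (bop_linear T).

Definition opnorm T : R :=
  sup [set l2norm (T f) | f in [set f | l2norm f <= 1]].

Lemma l2norm0 : l2norm (0 : ell2 R I) = 0.
Proof. by have := l2normZ 0 (0 : ell2 R I); rewrite scale0r (normc0 R) mul0r. Qed.

Lemma opnorm_has_sup T :
  has_sup [set l2norm (T f) | f in [set f | l2norm f <= 1]].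
Proof.
split; first by exists (l2norm (T 0)), 0 => //=; rewrite l2norm0 ler01.
have /bounded_linearP[_ [M TM]] := bopP T.
exists `|M| => _ [f f1 <-]; apply: (le_trans (TM f)).
apply: le_trans (ler_wpM2r (l2norm_ge0 f) (ler_norm M)) _.
by rewrite ler_piMr.
Qed.

Lemma opnorm_ge0 T : 0 <= opnorm T.
Proof.
apply: le_trans (l2norm_ge0 (T 0)) _; apply: ub_le_sup.
  by have [] := opnorm_has_sup T.
by exists 0 => //=; rewrite l2norm0 ler01.
Qed.

Lemma opnorm_le T (M : R) :
  (forall f, l2norm f <= 1 -> l2norm (T f) <= M) -> opnorm T <= M.
Proof.
move=> TM; apply: ge_sup; first by have [] := opnorm_has_sup T.
by move=> _ [f f1 <-]; exact: TM.
Qed.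

Lemma l2norm_bop T f : l2norm (T f) <= opnorm T * l2norm f.
Proof.
have [f0|f0] := eqVneq (l2norm f) 0.
  by rewrite f0 mulr0 (l2norm_eq0 f0) linear0 l2norm0.
have fgt0 : 0 < l2norm f by rewrite lt_def f0 l2norm_ge0.
have nV : normc (((l2norm f)^-1)%:C%C : R[i]) = (l2norm f)^-1.
  by rewrite /normc/= expr0n addr0 sqrtr_sqr ger0_norm// invr_ge0 ltW.
rewrite -ler_pdivrMr// mulrC -nV -l2normZ -linearZ.
apply: ub_le_sup; first by have [] := opnorm_has_sup T.
by exists (((l2norm f)^-1)%:C%C *: f) => //=; rewrite l2normZ nV mulVf.
Qed.

Let norm T : R[i] := (opnorm T)%:C%C.

Let norm_triangle S T : norm (S + T) <= norm S + norm T.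
Proof.
rewrite /norm -rmorphD/= lecR; apply: opnorm_le => f f1.
apply: le_trans (l2normD _ _) _; apply: lerD; apply: ub_le_sup.
- by have [] := opnorm_has_sup S.
- by exists f.
- by have [] := opnorm_has_sup T.
- by exists f.
Qed.

Let opnormZ_le (a : R[i]) T : opnorm (a *: T) <= normc a * opnorm T.
Proof.
apply: opnorm_le => f f1; rewrite l2normZ ler_wpM2l ?normc_ge0//.
by apply: ub_le_sup; [have [] := opnorm_has_sup T|exists f].
Qed.

Let norm_homogeneous (a : R[i]) T : norm (a *: T) = `|a| * norm T.
Proof.
rewrite /norm -[X in _ = X * _]/((normc a)%:C%C) -rmorphM; congr (_%:C%C).
apply/eqP; rewrite eq_le opnormZ_le/=.
have [->|a0] := eqVneq a 0; first by rewrite (normc0 R) mul0r opnorm_ge0.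
have na0 : 0 < normc a.
  by rewrite lt_def normc_ge0 andbT; apply: contraNneq a0 => /eq0_normc ->.
rewrite -ler_pdivlMl// -normcV -{1}(scale1r T) -(mulVf a0) -scalerA.
exact: opnormZ_le.
Qed.

Let norm_separated T : norm T = 0 -> T = 0.
Proof.
move=> [T0]; apply/val_inj/funext => f /=; apply: l2norm_eq0.
apply/eqP; rewrite eq_le l2norm_ge0 andbT.
by have := l2norm_bop T f; rewrite T0 mul0r.
Qed.

HB.instance Definition _ := Lmodule_isNormed.Build R[i] (bop R I)
  norm_triangle norm_homogeneous norm_separated.

End operator_norm.

Section operator_algebra.
Context {R : realType} {I : choiceType}.
Local Notation H := (ell2 R I).
Implicit Types (S T : bop R I) (A : set (bop R I)).

Lemma bcomp_subproof S T : (S \o T : H -> H) \in bounded_linear.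
Proof.
apply/bounded_linearP; split=> [a f g|] /=; first by rewrite !linearP.
exists (opnorm S * opnorm T) => f; apply: le_trans (l2norm_bop _ _) _.
by rewrite -mulrA ler_wpM2l ?opnorm_ge0 ?l2norm_bop.
Qed.

Definition bcomp S T : bop R I := BOp (bcomp_subproof S T).

(* No unit is required: over a graph with infinitely many vertices the
   algebra generated by the edges and vertices need not contain 1. *)
Definition subalgebra A : Prop :=
  [/\ A 0, forall (a : R[i]) S T, A S -> A T -> A (a *: S + T)
   & forall S T, A S -> A T -> A (bcomp S T)].

Definition matrix_coefs T : {ptws H * H -> R[i]^o} :=
  fun x => inner (T x.1) x.2.

Definition norm_closed A : Prop := closed A.
(* The weak operator topology is the coarsest one making all T |-> <T f, g>
   continuous. *)
Definition wot_closed A : Prop := closed (A : set (initial_topology matrix_coefs)).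

Definition norm_closed_algebra (G : set (bop R I)) : set (bop R I) :=
  smallest [set A | subalgebra A /\ norm_closed A] G.
Definition wot_closed_algebra (G : set (bop R I)) : set (bop R I) :=
  smallest [set A | subalgebra A /\ wot_closed A] G.

End operator_algebra.

Section derivation.
Context {R : realType} {I : choiceType}.
Implicit Types (A X : set (bop R I)) (d : bop R I -> bop R I).

(* A derivation of the algebra A into the A-bimodule X is represented by a
   total function of which only the values on A matter. *)
Definition derivation A X d : Prop :=
  [/\ forall S, A S -> X (d S),
      forall (a : R[i]) S T, A S -> A T -> d (a *: S + T) = a *: d S + d T
    & forall S T, A S -> A T -> d (bcomp S T) = bcomp (d S) T + bcomp S (d T)].

Definition bounded_on A d : Prop :=
  exists M : R, forall S, A S -> opnorm (d S) <= M * opnorm S.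

Definition normon A d : R :=
  sup [set opnorm (d S) | S in [set S | A S /\ opnorm S <= 1]].

Definition inner_derivation (T S : bop R I) : bop R I := bcomp S T - bcomp T S.

End derivation.

Record digraph := Digraph {
  vertex : Type;
  edge : Type;
  src : edge -> vertex;
  rng : edge -> vertex }.

Section paths.
Variable G : digraph.

Definition path_rng (x : vertex G) (es : seq (edge G)) : vertex G :=
  if es is e :: _ then rng e else x.

Fixpoint composable (x : vertex G) (es : seq (edge G)) : Prop :=
  if es is e :: es' then src e = path_rng x es' /\ composable x es' else True.

(* Paths compose from right to left: e_1 ... e_n, with src e_j = rng e_(j+1),
   is stored as [:: e_1; ...; e_n] together with its source src e_n, so that
   the path of length 0 at x is [DiPath x [::]]. *)
Record dipath := DiPath {
  psrc : vertex G;
  pedges : seq (edge G);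
  _ : composable psrc pedges }.

Definition prng (w : dipath) : vertex G := path_rng (psrc w) (pedges w).

Lemma dipath_inj (v w : dipath) : psrc v = psrc w -> pedges v = pedges w -> v = w.
Proof.
case: v w => [x p xp] [y q yq] /= xy pq; subst y q.
by congr DiPath; exact: Prop_irrelevance.
Qed.

Program Definition pcons (e : edge G) (w : dipath) (ew : src e = prng w) :
  dipath := @DiPath (psrc w) (e :: pedges w) _.
Next Obligation. by move=> e [x p xp]. Qed.

Definition strongly_connected : Prop :=
  forall x y, exists w : dipath, psrc w = x /\ prng w = y.

Definition same_component : vertex G -> vertex G -> Prop :=
  clos_refl_sym_trans (vertex G) (fun x y => exists e, src e = x /\ rng e = y).

End paths.

HB.instance Definition _ G := gen_eqMixin (dipath G).
HB.instance Definition _ G := gen_choiceMixin (dipath G).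

Definition component (G : digraph) (x : vertex G) : digraph :=
  @Digraph {y | same_component x y}
    {e | same_component x (src e) /\ same_component x (rng e)}
    (fun e => exist _ (src (sval e)) (proj1 (svalP e)))
    (fun e => exist _ (rng (sval e)) (proj2 (svalP e))).

Section partial_isometry.
Context {R : realType} {I : choiceType}.
Local Notation H := (ell2 R I).

Definition basis_fun (w : I) : I -> R[i] := fun i => (i == w)%:R.

Lemma basis_subproof (w : I) : basis_fun w \in square_summable.
Proof.
rewrite inE /= /sqsum (esumID [set w]) ; last by move=> i _; rewrite lee_fin sqr_ge0.
rewrite setTI esum_set1 ?lee_fin ?sqr_ge0// esum1 ?adde0 ?ltry// => i [_ /eqP].
by rewrite /basis_fun => /negPf ->; rewrite (normc0 R) expr0n.
Qed.

Definition xi (w : I) : H := Ell2 (basis_subproof w).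

Section partial_map.
Variable m : I -> option I.
Hypothesis m_inj : forall v w u, m v = Some u -> m w = Some u -> v = w.

Definition pushforward_fun (f : I -> R[i]) (u : I) : R[i] :=
  if pselect (exists w, m w = Some u) is left mu then f (sval (cid mu)) else 0.

Lemma le_sqsum_pushforward f : (sqsum (pushforward_fun f) <= sqsum f)%E.
Proof.
pose D := [set u | exists w, m w = Some u].
pose P := [set w | exists u, m w = Some u].
rewrite /sqsum (esumID D); last by move=> u _; rewrite lee_fin sqr_ge0.
rewrite !setTI [X in (_ + X)%E]esum1 ?adde0; last first.
  move=> u nDu; rewrite /pushforward_fun; case: pselect => // _.
  by rewrite (normc0 R) expr0n.
pose e w := odflt w (m w).
have eE w u : m w = Some u -> e w = u by rewrite /e => ->.
rewrite (@reindex_esum _ _ _ P D e); last first.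
  split=> [w [u wu]|v w|u [w wu]].
  - by exists w; rewrite wu (eE _ _ wu).
  - move=> /set_mem[u vu] /set_mem[u' wu'].
    rewrite (eE _ _ vu) (eE _ _ wu') => uu'.
    by apply: (m_inj vu); rewrite wu' uu'.
  - by exists w; [exists u|exact: eE].
rewrite [leRHS](esumID P); last by move=> w _; rewrite lee_fin sqr_ge0.
rewrite !setTI -[leLHS]adde0 leeD//; last first.
  by apply: esum_ge0 => w _; rewrite lee_fin sqr_ge0.
apply: le_esum => w [u wu]; rewrite (eE _ _ wu) /pushforward_fun.
case: pselect => [mu|[]]; last by exists w.
by case: cid => v /= vu; rewrite (m_inj vu wu).
Qed.

Lemma pushforward_subproof (f : H) : pushforward_fun f \in square_summable.
Proof. by apply: le_lt_trans (le_sqsum_pushforward f) _; exact: ell2P. Qed.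

Lemma pushforward_bounded :
  (fun f : H => Ell2 (pushforward_subproof f)) \in bounded_linear.
Proof.
apply/bounded_linearP; split=> [a f g|].
  apply/val_inj/funext => u /=; rewrite /pushforward_fun/= !fctE.
  by rewrite /pushforward_fun; case: pselect => //= _; rewrite scaler0 addr0.
exists 1 => f; rewrite mul1r /l2norm ler_wsqrtr// -lee_fin !sqsumK ?ell2P//.
exact: le_sqsum_pushforward.
Qed.

(* The operator with xi_w |-> xi_u if m w = Some u and xi_w |-> 0 if
   m w = None. *)
Definition pushforward : bop R I := BOp pushforward_bounded.

Lemma pushforward_xi w :
  pushforward (xi w) = if m w is Some u then xi u else 0.
Proof.
apply/val_inj/funext => u /=; rewrite /pushforward_fun.
case: pselect => [mu|nmu] /=; last first.
  case mw : (m w) => [v|//] /=; rewrite /basis_fun; case: eqP => // uv.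
  by case: nmu; exists w; rewrite mw uv.
case: cid => v /= mv; rewrite /basis_fun; case: eqP => [<-|vw].
  by rewrite mv /= /basis_fun eqxx.
case mw : (m w) => [v'|//] /=; rewrite /basis_fun; case: eqP => // uv'.
by case: vw; apply: (m_inj mv); rewrite mw uv'.
Qed.

End partial_map.
End partial_isometry.

Section left_regular.
Variables (R : realType) (G : digraph).
Local Notation W := (dipath G).

Definition edge_map (e : edge G) (w : W) : option W :=
  if pselect (src e = prng w) is left ew then Some (pcons ew) else None.

Lemma edge_map_inj e v w u :
  edge_map e v = Some u -> edge_map e w = Some u -> v = w.
Proof.
rewrite /edge_map; case: pselect => // ev; case: pselect => // ew [<-] [h1 h2].
exact: dipath_inj.
Qed.

Definition vertex_map (x : vertex G) (w : W) : option W :=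
  if pselect (prng w = x) is left _ then Some w else None.

Lemma vertex_map_inj x v w u :
  vertex_map x v = Some u -> vertex_map x w = Some u -> v = w.
Proof.
by rewrite /vertex_map; case: pselect => // _; case: pselect => // _ [->] [->].
Qed.

Definition Ledge (e : edge G) : bop R W := pushforward (@edge_map_inj e).
Definition Lvertex (x : vertex G) : bop R W := pushforward (@vertex_map_inj x).

Lemma Ledge_xi (e : edge G) (w : W) (ew : src e = prng w) :
  Ledge e (xi w) = xi (pcons ew).
Proof.
rewrite pushforward_xi /edge_map; case: pselect => // ew'.
by rewrite (Prop_irrelevance ew ew').
Qed.

Lemma Ledge_xi0 (e : edge G) (w : W) : src e <> prng w -> Ledge e (xi w) = 0.
Proof. by rewrite pushforward_xi /edge_map; case: pselect. Qed.

Lemma Lvertex_xi (x : vertex G) (w : W) : prng w = x -> Lvertex x (xi w) = xi w.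
Proof. by rewrite pushforward_xi /vertex_map; case: pselect. Qed.

Lemma Lvertex_xi0 (x : vertex G) (w : W) : prng w <> x -> Lvertex x (xi w) = 0.
Proof. by rewrite pushforward_xi /vertex_map; case: pselect. Qed.

Definition generators : set (bop R W) := range Ledge `|` range Lvertex.

Definition tensor_algebra : set (bop R W) := norm_closed_algebra generators.

Definition free_semigroupoid_algebra : set (bop R W) :=
  wot_closed_algebra generators.

End left_regular.

Arguments tensor_algebra R G _ : clear implicits.
Arguments free_semigroupoid_algebra R G _ : clear implicits.

(* Main.v *)
(* For a path [w] let [c_w = d(L_w) xi_(src w)], restricted to the paths parallel
   to [w]. As elements of the free semigroupoid algebra commute with right
   creation operators, [c] satisfies [c_(vw) = c_v w + v c_w], and
   [|c_w| <= |d|]. Boundedness, tested on words in which one edge or one cycle is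
   inserted at many places, turns [c] into a coboundary:
   [c_w = w sigma - sigma w] for coefficients [sigma] living on cycles. The
   remaining coefficients of [T] are read off [d(L_x)], [x] a vertex. This yields
   the matrix of [T] without any bound on it.

   The bound comes from the operators [V = sum_x eps_x L_(w_x)] over finite sets of
   vertices, with signs [eps_x] and words [w_x] starting at [x] no two of which are
   prefixes of a common path, so that [V] is a partial isometry. From
   [d(V) = V T - T V] one gets [V^* d(V) = T - V^* T V] on the vertices involved.
   If some vertex [z] of the component has two incoming edges [e <> f], take
   [w_x = a b^(N+i_x) a p_x] with [a], [b] the first-return cycles through [e] and
   [f]: such words have no period [<= N], and [V^* T V] loses all coefficients of
   length between [1] and [N]. Otherwise the component is a single vertex or a
   simple cycle, and one averages over the words of length [< m] as well. Averaging
   over the signs removes the terms between distinct vertices, hence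
   [|T| <= |d|] as a form on finitely supported vectors.

   Finally [T] is a limit of its Fejer means, cut off to finitely many edges and
   vertices; these are polynomials in the generators of norm at most that of [T],
   being averages of compressions of [T] to blocks. *)

From HB Require Import structures.
From mathcomp Require Import all_boot all_order all_algebra.
From mathcomp Require Import all_classical all_reals all_analysis.
From mathcomp Require Import finmap complex summability.
From Stdlib Require Import Relation_Operators.
From mathcomp Require Import zify ring lra.
Require Import Defs.

Set Implicit Arguments.
Unset Strict Implicit.
Unset Printing Implicit Defensive.

Import Order.TTheory GRing.Theory Num.Theory.
Import numFieldNormedType.Exports.
Import Normc.

Local Open Scope ring_scope.

(** * Words and paths *)

HB.instance Definition _ G := gen_eqMixin (vertex G).
HB.instance Definition _ G := gen_eqMixin (edge G).

Section words.
Variable G : digraph.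
Implicit Types (x y z : vertex G) (e : edge G) (s t u v w : seq (edge G)).

Definition ispath x y s := composable x s /\ path_rng x s = y.

Lemma path_rng_cat x s t : path_rng x (s ++ t) = path_rng (path_rng x t) s.
Proof. by case: s. Qed.

Lemma composable_cat x s t :
  composable x (s ++ t) <-> composable x t /\ composable (path_rng x t) s.
Proof.
elim: s => [|e s ih] /=; first by split=> // -[].
by rewrite path_rng_cat ih; tauto.
Qed.

Lemma ispath_nil x : ispath x x [::].
Proof. by []. Qed.

Lemma ispath_edge e : ispath (src e) (rng e) [:: e].
Proof. by []. Qed.

Lemma ispath_cat x y z s t : ispath x y t -> ispath y z s -> ispath x z (s ++ t).
Proof.
move=> [xt <-] [ts <-]; split; last by rewrite path_rng_cat.
exact/composable_cat.
Qed.

Lemma ispath_catP x z s t : ispath x z (s ++ t) ->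
  exists y, ispath x y t /\ ispath y z s.
Proof.
move=> [/composable_cat[xt ts] <-]; exists (path_rng x t).
by rewrite path_rng_cat.
Qed.

Lemma ispath_nilP x y : ispath x y [::] -> x = y.
Proof. by case. Qed.

Lemma ispath_consP x y e s : ispath x y (e :: s) -> y = rng e /\ ispath x (src e) s.
Proof. by move=> [/= [h1 h2] <-]. Qed.

Lemma ispath_rconsP x y e s : ispath x y (rcons s e) ->
  x = src e /\ ispath (rng e) y s.
Proof.
by rewrite -cats1 => /ispath_catP[z [/ispath_consP[-> /ispath_nilP ->]]].
Qed.

Lemma ispath_unique x y y' s : ispath x y s -> ispath x y' s -> y = y'.
Proof. by move=> [_ <-] [_ <-]. Qed.

Lemma cat_inj_size s s' t t' : size s = size s' ->
  s ++ t = s' ++ t' -> s = s' /\ t = t'.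
Proof. by move=> h /eqP; rewrite eqseq_cat// => /andP[/eqP -> /eqP ->]. Qed.

Lemma cat_inj_sizer s s' t t' : size t = size t' ->
  s ++ t = s' ++ t' -> s = s' /\ t = t'.
Proof.
move=> h h'; apply: cat_inj_size => //.
by have := congr1 size h'; rewrite !size_cat h => /addIn.
Qed.

Definition wpow u n : seq (edge G) := iter n (cat u) [::].

Lemma wpowS u n : wpow u n.+1 = u ++ wpow u n.
Proof. by []. Qed.

Lemma wpowD u m n : wpow u (m + n) = wpow u m ++ wpow u n.
Proof. by elim: m => // m ih; rewrite addSn !wpowS ih catA. Qed.

Lemma wpow1 u : wpow u 1 = u.
Proof. exact: cats0. Qed.

Lemma wpowSr u n : wpow u n.+1 = wpow u n ++ u.
Proof. by rewrite -addn1 wpowD wpow1. Qed.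

Lemma size_wpow u n : size (wpow u n) = (n * size u)%N.
Proof. by elim: n => //= n ih; rewrite size_cat ih mulSn. Qed.

Lemma ispath_wpow x u n : ispath x x u -> ispath x x (wpow u n).
Proof. by move=> h; elim: n => //= n ih; exact: ispath_cat ih h. Qed.

Lemma mem_wpow u n e : e \in wpow u n -> e \in u.
Proof. by elim: n => //= n ih; rewrite mem_cat => /orP[|/ih]. Qed.

End words.

Arguments wpow {G} u n : simpl never.

(** * The bimodule of formal sums of words *)

Section strip.
Variables (T : eqType) (C : nmodType).
Implicit Types (h : seq T -> C) (p q v w : seq T).

(* [stripr h w] and [stripl h v] are the coefficients of h.w and v.h, where
   [h] is viewed as the formal sum of the words [p] with weights [h p]. *)
Definition stripr h w q : C :=
  if suffix w q then h (take (size q - size w) q) else 0.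
Definition stripl h v q : C := if prefix v q then h (drop (size v) q) else 0.

Lemma stripr_cat h w p : stripr h w (p ++ w) = h p.
Proof. by rewrite /stripr suffix_suffix size_cat addnK take_size_cat. Qed.

Lemma stripl_cat h v p : stripl h v (v ++ p) = h p.
Proof. by rewrite /stripl prefix_prefix drop_size_cat. Qed.

Lemma stripr_id h w : stripr h w w = h [::].
Proof. exact: (stripr_cat h w [::]). Qed.

Lemma stripr_nil h q : stripr h [::] q = h q.
Proof. by have := stripr_cat h [::] q; rewrite cats0. Qed.

Lemma stripl_nil h q : stripl h [::] q = h q.
Proof. exact: (stripl_cat h [::] q). Qed.

Lemma stripr0 h w q : ~~ suffix w q -> stripr h w q = 0.
Proof. by rewrite /stripr => /negbTE ->. Qed.

Lemma stripl0 h v q : ~~ prefix v q -> stripl h v q = 0.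
Proof. by rewrite /stripl => /negbTE ->. Qed.

Lemma striprP h w q (P : C -> Prop) :
  (forall p, q = p ++ w -> P (h p)) -> (~~ suffix w q -> P 0) -> P (stripr h w q).
Proof.
move=> h1 h2; case: (boolP (suffix w q)) => [/suffixP[p pE]|nw].
  by rewrite pE stripr_cat; exact: h1.
by rewrite stripr0//; exact: h2.
Qed.

Lemma striplP h v q (P : C -> Prop) :
  (forall p, q = v ++ p -> P (h p)) -> (~~ prefix v q -> P 0) -> P (stripl h v q).
Proof.
move=> h1 h2; case: (boolP (prefix v q)) => [/prefixP[p pE]|nw].
  by rewrite pE stripl_cat; exact: h1.
by rewrite stripl0//; exact: h2.
Qed.

Lemma stripr_ext h h' w q : (forall p, q = p ++ w -> h p = h' p) ->
  stripr h w q = stripr h' w q.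
Proof.
case: (boolP (suffix w q)) => [/suffixP[p qE] hh|nq _]; last by rewrite !stripr0.
by rewrite qE !stripr_cat hh.
Qed.

Lemma stripl_ext h h' v q : (forall p, q = v ++ p -> h p = h' p) ->
  stripl h v q = stripl h' v q.
Proof.
case: (boolP (prefix v q)) => [/prefixP[p qE] hh|nq _]; last by rewrite !stripl0.
by rewrite qE !stripl_cat hh.
Qed.

(** Both sides are the coefficient at [q] of v.h.w. It lives on words of the form v p w; when [v]
    and [w] overlap in [q], both sides vanish. *)
Lemma stripl_stripr h v w q : stripl (stripr h w) v q = stripr (stripl h v) w q.
Proof.
elim/striplP: (stripl _ v q) => [p qE|nv].
  elim/striprP: (stripr h w p) => [p' pE|nw].
    by rewrite qE pE catA stripr_cat stripl_cat.
  elim/striprP: (stripr _ w q) => // p' q'E.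
  elim/striplP: (stripl _ v p') => // p'' p'E; case/negP: nw.
  move: q'E; rewrite qE p'E -catA => /eqP.
  by rewrite eqseq_cat// eqxx/= => /eqP ->; exact: suffix_suffix.
elim/striprP: (stripr _ w q) => // p' q'E.
by rewrite stripl0//; apply: contra nv; rewrite q'E => /prefix_catl.
Qed.

Lemma stripr_comp h v w q : stripr (stripr h v) w q = stripr h (v ++ w) q.
Proof.
elim/striprP: (stripr _ w q) => [p ->|nw]; last first.
  by rewrite stripr0//; apply: contra nw => /catl_suffix.
elim/striprP: (stripr _ v p) => [p' ->|nv]; first by rewrite -catA stripr_cat.
rewrite stripr0//; apply: contra nv; rewrite suffix_catl// => /andP[_ //].
Qed.

Lemma stripl_comp h v w q : stripl (stripl h w) v q = stripl h (v ++ w) q.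
Proof.
elim/striplP: (stripl _ v q) => [p ->|nv]; last first.
  by rewrite stripl0//; apply: contra nv => /catl_prefix.
elim/striplP: (stripl _ w p) => [p' ->|nw]; first by rewrite catA stripl_cat.
by rewrite stripl0//; apply: contra nw; rewrite prefix_catr// => /andP[_ //].
Qed.

End strip.

(** * Bounded cocycles on the path category *)

Section cocycles.
Variables (R : realType) (G : digraph).
Implicit Types (x y z : vertex G) (e : edge G) (p q s t u v w : seq (edge G)).

(** [gamma x w q] is the coefficient at [q] of the formal sum attached to the path [w] from [x]; the
    source is an argument because an empty word does not determine it. [M] bounds the squared l2
    norm, tested on finite sets of parallel paths. *)
Record bounded_cocycle (gamma : vertex G -> seq (edge G) -> seq (edge G) -> R[i])
    (M : R) : Prop := BoundedCocycle {
  cocycleM : forall x y z v w q, ispath x y w -> ispath y z v ->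
    ispath x z q ->
    gamma x (v ++ w) q = stripr (gamma y v) w q + stripl (gamma x w) v q;
  cocycle_bound : forall x y w (Q : seq (seq (edge G))), ispath x y w ->
    uniq Q -> (forall q, q \in Q -> ispath x y q) ->
    \sum_(q <- Q) normc (gamma x w q) ^+ 2 <= M }.

Variables (gamma : vertex G -> seq (edge G) -> seq (edge G) -> R[i]) (M : R).
Hypothesis gammaP : bounded_cocycle gamma M.

Lemma cocycle_nil x q : ispath x x q -> gamma x [::] q = 0.
Proof.
move=> xq; have := cocycleM gammaP (ispath_nil x) (ispath_nil x) xq.
rewrite stripr_nil stripl_nil.
by move=> /eqP; rewrite -subr_eq0 opprD addrA subrr sub0r oppr_eq0 => /eqP.
Qed.

Lemma natmul_sqr_bounded (c N : R) : (forall n : nat, n%:R * c ^+ 2 <= N) -> c = 0.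
Proof.
move=> h; apply/eqP; rewrite -sqrf_eq0; apply/negPn/negP => c0.
have cp : 0 < c ^+ 2 by rewrite lt_def c0 sqr_ge0.
have N0 : 0 <= N by have := h 0%N; rewrite mul0r.
have := h (Num.bound (N / c ^+ 2)); apply/negP; rewrite -ltNge -ltr_pdivrMr//.
by rewrite archi_boundP// divr_ge0// ltW.
Qed.

(** If [c] occurs at [n] places of one formal sum, then n|c|^2 <= [M]. *)
Lemma cocycle_repeat (c : R[i]) :
  (forall n, exists x y w (Q : seq (seq (edge G))), [/\ ispath x y w,
     uniq Q, size Q = n & forall q, q \in Q -> ispath x y q /\ gamma x w q = c]) ->
  c = 0.
Proof.
move=> h; apply/eq0_normc/(@natmul_sqr_bounded _ M) => n.
have [x [y [w [Q [xw uQ sQ hQ]]]]] := h n.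
have := cocycle_bound gammaP xw uQ (fun q qQ => (hQ q qQ).1).
rewrite (eq_big_seq (fun=> normc c ^+ 2)); last by move=> q /hQ[_ ->].
by rewrite big_const_seq count_predT sQ iter_addr_0 mulr_natl.
Qed.

(** Here a single coefficient grows linearly, and n|c|^2 <= |nc|^2 <= [M]. *)
Lemma cocycle_multiple (c : R[i]) :
  (forall n, exists x y w q, [/\ ispath x y w, ispath x y q
     & gamma x w q = c *+ n]) -> c = 0.
Proof.
move=> h; apply/eq0_normc/(@natmul_sqr_bounded _ M) => n.
have [x [y [w [q [xw xq wq]]]]] := h n.
have Qq p : p \in [:: q] -> ispath x y p by rewrite inE => /eqP ->.
have := cocycle_bound gammaP xw (isT : uniq [:: q]) Qq.
rewrite big_seq1 wq normcMn -[_ *+ n]mulr_natl exprMn.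
apply: le_trans; rewrite ler_wpM2r ?sqr_ge0//.
by rewrite -natrX ler_nat -mulnn; case: n {h xw xq wq} => // n; rewrite leq_pmulr.
Qed.

(** The word v w u starts with [v] and, being v u' w, also ends with [w]; so both terms of the
    cocycle identity survive. *)
Lemma cocycle_addl x y z v w u u' : ispath x y w -> ispath y z v ->
  ispath x x u -> w ++ u = u' ++ w -> ispath y y u' ->
  gamma x (v ++ w) (v ++ w ++ u) = gamma y v (v ++ u') + gamma x w (w ++ u).
Proof.
move=> xw yv xu wu yu'.
have xq : ispath x z (v ++ w ++ u) by apply: ispath_cat yv; exact: ispath_cat xw.
rewrite (cocycleM gammaP xw yv xq) stripl_cat; congr (_ + _).
by rewrite wu catA stripr_cat.
Qed.

Lemma prefix_cat_size s t w : (size w <= size t)%N ->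
  prefix w (t ++ s) = prefix w t.
Proof. by move=> wt; rewrite !prefixE takel_cat. Qed.

Lemma suffix_cat_size s t w : (size w <= size t)%N ->
  suffix w (s ++ t) = suffix w t.
Proof. by move=> wt; rewrite -!prefix_rev rev_cat prefix_cat_size ?size_rev. Qed.

(** As [w] is not a suffix of w u, only the term v.c_w survives: prolonging [w] on the left does not
    change the coefficient. *)
Lemma cocycle_catl x y z v w u : ispath x y w -> ispath y z v ->
  ispath x x u -> ~~ suffix w (w ++ u) ->
  gamma x (v ++ w) (v ++ w ++ u) = gamma x w (w ++ u).
Proof.
move=> xw yv xu wu.
have xq : ispath x z (v ++ w ++ u) by apply: ispath_cat yv; exact: ispath_cat xw.
rewrite (cocycleM gammaP xw yv xq) stripl_cat stripr0 ?add0r//.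
by rewrite suffix_cat_size// size_cat leq_addr.
Qed.

Lemma cocycle_catr x y z v w u : ispath x y w -> ispath y z v ->
  ispath z z u -> ~~ prefix v (u ++ v) ->
  gamma x (v ++ w) (u ++ v ++ w) = gamma y v (u ++ v).
Proof.
move=> xw yv zu wu.
have xq : ispath x z (u ++ v ++ w) by apply: ispath_cat zu; exact: ispath_cat yv.
rewrite (cocycleM gammaP xw yv xq) catA stripr_cat stripl0 ?addr0//.
by rewrite prefix_cat_size// size_cat leq_addl.
Qed.

(** As [u] commutes with [w], the coefficient of w^n at w^n u is n times that of [w] at w u. *)
Lemma cocycle_comm x u w : ispath x x u -> ispath x x w -> w ++ u = u ++ w ->
  gamma x w (w ++ u) = 0.
Proof.
move=> xu xw wu; apply: cocycle_multiple => n.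
exists x, x, (wpow w n), (wpow w n ++ u).
have xwn := ispath_wpow n xw; split=> //; first exact: ispath_cat xwn.
elim: n {xwn} => [|n ih]; first by rewrite cocycle_nil.
rewrite wpowSr -catA (cocycle_addl xw (ispath_wpow n xw) xu wu xu) ih.
by rewrite -mulrSr.
Qed.

Lemma uniq_map_ltn n (f : nat -> seq (edge G)) :
  (forall i j, (i < j < n)%N -> f i <> f j) -> uniq [seq f i | i <- iota 0 n].
Proof.
move=> fij; rewrite map_inj_in_uniq ?iota_uniq// => i j.
rewrite !mem_iota !add0n /= => ilt jlt eqf.
case: (ltngtP i j) => // ij.
- by case: (fij i j); rewrite ?ij.
- by case: (fij j i); rewrite ?ij.
Qed.

(* Inserting [u] at each of the junctions of the power of [B ++ A] gives as many
   words as wished at which [gamma] takes the value on the left. *)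
Lemma cocycle_insert x u A B : ispath x x A -> ispath x x B -> ispath x x u ->
  ~~ suffix A (A ++ u) -> ~~ prefix B (u ++ B) ->
  gamma x A (A ++ u) + gamma x B (u ++ B) = 0.
Proof.
move=> xA xB xu Au Bu; apply: cocycle_repeat => n.
pose X := B ++ A; have xX : ispath x x X by exact: ispath_cat xB.
pose f j := wpow X j.+1 ++ u ++ wpow X (n - j).
exists x, x, (wpow X n.+1), [seq f i | i <- iota 0 n].
have xf j : ispath x x (f j).
  by apply: ispath_cat (ispath_wpow _ xX); apply: ispath_cat (ispath_wpow _ xX) xu.
split; first exact: ispath_wpow.
- apply: uniq_map_ltn => i j /andP[ij jn] /=.
  (* If two insertions agree, cancelling the common left power leaves [B] as a prefix of u B. *)
  rewrite /f; have -> : j.+1 = (i.+1 + (j - i).-1.+1)%N by lia.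
  rewrite wpowD -[in X in _ = X]catA => /eqP; rewrite eqseq_cat// eqxx/= => /eqP.
  have -> : (n - i = (n - i).-1.+1)%N by lia.
  rewrite !wpowS {1}/X -!catA => h; move/negP: Bu; apply.
  rewrite -(@prefix_cat_size (A ++ wpow X (n - i).-1)) ?size_cat ?leq_addl//.
  by rewrite -catA h prefix_prefix.
- by rewrite size_map size_iota.
move=> q /mapP[j]; rewrite mem_iota add0n/= => jn ->; split=> //.
(* Split at the insertion: the left power ends in [A] and the right one starts with [B], and each
   contributes one of the two summands. *)
have -> : n.+1 = (j.+1 + (n - j))%N by lia.
rewrite wpowD (cocycleM gammaP (ispath_wpow _ xX) (ispath_wpow _ xX) (xf j)).
rewrite /f {1}catA stripr_cat stripl_cat; congr (_ + _).
  have -> : wpow X j.+1 = (wpow X j ++ B) ++ A by rewrite wpowSr catA.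
  rewrite -[X in gamma _ _ X]catA; apply: (@cocycle_catl x x x) => //.
  by apply: (ispath_cat xB); exact: ispath_wpow.
have -> : (n - j = (n - j).-1.+1)%N by lia.
have -> : wpow X (n - j).-1.+1 = B ++ (A ++ wpow X (n - j).-1).
  by rewrite wpowS /X -catA.
apply: (@cocycle_catr x x x) => //.
by apply: (ispath_cat _ xA); exact: ispath_wpow.
Qed.

Hypothesis path_sym : forall x y w, ispath x y w -> exists r, ispath y x r.

(** With [r] a path back, the word e (r e)^n contains many copies of [e]; replacing one of them by
    [q] gives [n] paths with the same coefficient. They are distinct because [q] does not start with
    [e], and the other cocycle term vanishes because [q] does not end with [e]. *)
Lemma cocycle_edge0 e q : ispath (src e) (rng e) q ->
  ~~ prefix [:: e] q -> ~~ suffix [:: e] q -> gamma (src e) [:: e] q = 0.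
Proof.
move=> eq eNq qNe; have [q0|qn0] := eqVneq q [::].
  (* An empty [q] makes [e] a loop. All replacements in e^n then give e^(n-1), and their
     contributions add up. *)
  subst q; have /ispath_nilP ee := eq.
  apply: cocycle_multiple => n.
  exists (src e), (src e), (wpow [:: e] n), (wpow [:: e] n.-1).
  have le : ispath (src e) (src e) [:: e] by rewrite {2}ee.
  have we m := ispath_wpow m le.
  split=> //; elim: n => [|n ih]; first by rewrite cocycle_nil// mulr0n.
  rewrite wpowS (cocycleM gammaP (we n) le)//= stripr_id mulrS.
  congr (_ + _); case: n ih => [|n ih]; first by rewrite mulr0n.
  by rewrite [X in stripl _ _ X]wpowS stripl_cat.
have [r er] := path_sym (ispath_edge e).
pose Y := e :: r; pose Z := rcons r e.
have yY : ispath (rng e) (rng e) Y by rewrite /Y -cat1s; exact: ispath_cat er (ispath_edge e).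
have xZ : ispath (src e) (src e) Z by rewrite /Z -cats1; exact: ispath_cat (ispath_edge e) er.
have yYn n := ispath_wpow n yY; have xZn n := ispath_wpow n xZ.
have YeZ j : wpow Y j ++ [:: e] = [:: e] ++ wpow Z j.
  elim: j => // j ih; rewrite !wpowS -catA ih /Z -cats1 -!catA/=; congr cons.
apply: cocycle_repeat => n.
pose f j := wpow Y j ++ q ++ wpow Z (n - j).
exists (src e), (rng e), ([:: e] ++ wpow Z n), [seq f i | i <- iota 0 n].
have xf j : ispath (src e) (rng e) (f j).
  by apply: ispath_cat (yYn _); apply: ispath_cat (xZn _) _.
split.
- by apply: ispath_cat (ispath_edge e); exact: xZn.
- apply: uniq_map_ltn => i j /andP[ij jn] /=.
  have -> : j = (i + (j - i).-1.+1)%N by lia.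
  rewrite /f wpowD -!catA => /eqP; rewrite eqseq_cat// eqxx/= => /eqP h.
  move/negP: eNq; apply; move: h qn0; case: (q) => //= a q' [-> _] _.
  by rewrite /= eqxx prefix0s.
- by rewrite size_map size_iota.
move=> p /mapP[j]; rewrite mem_iota add0n/= => jn ->; split=> //.
have -> : n = (j + (n - j))%N by lia.
have eZ : ispath (src e) (rng e) ([:: e] ++ wpow Z (n - j)).
  by apply: ispath_cat (ispath_edge e); exact: xZn.
rewrite -cat1s wpowD catA -YeZ -catA.
rewrite (cocycleM gammaP eZ (yYn j) (xf j)) /f.
have q0 : (size [:: e] <= size q)%N by case: (q) qn0.
rewrite stripl_cat -stripr_comp catA stripr_cat stripr0 ?suffix_cat_size//.
have eqZ : ispath (src e) (rng e) (q ++ wpow Z (n - j)) by exact: ispath_cat eq.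
rewrite add0r (cocycleM gammaP (xZn (n - j)%N) (ispath_edge e) eqZ).
by rewrite stripr_cat stripl0 ?addr0// prefix_cat_size.
Qed.

End cocycles.

(** * Bounded cocycles are coboundaries *)

Section normalization.
Variables (R : realType) (G : digraph).
Implicit Types (x y z : vertex G) (e : edge G) (p q s t u v w : seq (edge G)).

Variables (gamma : vertex G -> seq (edge G) -> seq (edge G) -> R[i]).
Local Notation potential := (vertex G -> seq (edge G) -> R[i]).

Definition primitive_on (K : vertex G -> Prop) (sigma : potential) : Prop :=
  forall e q, K (src e) -> ispath (src e) (rng e) q ->
  gamma (src e) [:: e] q =
  stripl (sigma (src e)) [:: e] q - stripr (sigma (rng e)) [:: e] q.

(* On the vertices in [F], the isometries of the words [W i] conjugate the
   operator with coefficients [sigma] to operators whose average over [i]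
   vanishes up to length [N]. *)
Definition averaging_words (sigma : potential) (N : nat) (F : seq (vertex G))
    (m : nat) (W : nat -> vertex G -> seq (edge G)) : Prop :=
  [/\ (0 < m)%N,
      forall i x, x \in F -> composable x (W i x),
      forall i x y z p p', x \in F -> y \in F -> ispath z x p ->
        ispath z y p' -> W i x ++ p = W i y ++ p' -> x = y
    & forall x z a b, x \in F -> ispath z x a -> ispath z x b ->
        (size a <= N)%N -> (size b <= N)%N ->
        \sum_(i < m) stripr (sigma (path_rng x (W i x)))
                            (W i x ++ a) (W i x ++ b) = 0].

Definition averaged_on (K : vertex G -> Prop) (sigma : potential) : Prop :=
  forall N F, (forall x, x \in F -> K x) ->
  exists m W, averaging_words sigma N F m W.

Variable M : R.
Hypothesis gammaP : bounded_cocycle gamma M.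
Hypothesis path_sym : forall x y w, ispath x y w -> exists r, ispath y x r.

(** Coboundaries satisfy the cocycle identity too, the two middle terms e.sigma.w cancelling; so
    agreement on edges propagates to words. *)
Lemma primitive_word K sigma x y w q : primitive_on K sigma ->
  (forall x y w, ispath x y w -> K x -> K y) ->
  K x -> ispath x y w -> ispath x y q ->
  gamma x w q = stripl (sigma x) w q - stripr (sigma y) w q.
Proof.
move=> sE Kp Kx; elim: w y q => [|e w ih] y q.
  move=> /ispath_nilP <- xq.
  by rewrite (cocycle_nil gammaP xq) stripl_nil stripr_nil subrr.
move=> /ispath_consP[-> xw] xq; rewrite -cat1s.
rewrite (cocycleM gammaP xw (ispath_edge e) xq).
have -> : stripr (gamma (src e) [:: e]) w q =
    stripr (stripl (sigma (src e)) [:: e]) w q -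
    stripr (stripr (sigma (rng e)) [:: e]) w q.
  case: (boolP (suffix w q)) => [/suffixP[p qE]|nwq]; last first.
    by rewrite !stripr0 ?subrr.
  rewrite qE !stripr_cat; apply: sE; first exact: Kp xw Kx.
  by move: xq; rewrite qE => /ispath_catP[y' [/ispath_unique/(_ xw) <-]].
have -> : stripl (gamma x w) [:: e] q =
    stripl (stripl (sigma x) w) [:: e] q - stripl (stripr (sigma (src e)) w) [:: e] q.
  case: (boolP (prefix [:: e] q)) => [/prefixP[p qE]|nwq]; last first.
    by rewrite !stripl0 ?subrr.
  rewrite qE !stripl_cat; apply: ih => //.
  by move: xq; rewrite qE => /ispath_consP[].
by rewrite stripr_comp stripl_comp stripl_stripr addrC addrA subrK.
Qed.

(** * Words at a vertex with two incoming edges *)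

Section branching.
Variables (z : vertex G) (e f : edge G).
Hypotheses (ez : rng e = z) (fz : rng f = z) (ef : e <> f).

Let K x := exists p, ispath x z p.

(** Keep the part of the path traversed after its last visit to [x]. *)
Lemma first_return x y s : ispath x y s ->
  exists s', ispath x y s' /\ forall g, g \in s' -> rng g <> x.
Proof.
elim: s y => [|g s ih] y; first by move=> /ispath_nilP <-; exists [::].
move=> /ispath_consP[-> xs]; have [gx|gx] := pselect (rng g = x).
  by exists [::]; rewrite gx.
have [s' [xs' s'P]] := ih _ xs; exists (g :: s'); split.
  by rewrite -cat1s; exact: ispath_cat xs' (ispath_edge g).
by move=> h; rewrite inE => /predU1P[->//|/s'P].
Qed.

Lemma return_avoiding g : rng g = z ->
  exists s, ispath z (src g) s /\ forall h, rng h = z -> h \notin s.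
Proof.
move=> gz; have [r] := path_sym (ispath_edge g).
rewrite gz => /first_return[s [zs sP]].
by exists s; split=> // h hz; apply/negP => /sP.
Qed.

Lemma index_cat_cons (g : edge G) s t : g \notin s -> index g (s ++ g :: t) = size s.
Proof. by move=> gs; rewrite index_cat (negbTE gs)/= eqxx addn0. Qed.

(** The words are e a (f b)^(N+i) e a r_x, where e a and f b are first-return cycles at [z]. After
    the initial [e] the letter [e] reappears only at a distance greater than [N], which rules out
    short periods; that distance also determines [i]. *)
Lemma marked_words : exists W : nat -> nat -> vertex G -> seq (edge G),
  [/\ forall N i x, K x -> ispath x z (W N i x),
      forall N i x u u', (0 < size u <= N)%N -> u ++ W N i x <> W N i x ++ u'
    & forall N i j x y p p', W N i x ++ p = W N j y ++ p' -> i = j].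
Proof.
have [a [za aN]] := return_avoiding ez.
have [b [zb bN]] := return_avoiding fz.
have /choice[r rP] : forall x, exists r, K x -> ispath x z r.
  move=> x; have [[r xr]|nK] := pselect (K x); first by exists r.
  by exists [::].
have zfb : ispath z z (f :: b).
  by rewrite -cat1s -{2}fz; exact: ispath_cat zb (ispath_edge f).
have zea : ispath z z (e :: a).
  by rewrite -cat1s -{2}ez; exact: ispath_cat za (ispath_edge e).
pose Y k := a ++ wpow (f :: b) k.
have eY k : e \notin Y k.
  rewrite mem_cat negb_or aN//=; apply: contra (bN _ ez) => /mem_wpow.
  by rewrite inE => /predU1P[/ef|].
have sY k : size (Y k) = (size a + k * (size b).+1)%N by rewrite size_cat size_wpow.
have zY k : ispath z (src e) (Y k) by apply: (ispath_cat _ za); exact: ispath_wpow.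
have zeY k : ispath z z (e :: Y k).
  by rewrite -cat1s -{2}ez; apply: (ispath_cat _ (ispath_edge e)).
clearbody Y.
exists (fun N i x => e :: Y (N + i)%N ++ e :: a ++ r x); split.
- move=> N i x /rP xr.
  rewrite -cat_cons -[e :: a ++ r x]cat_cons; apply: (ispath_cat _ (zeY _)).
  exact: ispath_cat xr zea.
- move=> N i x u u' /andP[u0 uN] h.
  (* At position [size u] the left side has the initial [e] of the word, while the right side is
     still inside the block [Y], which is free of [e]. *)
  have := congr1 (fun l => nth e l (size u)) h.
  rewrite nth_cat ltnn subnn [LHS]/= cat_cons /=.
  case: (size u) u0 uN => // k _ kN /=.
  rewrite -catA nth_cat sY ifT; last by nia.
  move=> eE; move: (eY (N + i)%N); rewrite {1}eE mem_nth// sY; nia.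
- move=> N i j x y p p' [] /(congr1 (index e)).
  by rewrite -!catA /= !index_cat_cons// !sY => /addnI/eqP; rewrite eqn_mul2r/= => /eqP/addnI.
Qed.

(** Two cycles at [x] pass through [z], one along [e] and one along [f]. A prefix [B] of u B is
    compatible with the powers of [u]; if both cycles were such prefixes, they would carry the same
    letter at position [size q], where one has [e] and the other [f]. *)
Lemma nonperiodic_word x u : K x -> ispath x x u -> u <> [::] ->
  exists B, ispath x x B /\ ~~ prefix B (u ++ B).
Proof.
move=> [p xp] xu u0; have [q zq] := path_sym xp.
have [a [za _]] := return_avoiding ez.
have [b [zb _]] := return_avoiding fz.
have loop g c : rng g = z -> ispath z (src g) c -> ispath x x (q ++ g :: c ++ p).
  move=> gz zc; apply: (ispath_cat _ zq).
  rewrite -cat1s -gz; apply: (ispath_cat _ (ispath_edge g)).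
  exact: ispath_cat xp zc.
have [hBe|nB] := boolP (prefix (q ++ e :: a ++ p) (u ++ q ++ e :: a ++ p)); last first.
  by exists (q ++ e :: a ++ p); split=> //; exact: loop.
have [hBf|nB] := boolP (prefix (q ++ f :: b ++ p) (u ++ q ++ f :: b ++ p)); last first.
  by exists (q ++ f :: b ++ p); split=> //; exact: loop.
have per B k : prefix B (u ++ B) -> prefix B (wpow u k ++ B).
  move=> uB; elim: k => [|k ih]; first exact: prefix_refl.
  apply: prefix_trans uB _; rewrite wpowS -catA prefix_catr// eqxx.
  exact: ih.
have nthB B : prefix B (u ++ B) -> (size q < size B)%N ->
    nth e B (size q) = nth e (wpow u (size q).+1) (size q).
  move=> /per-/(_ (size q).+1) /prefixP[t tE] qB.
  have := congr1 (fun l => nth e l (size q)) tE.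
  rewrite !nth_cat size_wpow qB ifT//.
  by case: (u) u0 => //= g u' _; nia.
have := nthB _ hBe; have := nthB _ hBf.
rewrite !size_cat/= !addnS !ltnS !leq_addr !nth_cat ltnn subnn/=.
by move=> /(_ isT) <- /(_ isT) /ef.
Qed.

End branching.
End normalization.

(** * The potential of a branching component *)

Section branching_solution.
Variables (R : realType) (G : digraph).
Implicit Types (x y z : vertex G) (e : edge G) (p q s t u v w : seq (edge G)).
Variables (gamma : vertex G -> seq (edge G) -> seq (edge G) -> R[i]) (M : R).
Hypothesis gammaP : bounded_cocycle gamma M.
Hypothesis path_sym : forall x y w, ispath x y w -> exists r, ispath y x r.

(** For a path [r] back, the diagonal coefficients of [r] and [w] add up to that of the cycle r w,
    which is zero since the empty word commutes with it. *)
Lemma cocycle_diag x y w w' : ispath x y w -> ispath x y w' ->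
  gamma x w w = gamma x w' w'.
Proof.
move=> xw xw'; have [r yr] := path_sym xw.
have E v : ispath x y v -> gamma y r r + gamma x v v = 0.
  move=> xv; have xrv := ispath_cat xv yr.
  have := cocycle_addl gammaP xv yr (ispath_nil x) (_ : v ++ [::] = [::] ++ v) (ispath_nil y).
  rewrite !cats0 => <- //.
  have := cocycle_comm gammaP (ispath_nil x) xrv (_ : _ ++ [::] = _).
  by rewrite !cats0 /=; apply.
by apply: (addrI (gamma y r r)); rewrite !E.
Qed.

Lemma suffix_period u w : suffix w (w ++ u) ->
  exists2 u', w ++ u = u' ++ w & size u' = size u.
Proof.
move=> /suffixP[u' wu]; exists u' => //.
by have /eqP := congr1 size wu; rewrite !size_cat addnC eqn_add2r => /eqP.
Qed.

Variables (z : vertex G) (e f : edge G).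
Hypotheses (ez : rng e = z) (fz : rng f = z) (ef : e <> f).

Let K x := exists p, ispath x z p.

(** By [cocycle_insert] the coefficient of [A] at A u, for [A] not a suffix of A u, is the opposite
    of a coefficient that does not involve [A]. Its value, independent of [A], serves as potential
    at a nonempty cycle [u]. *)
Lemma branching_solution :
  exists sigma, primitive_on gamma K sigma /\ averaged_on K sigma.
Proof.
have [W [Wz Wap Winj]] := marked_words path_sym ez fz ef.
have Wsuf N i x u : (0 < size u <= N)%N -> ~~ suffix (W N i x) (W N i x ++ u).
  move=> uN; apply/negP => /suffix_period[u' wu uu'].
  by apply: (Wap N i x u' u); rewrite ?uu'.
have Kpath x y w : ispath x y w -> K x -> K y.
  move=> /path_sym[r yr] [p xp]; exists (p ++ r); exact: ispath_cat xp.
(* The parameter [size u] excludes the period that would make the word a suffix of its product with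
   [u]. For empty [u] this is the diagonal coefficient of a path to [z], in general not zero. *)
pose sigma x u := gamma x (W (size u) 0%N x) (W (size u) 0%N x ++ u).
have sigmaL x u B : K x -> ispath x x u -> u <> [::] -> ispath x x B ->
    ~~ prefix B (u ++ B) -> sigma x u + gamma x B (u ++ B) = 0.
  move=> Kx xu u0 xB uB; have xw := Wz (size u) 0%N x Kx; have [r zr] := path_sym xw.
  have uS : (0 < size u <= size u)%N by rewrite leqnn andbT; case: (u) u0.
  have nS := Wsuf _ 0%N x _ uS.
  rewrite -(cocycle_insert gammaP (ispath_cat xw zr) xB xu _ uB).
    by rewrite -catA (cocycle_catl gammaP xw zr xu nS).
  rewrite -catA; apply: contra nS => /catl_suffix.
  by rewrite suffix_cat_size// size_cat leq_addr.
have sigmaR x y u w : K x -> ispath x x u -> u <> [::] -> ispath x y w ->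
    ~~ suffix w (w ++ u) -> gamma x w (w ++ u) = sigma x u.
  move=> Kx xu u0 xw nS; have [r yr] := path_sym xw.
  have [B [xB uB]] := nonperiodic_word path_sym ez fz ef Kx xu u0.
  apply/eqP; rewrite -(inj_eq (addIr (gamma x B (u ++ B)))) (sigmaL _ _ B)//.
  rewrite -(cocycle_insert gammaP (ispath_cat xw yr) xB xu _ uB).
    by rewrite -catA (cocycle_catl gammaP xw yr xu nS).
  rewrite -catA; apply: contra nS => /catl_suffix.
  by rewrite suffix_cat_size// size_cat leq_addr.
exists sigma; split.
  move=> g q Kg gq; have Kg' := Kpath _ _ _ (ispath_edge g) Kg.
  have Wg := Wz _ _ _ Kg'.
  (* Each of the two potentials occurs only if [g] can be stripped from the corresponding side of
     [q]. *)
  have [|gNq] := boolP (prefix [:: g] q); have [|qNg] := boolP (suffix [:: g] q).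
  - move=> /suffixP[u' qu'] /prefixP[u qu].
    rewrite {2}qu {2}qu' stripl_cat stripr_cat.
    have xu : ispath (src g) (src g) u by move: gq; rewrite qu => /ispath_consP[].
    have xu' : ispath (rng g) (rng g) u'.
      by move: gq; rewrite qu' cats1 => /ispath_rconsP[].
    have uu' : size u = size u'.
      by have /eqP := congr1 size qu; rewrite qu' !size_cat addnC eqn_add2l => /eqP.
    have [u0|u0] := pselect (u = [::]).
      have u'0 : u' = [::] by apply: size0nil; rewrite -uu' u0.
      rewrite {}qu {}u0 {}u'0 /sigma !cats0.
      rewrite (cocycle_diag (Wz 0%N 0%N _ Kg) (ispath_cat (ispath_edge g) (Wz 0%N 0%N _ Kg'))).
      have := cocycle_addl gammaP (ispath_edge g) (Wz 0%N 0%N _ Kg') (ispath_nil _)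
        (erefl : [:: g] ++ [::] = [::] ++ [:: g]) (ispath_nil _).
      by rewrite !cats0 => ->; rewrite addrC addKr.
    have u'0 : u' <> [::] by move=> u'0; apply/u0/size0nil; rewrite uu' u'0.
    have wg := ispath_cat (ispath_edge g) (Wz (size u') 0%N _ Kg').
    rewrite -(sigmaR _ _ _ _ Kg xu u0 wg); last first.
      rewrite -catA -qu qu' catA suffix_catl// eqxx; apply: Wsuf.
      by rewrite leqnn andbT; case: (u') u'0.
    rewrite -catA (cocycle_addl gammaP (ispath_edge g) (Wz _ _ _ Kg') xu _ xu');
      last by rewrite -qu.
    by rewrite -qu addrAC subrr add0r.
  - move=> /prefixP[u qu]; rewrite (stripr0 _ qNg) subr0 qu stripl_cat.
    have xu : ispath (src g) (src g) u by move: gq; rewrite qu => /ispath_consP[].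
    apply: sigmaR (ispath_edge g) _ => //; last by rewrite -qu.
    by move=> u0; move: qNg; rewrite qu u0 cats0 suffix_refl.
  - move=> /suffixP[u qu]; rewrite (stripl0 _ gNq) sub0r qu stripr_cat.
    have [r gr] := path_sym (ispath_edge g).
    have yu : ispath (rng g) (rng g) u.
      by move: gq; rewrite qu cats1 => /ispath_rconsP[].
    have u0 : u <> [::] by move=> u0; move: gNq; rewrite qu u0 prefix_refl.
    have nP : ~~ prefix ([:: g] ++ r) (u ++ [:: g] ++ r).
      apply: contra gNq => /catl_prefix; rewrite catA -qu prefix_cat_size// qu size_cat.
      exact: leq_addl.
    have := sigmaL _ _ _ Kg' yu u0 (ispath_cat gr (ispath_edge g)) nP.
    have ruP : ispath (rng g) (rng g) (u ++ [:: g] ++ r).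
      by apply: (ispath_cat _ yu); exact: ispath_cat gr (ispath_edge g).
    rewrite (cocycleM gammaP gr (ispath_edge g) ruP) catA stripr_cat stripl0.
      by rewrite addr0 addrC => /eqP; rewrite addr_eq0 => /eqP.
    by rewrite -qu prefix_cat_size// qu size_cat leq_addl.
  - rewrite (stripr0 _ qNg) (stripl0 _ gNq) subr0.
    exact: (cocycle_edge0 gammaP path_sym).
(* A single word per vertex suffices; the position of [x] in [F] is the marker that keeps the words
   incomparable. *)
move=> N F FK; exists 1%N, (fun _ x => W N (index x F) x); split=> //.
- by move=> _ x /FK/Wz-/(_ N (index x F))[].
- move=> _ x y x0 p p' xF yF _ _ /Winj ij.
  by rewrite -(nth_index x xF) ij nth_index.
move=> x z' a b xF xa xb aN bN; rewrite big_ord1.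
set w := W _ _ _; have xw : ispath x z w by apply: Wz; exact: FK.
have [_ ->] := xw; elim/striprP: (stripr _ _ _) => // p pE.
have [->|p0] := eqVneq p [::].
  have Kz : K z by exists [::].
  have zW := Wz 0%N 0%N z Kz; rewrite /sigma /=.
  by apply: (cocycle_comm gammaP) => //; rewrite cats0.
have pb : (size p <= size b)%N.
  by have /eqP := congr1 size pE; rewrite !size_cat addnCA eqn_add2l => /eqP ->; exact: leq_addr.
(* The first [size p + size w] letters give an equation p w = w u' with 0 < [size p] <= [N],
   excluded by [Wap]. *)
have := congr1 (take (size p + size w)) pE.
rewrite catA -[X in take X (_ ++ a)]size_cat take_size_cat// take_cat ltnNge leq_addl/= addnK.
move/esym/Wap; case; rewrite (leq_trans pb bN) andbT.
by case: (p) p0.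
Qed.

End branching_solution.

(** * The potential of a component with unique incoming edges *)

Section nonbranching_solution.
Variables (R : realType) (G : digraph).
Implicit Types (x y z : vertex G) (e : edge G) (p q s t u v w : seq (edge G)).
Variables (gamma : vertex G -> seq (edge G) -> seq (edge G) -> R[i]) (M : R).
Hypothesis gammaP : bounded_cocycle gamma M.
Hypothesis path_sym : forall x y w, ispath x y w -> exists r, ispath y x r.

Variable z : vertex G.
Let K x := exists p, ispath x z p.
Hypothesis in_unique : forall e f, rng e = rng f -> K (rng e) -> e = f.

Let Kpath x y w : ispath x y w -> K x -> K y.
Proof.
by move=> /path_sym[r yr] [p xp]; exists (p ++ r); exact: ispath_cat xp.
Qed.

Lemma path_unique_to x x' y s s' : K y -> ispath x y s -> ispath x' y s' ->
  size s = size s' -> s = s'.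
Proof.
elim: s s' y => [|e s ih] [|e' s']//= y Ky.
move=> /ispath_consP[yE xs] /ispath_consP[yE' xs'] [ss].
have ee : e = e' by apply: in_unique; rewrite -?yE.
subst e'; rewrite (ih s' (src e))//.
by have [r er] := path_sym (ispath_edge e); apply: Kpath er _; rewrite -yE.
Qed.

(** The closed paths r e r' f and r' f r e have equal length and the same end, hence coincide; their
    rightmost letters are [f] and [e]. *)
Lemma out_unique e f : src e = src f -> K (src e) -> e = f.
Proof.
move=> ef Ke; have [r er] := path_sym (ispath_edge e).
have [r' fr'] := path_sym (ispath_edge f).
have eP : ispath (src e) (src e) (r ++ [:: e]) by exact: ispath_cat er.
have fP : ispath (src e) (src e) (r' ++ [:: f]).
  by rewrite ef; exact: ispath_cat fr'.
have : (r ++ [:: e]) ++ (r' ++ [:: f]) = (r' ++ [:: f]) ++ (r ++ [:: e]).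
  apply: (path_unique_to Ke (ispath_cat fP eP) (ispath_cat eP fP)).
  by rewrite !size_cat addnC.
by rewrite !cats1 -!rcons_cat => /rcons_inj[].
Qed.

Lemma path_unique_from x y y' s s' : K x -> ispath x y s -> ispath x y' s' ->
  size s = size s' -> s = s'.
Proof.
elim/last_ind: s s' x => [|s e ih] s' x Kx; first by move=> _ _ /esym/size0nil.
elim/last_ind: s' => [|s' e' _]; first by rewrite size_rcons.
rewrite !size_rcons => /ispath_rconsP[xE es] /ispath_rconsP[xE' es'] [ss].
have ee : e = e' by apply: out_unique; rewrite -?xE.
subst e'; rewrite (ih s' (rng e))//.
by apply: Kpath (ispath_edge e) _; rewrite -xE.
Qed.

(** The right end of w u of length [size w] is a path from [x], hence equal to [w]. *)
Lemma cycle_shift x y w u : K x -> ispath x y w -> ispath x x u ->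
  exists u', [/\ w ++ u = u' ++ w, ispath y y u' & size u' = size u].
Proof.
move=> Kx xw xu; have xwu := ispath_cat xu xw.
have := xwu; rewrite -{1}(cat_take_drop (size u) (w ++ u)) => /ispath_catP[y' [xd yt]].
have dw : drop (size u) (w ++ u) = w.
  by apply: (path_unique_from Kx xd xw); rewrite size_drop size_cat addnK.
exists (take (size u) (w ++ u)); split.
- by rewrite -[LHS](cat_take_drop (size u)) dw.
- by move: xd yt; rewrite dw => /ispath_unique/(_ xw) ->.
- by rewrite size_takel// size_cat leq_addl.
Qed.

(** Nonperiodic words are replaced by an average over the unique paths of length [i] from [x], for
    [i] below the length [m] of some nonempty cycle, not necessarily a minimal one. *)
Lemma nonbranching_solution :
  exists sigma, primitive_on gamma K sigma /\ averaged_on K sigma.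
Proof.
have Kz : K z by exists [::].
(* Without a nonempty cycle at [z] the component has no edges, since an edge could be closed up to
   such a cycle. *)
have [noc|] := pselect (forall c, ispath z z c -> c = [::]).
  exists (fun _ _ => 0); split.
    move=> e q [p ep].
    have [r er] := path_sym (ispath_edge e).
    have [p' zp'] := path_sym ep.
    have := noc _ (ispath_cat zp' (ispath_cat (ispath_edge e) (ispath_cat er ep))).
    by move=> /(congr1 size); rewrite !size_cat/= => ?; lia.
  move=> N F FK; exists 1%N, (fun _ _ => [::]); split=> //.
    by move=> _ x y x0 s p p' _ /= xp yp pp; apply: ispath_unique xp _; rewrite pp.
  move=> x z' a b _ _ _ _ _; rewrite big_ord1.
  by elim/striprP: (stripr _ _ _).
move=> /existsNP[c /not_implyP[zc c0]]; pose m := size c.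
have m0 : (0 < m)%N by rewrite lt0n size_eq0; exact/eqP.
have cyc x : K x -> exists2 cx, ispath x x cx & size cx = m.
  move=> [p /path_sym[w zw]].
  by have [c' [_ xc' sc']] := cycle_shift Kz zw zc; exists c'.
have /choice[W WP] : forall ix : nat * vertex G, exists s, K ix.2 ->
    size s = ix.1 /\ composable ix.2 s.
  move=> [i x]; have [Kx|nK] := pselect (K x); last by exists [::].
  have [p xp] := Kx.
  (* As [c] is not empty, c^i p has length at least [i]; its rightmost [i] letters are the path
     sought. *)
  have [] := ispath_cat xp (ispath_wpow i zc).
  set l := wpow c i ++ p; rewrite -(cat_take_drop (size l - i) l).
  move=> /composable_cat[xd _] _; exists (drop (size l - i) l) => _; split=> //=.
  rewrite size_drop subKn// size_cat size_wpow.
  by apply: leq_trans (leq_addr _ _); rewrite leq_pmulr.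
have Wsize i x : K x -> size (W (i, x)) = i by move=> /(WP (i, x))[].
have Wpath i x : K x -> ispath x (path_rng x (W (i, x))) (W (i, x)).
  by move=> /(WP (i, x))[].
pose A x u i := gamma x (W (i, x)) (W (i, x) ++ u).
pose sigma x u := m%:R^-1 * \sum_(i < m) A x u i.
have m0R : m%:R != 0 :> R[i] by rewrite pnatr_eq0 -lt0n.
have msigma x u : m%:R * sigma x u = \sum_(i < m) A x u i.
  by rewrite /sigma mulVKf.
have prim : primitive_on gamma K sigma.
  move=> g q Kg gq; have Kg' := Kpath (ispath_edge g) Kg.
  have [q0|q0] := eqVneq q [::].
    by rewrite (cocycle_edge0 gammaP path_sym)// ?stripl0 ?stripr0 ?subrr// q0.
  have [u qu] : exists u, q = [:: g] ++ u.
    move: gq q0; case: (q) => // h u /ispath_consP[gh _] _; exists u.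
    by rewrite (in_unique gh Kg').
  have [u' qu'] : exists u, q = u ++ [:: g].
    move: gq q0; case/lastP: (q) => // u' h /ispath_rconsP[gh _] _; exists u'.
    by rewrite (out_unique gh Kg) cats1.
  rewrite {2}qu {2}qu' stripl_cat stripr_cat.
  have xu : ispath (src g) (src g) u by move: gq; rewrite qu => /ispath_consP[].
  have xu' : ispath (rng g) (rng g) u'.
    by move: gq; rewrite qu' cats1 => /ispath_rconsP[].
  apply: (mulfI m0R); rewrite mulrBr !msigma.
  (* The path of length i+1 from [src g] is [g] followed by the path of length [i] from [rng g].
     Summation over [i] gives the equation for [sigma], because the terms of index 0 and [m]
     vanish. *)
  have AS i : A (src g) u i.+1 = A (rng g) u' i + gamma (src g) [:: g] q.
    have Wi := Wpath i _ Kg'.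
    rewrite /A; have -> : W (i.+1, src g) = W (i, rng g) ++ [:: g].
      apply: (path_unique_from Kg (Wpath i.+1 _ Kg) (ispath_cat (ispath_edge g) Wi)).
      by rewrite size_cat !Wsize// addn1.
    rewrite -catA (cocycle_addl gammaP (ispath_edge g) Wi xu _ xu') -?qu//.
  have A0 : A (src g) u 0%N = 0.
    by rewrite /A (size0nil (Wsize 0%N _ Kg)) (cocycle_nil gammaP).
  have Am : A (src g) u m = 0.
    have [cx xcx sc] := cyc _ Kg.
    rewrite /A (_ : W (m, src g) = cx); last first.
      by apply: (path_unique_from Kg (Wpath m _ Kg) xcx); rewrite Wsize.
    apply: (cocycle_comm gammaP) => //.
    apply: (path_unique_from Kg (ispath_cat xu xcx) (ispath_cat xcx xu)).
    by rewrite !size_cat addnC.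
  have : \sum_(i < m) A (src g) u i.+1 = \sum_(i < m) A (src g) u i.
    have : \sum_(i < m.+1) A (src g) u i = \sum_(i < m.+1) A (src g) u i by [].
    by rewrite {1}big_ord_recl big_ord_recr/= A0 Am add0r addr0.
  move=> <-; rewrite (eq_bigr _ (fun (i : 'I_m) _ => AS i)) big_split/= addrAC subrr add0r.
  by rewrite sumr_const card_ord mulr_natl.
exists sigma; split=> // N F FK; exists m, (fun i x => W (i, x)); split=> //.
- by move=> i x /FK/(Wpath i)[].
- move=> i x y x' p p' /FK Kx /FK Ky xp yp'.
  move=> /cat_inj_size[|_ pp]; first by rewrite !Wsize.
  by apply: ispath_unique xp _; rewrite pp.
move=> x z' a b /FK Kx xa xb _ _.
have Kz' : K z' by have [r xr] := path_sym xa; exact: Kpath xr Kx.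
have [ab|ba] := leqP (size a) (size b); last first.
  rewrite big1// => i _; rewrite stripr0//.
  by apply/negP => /size_suffix; rewrite !size_cat leq_add2l leqNgt ba.
(* By uniqueness [a] is the right end of [b]. The remaining cycle [u] yields the terms
   [sigma x u - A x u i], whose sum vanishes as [sigma x u] is their mean. *)
have [u bu] : exists u, b = u ++ a.
  exists (take (size b - size a) b).
  rewrite -{1}(cat_take_drop (size b - size a) b); congr (_ ++ _).
  move: xb; rewrite -{1}(cat_take_drop (size b - size a) b) => /ispath_catP[y [zd _]].
  by apply: (path_unique_from Kz' zd xa); rewrite size_drop subKn.
have xu : ispath x x u.
  by move: xb; rewrite bu => /ispath_catP[y [/ispath_unique/(_ xa) ->]].
rewrite (eq_bigr (fun i : 'I_m => sigma x u - A x u i)).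
  rewrite big_split/= sumr_const card_ord sumrN -msigma mulr_natl.
  by rewrite subrr.
move=> i _; have [u' [Wu yu' _]] := cycle_shift Kx (Wpath i _ Kx) xu.
rewrite bu catA Wu -catA stripr_cat /A.
rewrite (primitive_word gammaP prim Kpath Kx (Wpath i x Kx) (ispath_cat xu (Wpath i x Kx))).
by rewrite stripl_cat Wu stripr_cat opprB addrC subrK.
Qed.

End nonbranching_solution.

(** * Gluing the potentials of all components *)

Section global_solution.
Variables (R : realType) (G : digraph).
Implicit Types (x y z : vertex G) (e : edge G) (p q s t u v w : seq (edge G)).
Variables (gamma : vertex G -> seq (edge G) -> seq (edge G) -> R[i]) (M : R).
Hypothesis gammaP : bounded_cocycle gamma M.
Hypothesis path_sym : forall x y w, ispath x y w -> exists r, ispath y x r.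

Definition connected_to z x := exists p, ispath x z p.

Lemma connected_to_class x y w : ispath x y w -> connected_to x = connected_to y.
Proof.
move=> xy; have [r yx] := path_sym xy.
apply/funext => a; apply/propext; split=> -[p ap].
  by exists (w ++ p); exact: ispath_cat ap xy.
by exists (r ++ p); exact: ispath_cat ap yx.
Qed.

Lemma component_solution z : exists sigma,
  primitive_on gamma (connected_to z) sigma /\ averaged_on (connected_to z) sigma.
Proof.
have [[e [f [ef [efE [p ep]]]]]|nb] := pselect (exists e f, e <> f /\
    rng e = rng f /\ connected_to z (rng e)).
  rewrite -(connected_to_class ep).
  by have := branching_solution gammaP path_sym erefl (esym efE) ef.
apply: (@nonbranching_solution _ _ _ _ gammaP path_sym z) => e f ef Ke.
by apply: contra_notP nb => efN; exists e, f.
Qed.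

Lemma cocycle_solution : exists sigma,
  (forall x y w q, ispath x y w -> ispath x y q ->
    gamma x w q = stripl (sigma x) w q - stripr (sigma y) w q) /\
  forall z, averaged_on (connected_to z) sigma.
Proof.
(* The choice depends on the component as a predicate, not on a vertex in it, so that the potentials
   at both ends of a path belong to the same solution. *)
have /choice[S SP] : forall P : vertex G -> Prop, exists sigma, forall z,
    P = connected_to z -> primitive_on gamma P sigma /\ averaged_on P sigma.
  move=> P; have [[z ->]|nP] := pselect (exists z, P = connected_to z).
    by have [s sP] := component_solution z; exists s.
  by exists (fun _ _ => 0) => z zP; case: nP; exists z.
pose sigma x := S (connected_to x) x.
have SE z x : connected_to z x -> S (connected_to z) x = sigma x.
  by move=> [p /connected_to_class <-].
exists sigma; split=> [x y w q xw xq|z N F FK].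
  have Kx : connected_to x x by exists [::].
  have [prim _] := SP (connected_to x) x erefl.
  have Kp x' y' w' : ispath x' y' w' -> connected_to x x' -> connected_to x y'.
    move=> xy' [r xr]; have [v yv] := path_sym xy'.
    by exists (r ++ v); exact: ispath_cat yv xr.
  rewrite (primitive_word gammaP prim Kp Kx xw xq).
  by rewrite !SE//; exact: Kp xw Kx.
have [_ /(_ N F FK) [m [W [m0 Wc Winj Wsum]]]] := SP (connected_to z) z erefl.
exists m, W; split=> // x y a b xF ax bx aN bN.
rewrite -[RHS](Wsum x y a b xF ax bx aN bN); apply: eq_bigr => i _.
rewrite SE//; have [p xp] := FK x xF.
have xW : ispath x (path_rng x (W i x)) (W i x) by split=> //; exact: Wc.
have [r yr] := path_sym xW.
by exists (p ++ r); exact: ispath_cat yr xp.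
Qed.

End global_solution.

(** * Return paths from strong connectedness *)

Section strong_components.
Variable G : digraph.

Lemma ispath_component (x : vertex G) (y z : vertex (component x)) s :
  ispath y z s -> exists t, ispath (sval y) (sval z) t.
Proof.
elim: s z => [|e s ih] z; first by move=> /ispath_nilP <-; exists [::].
move=> /ispath_consP[-> /ih[t yt]]; exists (sval e :: t).
by rewrite -cat1s; apply: (ispath_cat yt); exact: (@ispath_edge G).
Qed.

Lemma ispath_same_component (x y : vertex G) s : ispath x y s -> same_component x y.
Proof.
elim: s y => [|e s ih] y; first by move=> /ispath_nilP <-; exact: rst_refl.
move=> /ispath_consP[-> /ih xe]; apply: rst_trans xe _; apply: rst_step.
by exists e.
Qed.

Lemma strongly_connected_path_sym :
  (forall x : vertex G, strongly_connected (component x)) ->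
  forall (x y : vertex G) w, ispath x y w -> exists r, ispath y x r.
Proof.
move=> hG x y w /ispath_same_component xy.
have [[a t at'] [/= ay tx]] := hG x (exist _ y xy) (exist _ x (rst_refl _ _ x)).
have : ispath a (path_rng a t) t by [].
by move: tx; rewrite /prng/= => ->; rewrite ay => /ispath_component.
Qed.

End strong_components.

(** * Finite sums and kernels in l2 *)

Lemma sum_sub_seq (V : nmodType) (I : eqType) (F : I -> V) (s t : seq I) :
  uniq s -> uniq t -> {subset s <= t} ->
  \sum_(i <- s) F i = \sum_(i <- t) if i \in s then F i else 0.
Proof.
move=> us ut st; rewrite -big_mkcond -big_filter; apply: perm_big.
apply: uniq_perm; rewrite ?filter_uniq// => i; rewrite mem_filter.
by case: (boolP (i \in s)) => // /st ->.
Qed.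

Lemma ler_sum_sub_seq (R : numDomainType) (I : eqType) (F : I -> R) (s t : seq I) :
  uniq s -> uniq t -> {subset s <= t} -> (forall i, 0 <= F i) ->
  \sum_(i <- s) F i <= \sum_(i <- t) F i.
Proof.
move=> us ut st F0; rewrite (sum_sub_seq F us ut st) ler_sum// => i _.
by case: ifP.
Qed.

Section ell2_finite_sums.
Context {R : realType} {I : choiceType}.
Implicit Types (f g : ell2 R I) (s : seq I) (c : I -> R[i]).

Lemma sum_le_l2norm f s : uniq s -> \sum_(i <- s) normc (f i) ^+ 2 <= l2norm f ^+ 2.
Proof.
move=> us; rewrite -lee_fin sqr_l2norm -sumEFin; apply: esum_ge.
exists [set` s]%classic; first by split=> //; exact: finite_seq.
by rewrite fsbig_seq.
Qed.

Lemma sqsum_le (h : I -> R[i]) (B : R) :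
  (forall s, uniq s -> \sum_(i <- s) normc (h i) ^+ 2 <= B) ->
  (sqsum h <= B%:E)%E.
Proof.
move=> hB; apply: ge_ereal_sup => _ [X [finX _] <-].
by rewrite fsbig_finite// sumEFin lee_fin hB// fset_uniq.
Qed.

Lemma l2norm_le f (B : R) : 0 <= B ->
  (forall s, uniq s -> \sum_(i <- s) normc (f i) ^+ 2 <= B ^+ 2) -> l2norm f <= B.
Proof.
move=> B0 fB; rewrite -(@ler_pXn2r _ 2)// ?nnegrE ?l2norm_ge0//.
by rewrite -lee_fin sqr_l2norm sqsum_le.
Qed.

Definition ell2_of (h : I -> R[i]) (B : R)
    (hB : forall s, uniq s -> \sum_(i <- s) normc (h i) ^+ 2 <= B) : ell2 R I.
Proof.
apply: (@Ell2 R I h); rewrite inE; apply: le_lt_trans (sqsum_le hB) _.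
exact: ltry.
Defined.

Definition trunc c s : ell2 R I := \sum_(i <- s) c i *: xi i.

Lemma ell2BE f g i : (f - g) i = f i - g i.
Proof. by []. Qed.

Lemma ell2ZE (a : R[i]) f i : (a *: f) i = a * f i.
Proof. by []. Qed.

Lemma xiE (w i : I) : (xi w : ell2 R I) i = (i == w)%:R.
Proof. by []. Qed.

Lemma ell2_sumE (J : Type) (r : seq J) (F : J -> ell2 R I) i :
  (\sum_(j <- r) F j) i = \sum_(j <- r) F j i.
Proof.
elim: r => [|j r ih]; rewrite ?big_nil ?big_cons//.
by rewrite -ih.
Qed.

Lemma truncE c s i : uniq s -> trunc c s i = if i \in s then c i else 0.
Proof.
move=> us; rewrite /trunc ell2_sumE.
transitivity (\sum_(j <- s) if j \in [seq k <- s | k == i] then c i else 0).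
  rewrite big_seq [RHS]big_seq; apply: eq_bigr => j js.
  rewrite ell2ZE xiE eq_sym mem_filter js andbT.
  by case: eqP => [->|_]; rewrite ?mulr1 ?mulr0.
rewrite -(@sum_sub_seq _ _ (fun=> c i)) ?filter_uniq//; last first.
  by move=> k; rewrite mem_filter => /andP[].
case: ifPn => si; first by rewrite (filter_pred1_uniq us si) big_seq1.
rewrite big_seq big1// => j; rewrite mem_filter => /andP[/eqP ->].
by rewrite (negbTE si).
Qed.

Lemma sqr_l2norm_trunc c s : uniq s ->
  l2norm (trunc c s) ^+ 2 = \sum_(i <- s) normc (c i) ^+ 2.
Proof.
move=> us; apply/eqP; rewrite eq_le; apply/andP; split; last first.
  apply: le_trans (sum_le_l2norm (trunc c s) us).
  by rewrite big_seq [leRHS]big_seq ler_sum// => i si; rewrite truncE// si.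
rewrite -lee_fin sqr_l2norm; apply: sqsum_le => s' us'.
rewrite (bigID (mem s))/= [X in _ + X]big1 ?addr0; last first.
  by move=> i si; rewrite truncE// (negbTE si) (normc0 R) expr0n.
rewrite (eq_bigr (fun i => normc (c i) ^+ 2)); last first.
  by move=> i si; rewrite truncE// si.
rewrite -big_filter; apply: ler_sum_sub_seq; rewrite ?filter_uniq//.
  by move=> i; rewrite mem_filter => /andP[].
by move=> i; exact: sqr_ge0.
Qed.

Lemma trunc_approx f (e : R) : 0 < e ->
  exists2 s, uniq s & l2norm (f - trunc f s) <= e.
Proof.
move=> e0.
have : ((l2norm f ^+ 2 - e ^+ 2)%:E < sqsum f)%E.
  by rewrite -sqr_l2norm lte_fin ltrBlDr ltrDl exprn_gt0.
move=> /ereal_sup_gt[_ [X [finX _] <-]].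
rewrite fsbig_finite// sumEFin lte_fin => Xe.
pose s := enum_fset (fset_set X); have us : uniq s by exact: fset_uniq.
exists s => //; apply: l2norm_le => [|t ut]; first exact: ltW.
rewrite (eq_bigr (fun i => if i \notin s then normc (f i) ^+ 2 else 0)); last first.
  move=> i _; rewrite ell2BE truncE//.
  by case: ifP => _; rewrite ?subrr ?subr0// (normc0 R) expr0n.
rewrite -big_mkcond/=.
rewrite -big_filter; set t' := [seq i <- t | i \notin s].
have : uniq (s ++ t').
  rewrite cat_uniq us filter_uniq//= andbT; apply/hasPn => i.
  by rewrite mem_filter => /andP[].
move=> /(sum_le_l2norm f); rewrite big_cat/= => h; move: Xe h; rewrite -/s; lra.
Qed.

Lemma bopZ (T : bop R I) (a : R[i]) f : T (a *: f) = a *: T f.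
Proof. exact: linearZ. Qed.

Lemma bopD (T : bop R I) f g : T (f + g) = T f + T g.
Proof. exact: linearD. Qed.

Lemma bop0 (T : bop R I) : T 0 = 0.
Proof. exact: linear0. Qed.

Lemma bop_sum (T : bop R I) (J : Type) (r : seq J) (F : J -> ell2 R I) :
  T (\sum_(j <- r) F j) = \sum_(j <- r) T (F j).
Proof.
by elim: r => [|j r ih]; rewrite ?big_nil ?bop0// !big_cons bopD ih.
Qed.

Lemma bop_trunc (T : bop R I) c s b :
  T (trunc c s) b = \sum_(a <- s) c a * T (xi a) b.
Proof.
rewrite /trunc bop_sum ell2_sumE; apply: eq_bigr => a _.
by rewrite bopZ ell2ZE.
Qed.

Lemma bop_eq0 (T : bop R I) : (forall i, T (xi i) = 0) -> forall f, T f = 0.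
Proof.
move=> T0 f; apply/l2norm_eq0/eqP.
rewrite eq_le l2norm_ge0 andbT; apply/ler_addgt0Pr => e e0; rewrite add0r.
have p0 : 0 < opnorm T + 1 by rewrite ltr_wpDl// opnorm_ge0.
have [|s us fs] := @trunc_approx f (e / (opnorm T + 1)); first exact: divr_gt0.
have E : T (trunc f s) = 0.
  by rewrite /trunc bop_sum big1// => i _; rewrite bopZ T0 scaler0.
rewrite -(subrK (trunc f s) f) linearD/= E addr0.
apply: le_trans (l2norm_bop _ _) _.
apply: le_trans (ler_wpM2l (opnorm_ge0 T) fs) _.
rewrite mulrA ler_pdivrMr// mulrC ler_wpM2l ?(ltW e0)//.
by rewrite lerDl.
Qed.

Lemma bopBE (S T : bop R I) f : (S - T) f = S f - T f.
Proof. by []. Qed.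

Lemma bop_ext (S T : bop R I) : (forall i, S (xi i) = T (xi i)) -> S = T.
Proof.
move=> ST; apply/val_inj/funext => f; apply/eqP; rewrite -subr_eq0.
apply/eqP/(@bop_eq0 (S - T)) => i; by rewrite bopBE ST subrr.
Qed.

Lemma sqr_l2norm_bop (T : bop R I) f (B : R) s : opnorm T <= B -> uniq s ->
  \sum_(i <- s) normc (T f i) ^+ 2 <= B ^+ 2 * l2norm f ^+ 2.
Proof.
move=> TB us; apply: le_trans (sum_le_l2norm _ us) _; rewrite -exprMn.
have B0 := le_trans (opnorm_ge0 T) TB.
rewrite ler_pXn2r// ?nnegrE ?mulr_ge0 ?l2norm_ge0//.
by apply: le_trans (l2norm_bop _ _) _; rewrite ler_wpM2r ?l2norm_ge0.
Qed.

Lemma l2norm_xi (i : I) : l2norm (xi i : ell2 R I) = 1.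
Proof.
have E : xi i = trunc (fun=> 1) [:: i] by rewrite /trunc big_seq1 scale1r.
apply/eqP; rewrite -(@eqrXn2 _ 2)// ?l2norm_ge0// E sqr_l2norm_trunc//.
by rewrite big_seq1 (normc1 R).
Qed.

Lemma sumr_normc (J : Type) (r : seq J) (F : J -> R[i]) :
  normc (\sum_(j <- r) F j) <= \sum_(j <- r) normc (F j).
Proof.
elim: r => [|j r ih]; first by rewrite !big_nil (normc0 R).
by rewrite !big_cons; apply: le_trans (le_normcD _ _) _; rewrite lerD2l.
Qed.

(* Arithmetic-geometric mean form of boundedness; by homogeneity it is
   equivalent to [|K(f, g)| <= B * |f| * |g|], but it adds up over blocks. *)
Definition form_bounded (B : R) (K : I -> I -> R[i]) : Prop :=
  forall s (f g : I -> R[i]), uniq s ->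
  normc (\sum_(b <- s) \sum_(a <- s) K b a * f a * g b) <=
  B / 2 * (\sum_(i <- s) normc (f i) ^+ 2 + \sum_(i <- s) normc (g i) ^+ 2).

Lemma amgm (B x y : R) : 0 < B -> x * y <= B / 2 * x ^+ 2 + (2 * B)^-1 * y ^+ 2.
Proof.
move=> B0; rewrite -subr_ge0.
rewrite (_ : _ - _ = (2 * B)^-1 * (B * x - y) ^+ 2).
  by rewrite mulr_ge0 ?sqr_ge0// invr_ge0 mulr_ge0// ltW.
by field; rewrite gt_eqF.
Qed.

(* The sum is [<T f, U g>], where [U] maps [xi b] to a multiple of [xi (phi b)]. *)
Lemma form_le_bop (T : bop R I) (B : R) (phi : I -> I) (c : I -> R[i]) s
    (f g : I -> R[i]) : 0 < B -> opnorm T <= B ->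
  uniq s -> {in s &, injective phi} -> (forall b, normc (c b) = 1) ->
  normc (\sum_(b <- s) \sum_(a <- s) c b * T (xi a) (phi b) * f a * g b) <=
  B / 2 * (\sum_(i <- s) normc (f i) ^+ 2 + \sum_(i <- s) normc (g i) ^+ 2).
Proof.
move=> B0 TB us phi_inj c1.
have E b : \sum_(a <- s) c b * T (xi a) (phi b) * f a * g b =
    T (trunc f s) (phi b) * (c b * g b).
  rewrite bop_trunc mulr_suml; apply: eq_bigr => a _.
  by ring.
under eq_bigr do rewrite E; apply: le_trans (sumr_normc _ _) _.
apply: (@le_trans _ _ (\sum_(b <- s) (B / 2 * normc (g b) ^+ 2 +
    (2 * B)^-1 * normc (T (trunc f s) (phi b)) ^+ 2))).
  by apply: ler_sum => b _; rewrite !normcM c1 mul1r mulrC amgm.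
rewrite big_split/= -!mulr_sumr mulrDr addrC lerD2r.
rewrite -(big_map phi xpredT (fun b => normc (T (trunc f s) b) ^+ 2)).
have ups : uniq (map phi s) by rewrite map_inj_in_uniq.
apply: le_trans (ler_wpM2l _ (sqr_l2norm_bop _ TB ups)) _.
  by rewrite invr_ge0 mulr_ge0// ltW.
rewrite sqr_l2norm_trunc// mulrA ler_wpM2r ?sumr_ge0// => [i _|].
  exact: sqr_ge0.
by have -> : (2 * B)^-1 * B ^+ 2 = B / 2 by field; rewrite gt_eqF.
Qed.

Lemma form_bounded_bop (T : bop R I) (B : R) : 0 < B -> opnorm T <= B ->
  form_bounded B (fun b a => T (xi a) b).
Proof.
move=> B0 TB s f g us.
have := form_le_bop f g B0 TB us (in2W (@inj_id _)) (fun=> normc1 R).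
by under eq_bigr do under eq_bigr do rewrite mul1r.
Qed.

End ell2_finite_sums.

Lemma normc_conj (R : realType) (z : R[i]) : normc z^* = normc z.
Proof. by have [] := norm_conjC z. Qed.

Lemma sum_by_class (V : nmodType) (I J : eqType) (cl : I -> J) (s : seq I) (F : I -> V) :
  \sum_(i <- s) F i =
  \sum_(c <- undup [seq cl i | i <- s]) \sum_(i <- s | cl i == c) F i.
Proof.
rewrite (exchange_big_dep xpredT)//= big_seq [RHS]big_seq; apply: eq_bigr => i si.
rewrite -big_filter (eq_filter (a2 := pred1 (cl i))); last by move=> c; rewrite /= eq_sym.
by rewrite filter_pred1_uniq ?undup_uniq ?big_seq1// mem_undup map_f.
Qed.

(** * Operators given by matrices with finite rows *)

Section kernel_operator.
Context {R : realType} {I : choiceType}.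
Variables (K : I -> I -> R[i]) (rows : I -> seq I) (B : R).
Hypotheses (rows_uniq : forall b, uniq (rows b))
  (rowsP : forall b a, a \notin rows b -> K b a = 0)
  (B_gt0 : 0 < B) (K_bounded : form_bounded B K).
Implicit Types f g : ell2 R I.

Definition kernel_fun f b : R[i] := \sum_(a <- rows b) K b a * f a.

Lemma kernel_fun_bound f s : uniq s ->
  \sum_(b <- s) normc (kernel_fun f b) ^+ 2 <= (B * l2norm f) ^+ 2.
Proof.
move=> us; set S := \sum_(b <- s) _.
(* The set [t] contains every row indexed by [s], so the form over [t] sees the values
   [kernel_fun f b] in full. *)
pose t := undup (s ++ flatten [seq rows b | b <- s]).
have st : {subset s <= t} by move=> b bs; rewrite mem_undup mem_cat bs.
have rt b : b \in s -> {subset rows b <= t}.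
  move=> bs a ab; rewrite mem_undup mem_cat; apply/orP; right.
  by apply/flattenP; exists (rows b) => //; exact: map_f.
have ut : uniq t by exact: undup_uniq.
pose g b : R[i] := if b \in s then (kernel_fun f b)^* / B%:C%C else 0.
have Bn : normc (B%:C%C : R[i]) = B.
  by rewrite /normc/= expr0n addr0 sqrtr_sqr ger0_norm// ltW.
have := K_bounded f g ut.
have -> : \sum_(b <- t) \sum_(a <- t) K b a * f a * g b = (S / B)%:C%C.
  rewrite rmorphM/= fmorphV/= rmorph_sum/= mulr_suml [RHS](sum_sub_seq _ us ut st).
  apply: eq_bigr => b _; rewrite /g; case: ifPn => bs; last first.
    by rewrite big1// => a _; rewrite mulr0.
  rewrite -mulr_suml -(_ : kernel_fun f b = \sum_(a <- t) K b a * f a).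
    by rewrite mulrA -sqr_normc rmorphXn.
  rewrite /kernel_fun (sum_sub_seq _ (rows_uniq b) ut (rt b bs)).
  apply: eq_bigr => a _; case: ifPn => // ab.
  by rewrite rowsP// mul0r.
have -> : normc ((S / B)%:C%C : R[i]) = S / B.
  rewrite /normc/= expr0n addr0 sqrtr_sqr ger0_norm// divr_ge0// ?(ltW B_gt0)//.
  by rewrite sumr_ge0// => i _; exact: sqr_ge0.
have -> : \sum_(b <- t) normc (g b) ^+ 2 = S / B ^+ 2.
  rewrite /S mulr_suml [RHS](sum_sub_seq _ us ut st); apply: eq_bigr => b _.
  rewrite /g; case: ifP => _; last by rewrite (normc0 R) expr0n.
  by rewrite normcM normcV Bn normc_conj exprMn exprVn.
have ft := sum_le_l2norm f ut.
move=> h; have : S / B <= B / 2 * (l2norm f ^+ 2 + S / B ^+ 2).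
  by apply: le_trans h _; rewrite ler_wpM2l ?divr_ge0 ?(ltW B_gt0)// lerD2r.
have -> : B / 2 * (l2norm f ^+ 2 + S / B ^+ 2) = B / 2 * l2norm f ^+ 2 + (S / B) / 2.
  by field; rewrite gt_eqF.
rewrite exprMn => h'.
have : S / B <= B * l2norm f ^+ 2 by lra.
by rewrite ler_pdivrMr// => /le_trans; apply; rewrite mulrAC -expr2.
Qed.

Lemma kernel_bop_subproof :
  (fun f => ell2_of (kernel_fun_bound f)) \in bounded_linear.
Proof.
apply/bounded_linearP; split.
  move=> a f g; apply/val_inj/funext => b /=; rewrite !fctE/=.
  rewrite /kernel_fun scaler_sumr -big_split/=; apply: eq_bigr => i _.
  by rewrite mulrDr /GRing.scale/= mulrCA.
exists B => f; apply: l2norm_le => [|s us].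
  by rewrite mulr_ge0 ?l2norm_ge0// ltW.
exact: kernel_fun_bound.
Qed.

Definition kernel_bop : bop R I := BOp kernel_bop_subproof.

Lemma kernel_bop_xi a b : kernel_bop (xi a) b = K b a.
Proof.
rewrite [LHS]/= /kernel_fun; have [ab|ab] := boolP (a \in rows b).
  rewrite (bigD1_seq a)//= /basis_fun eqxx mulr1 big1 ?addr0// => i /negbTE ->.
  by rewrite mulr0.
rewrite rowsP// big_seq big1// => i ib; rewrite /= /basis_fun.
by case: eqP ib ab => [->->|_ _ _]//; rewrite mulr0.
Qed.

Lemma opnorm_kernel_bop : opnorm kernel_bop <= B.
Proof.
apply: opnorm_le => f f1; apply: l2norm_le; first exact: ltW.
move=> s us; apply: le_trans (kernel_fun_bound f us) _.
rewrite ler_pXn2r ?nnegrE ?mulr_ge0 ?l2norm_ge0// ?(ltW B_gt0)//.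
by rewrite ger_pMr.
Qed.

End kernel_operator.

(** * Block compressions and averages of forms *)

Section forms.
Context {R : realType} {I : choiceType}.
Implicit Types (K : I -> I -> R[i]) (B : R).

(** The form is the sum of its restrictions to the classes, and the right-hand sides, being sums of
    squares, add up as well. *)
Lemma form_bounded_block (J : eqType) (cl : I -> J) B K :
  (forall b a, cl b != cl a -> K b a = 0) ->
  (forall s f g, uniq s ->
    (forall i j, i \in s -> j \in s -> cl i = cl j) ->
    normc (\sum_(b <- s) \sum_(a <- s) K b a * f a * g b) <=
    B / 2 * (\sum_(i <- s) normc (f i) ^+ 2 + \sum_(i <- s) normc (g i) ^+ 2)) ->
  form_bounded B K.
Proof.
move=> Kcl KB s f g us.
rewrite !(sum_by_class cl s) -big_split/= mulr_sumr.
apply: le_trans (sumr_normc _ _) _; apply: (@ler_sum R) => c _.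
pose t := [seq i <- s | cl i == c].
have bt (V : nmodType) (F : I -> V) :
  \sum_(i <- s | cl i == c) F i = \sum_(i <- t) F i by rewrite big_filter.
rewrite !bt.
have ut : uniq t by exact: filter_uniq.
have tc i : i \in t -> cl i = c by rewrite mem_filter => /andP[/eqP].
rewrite (eq_big_seq (fun b => \sum_(a <- t) K b a * f a * g b)); last first.
  move=> b b_t; rewrite (bigID (fun a => cl a == c))/= [X in _ + X]big1 ?addr0.
    by rewrite bt.
  by move=> a ac; rewrite Kcl ?mul0r// (tc b b_t) eq_sym.
by apply: KB => // i j it jt; rewrite !tc.
Qed.

(** Within one class the compressed kernel is the original one, so passing to diagonal blocks does
    not raise the bound. *)
Lemma form_bounded_diag (J : eqType) (cl : I -> J) B K : form_bounded B K ->
  form_bounded B (fun b a => if cl b == cl a then K b a else 0).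
Proof.
move=> KB; apply: (form_bounded_block (cl := cl)) => [b a /negbTE->//|s f g us scl].
rewrite (eq_big_seq (fun b => \sum_(a <- s) K b a * f a * g b)); first exact: KB.
by move=> b bs; apply: eq_big_seq => a as_; rewrite (scl b a)// eqxx.
Qed.

Lemma form_le_avg (T : finType) B (K : T -> I -> I -> R[i]) s (f g : I -> R[i]) :
  (0 < #|T|)%N ->
  (forall t, normc (\sum_(b <- s) \sum_(a <- s) K t b a * f a * g b) <= B) ->
  normc (\sum_(b <- s) \sum_(a <- s)
    #|T|%:R^-1 * (\sum_t K t b a) * f a * g b) <= B.
Proof.
move=> T0 KB.
have -> : \sum_(b <- s) \sum_(a <- s) #|T|%:R^-1 * (\sum_t K t b a) * f a * g b =
    #|T|%:R^-1 * \sum_t \sum_(b <- s) \sum_(a <- s) K t b a * f a * g b.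
  rewrite [RHS]mulr_sumr; under [RHS]eq_bigr do rewrite mulr_sumr.
  rewrite [RHS]exchange_big; apply: eq_bigr => b _.
  under [RHS]eq_bigr do rewrite mulr_sumr.
  rewrite [RHS]exchange_big; apply: eq_bigr => a _.
  rewrite -[RHS]mulr_sumr -!mulrA mulr_suml; congr (_ * _).
  by apply: eq_bigr => t _; rewrite mulrA.
rewrite normcM normcV.
have -> : normc (#|T|%:R : R[i]) = #|T|%:R.
  by rewrite normcMn (normc1 R).
rewrite mulrC ler_pdivrMr ?ltr0n//; apply: le_trans (sumr_normc _ _) _.
apply: le_trans (ler_sum _ (fun t _ => KB t)) _.
by rewrite sumr_const mulr_natr.
Qed.

End forms.

(** * Creation operators *)

Section pushforward_values.
Context {R : realType} {I : choiceType}.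
Variables (m : I -> option I)
  (m_inj : forall v w u, m v = Some u -> m w = Some u -> v = w).

Lemma pushforward_some (f : ell2 R I) w u : m w = Some u ->
  pushforward m_inj f u = f w.
Proof.
move=> wu; rewrite [LHS]/= /pushforward_fun; case: pselect => [h|[]]; last by exists w.
by case: cid => v /= vu; rewrite (m_inj vu wu).
Qed.

Lemma pushforward_none (f : ell2 R I) u : (forall w, m w <> Some u) ->
  pushforward m_inj f u = 0.
Proof.
move=> nu; rewrite [LHS]/= /pushforward_fun; case: pselect => // -[w wu].
by case: (nu w).
Qed.

Lemma opnorm_pushforward : opnorm (pushforward m_inj : bop R I) <= 1.
Proof.
apply: opnorm_le => f f1; apply: le_trans f1.
rewrite /l2norm ler_wsqrtr// -lee_fin !sqsumK ?ell2P//.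
exact: le_sqsum_pushforward.
Qed.

End pushforward_values.

Section graph_operators.
Variables (R : realType) (G : digraph).
Local Notation W := (dipath G).
Local Notation H := (ell2 R W).
Implicit Types (x y z : vertex G) (e : edge G) (p q s t u v w : seq (edge G))
  (a b : W) (f : H).

Definition vpath x : W := @DiPath G x [::] I.

(** The value 0 at words that are not composable lets words be cut and joined without carrying
    proofs inside paths. *)
Definition ev f x s : R[i] :=
  if pselect (composable x s) is left c then f (DiPath c) else 0.

Lemma dipathP a : composable (psrc a) (pedges a).
Proof. by case: a. Qed.

Lemma dipath_ispath a : ispath (psrc a) (prng a) (pedges a).
Proof. by split=> //; exact: dipathP. Qed.

Lemma ev_path f a : ev f (psrc a) (pedges a) = f a.
Proof.
rewrite /ev; case: pselect => [c|/(_ (dipathP a))//].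
by congr (f _); exact: dipath_inj.
Qed.

Lemma evE f x s (c : composable x s) : ev f x s = f (DiPath c).
Proof. exact: ev_path f (DiPath c). Qed.

Lemma ev_edge e f x q : composable x q ->
  ev (Ledge R e f) x q = stripl (ev f x) [:: e] q.
Proof.
move=> xq; rewrite [LHS](evE _ xq).
elim/striplP: (stripl _ _ _) => [p qE|eq].
  subst q; have [ep xp] := xq; rewrite (evE _ xp).
  apply: pushforward_some; rewrite /edge_map; case: pselect => // h.
  by congr Some; exact: dipath_inj.
apply: pushforward_none => a; rewrite /edge_map; case: pselect => // h [_ qE].
by case/negP: eq; rewrite -qE /= eqxx prefix0s.
Qed.

Lemma ev_vertex y f x q : composable x q ->
  ev (Lvertex R y f) x q = if path_rng x q == y then ev f x q else 0.
Proof.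
move=> xq; rewrite !(evE _ xq).
case: eqP => [xy|nxy].
  by apply: pushforward_some; rewrite /vertex_map; case: pselect.
apply: pushforward_none => a; rewrite /vertex_map; case: pselect => // h [aE].
by case: nxy; rewrite -h aE.
Qed.

(** The final projection makes the empty word give [Lvertex R x]. *)
Fixpoint Lword x w : bop R W :=
  if w is e :: w' then bcomp (Ledge R e) (Lword x w') else Lvertex R x.

Lemma ev_word x w f z q : composable z q ->
  ev (Lword x w f) z q =
  stripl (fun p => if path_rng z p == x then ev f z p else 0) w q.
Proof.
elim: w q => [|e w ih] q zq; first by rewrite ev_vertex// stripl_nil.
rewrite [LHS](ev_edge _ _ zq) -[e :: w]/([:: e] ++ w) -stripl_comp.
by apply: stripl_ext => p qE; subst q; apply: ih; case: zq.
Qed.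

Definition right_map a b : option W :=
  if pselect (psrc b = prng a) is left h then
    Some (@DiPath G (psrc a) (pedges b ++ pedges a)
      ((composable_cat (psrc a) (pedges b) (pedges a)).2
        (conj (dipathP a) (eq_ind _ (fun x => composable x (pedges b)) (dipathP b) _ h))))
  else None.

Lemma right_map_inj a b b' c :
  right_map a b = Some c -> right_map a b' = Some c -> b = b'.
Proof.
rewrite /right_map; case: pselect => // h; case: pselect => // h' [<-] [].
by move=> /(cat_inj_sizer erefl)[bb _]; apply: dipath_inj => //; rewrite h.
Qed.

(** The right creation operator, sending xi_b to xi_(b a) when b a is a path and to 0 otherwise. *)
Definition Rpath a : bop R W := pushforward (@right_map_inj a).

Lemma ev_right a f z q : composable z q ->
  ev (Rpath a f) z q =
  if z == psrc a then stripr (ev f (prng a)) (pedges a) q else 0.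
Proof.
move=> zq; rewrite [LHS](evE _ zq).
have none : (forall b, right_map a b <> Some (DiPath zq)) ->
  Rpath a f (DiPath zq) = 0 by move=> h; exact: pushforward_none.
case: eqP => [za|nza]; last first.
  apply: none => b; rewrite /right_map; case: pselect => // h [za _].
  by case: nza.
elim/striprP: (stripr _ _ _) => [p qE|nq].
  subst z q; have [_ yp] := (composable_cat _ _ _).1 zq.
  rewrite (evE _ yp).
  apply: pushforward_some; rewrite /right_map; case: pselect => // h.
  by congr Some; exact: dipath_inj.
apply: none => b; rewrite /right_map; case: pselect => // h [_ qE].
by case/negP: nq; rewrite -qE suffix_suffix.
Qed.

Lemma Rpath_xi a : Rpath a (xi (vpath (prng a))) = xi a.
Proof.
rewrite pushforward_xi /right_map; case: pselect => // h.
by congr xi; exact: dipath_inj.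
Qed.

Lemma ell2_ext f g : (forall z q, composable z q -> ev f z q = ev g z q) -> f = g.
Proof.
move=> fg; apply/val_inj/funext => a; rewrite -[LHS]ev_path -[RHS]ev_path.
exact/fg/dipathP.
Qed.

Definition right_commuting (S : bop R W) := forall a f, S (Rpath a f) = Rpath a (S f).

Lemma right_commuting_edge e : right_commuting (Ledge R e).
Proof.
move=> a f; apply: ell2_ext => z q zq; rewrite ev_edge// ev_right//.
transitivity (stripl (fun p => if z == psrc a then
    stripr (ev f (prng a)) (pedges a) p else 0) [:: e] q).
  by apply: stripl_ext => p qE; subst q; rewrite ev_right//; case: zq.
case: ifPn => [/eqP za|_]; last by elim/striplP: (stripl _ _ q).
rewrite stripl_stripr; apply: stripr_ext => p qE; subst q z.
by rewrite ev_edge//; case/composable_cat: zq.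
Qed.

Lemma right_commuting_vertex x : right_commuting (Lvertex R x).
Proof.
move=> a f; apply: ell2_ext => z q zq; rewrite ev_vertex// !ev_right//.
case: (z =P psrc a) => [za|_]; last by rewrite if_same.
case: (boolP (suffix (pedges a) q)) => [/suffixP[p qE]|nq]; last first.
  by rewrite !stripr0// if_same.
subst q z; have [_ yp] := (composable_cat _ _ _).1 zq.
by rewrite !stripr_cat ev_vertex// path_rng_cat.
Qed.

Lemma right_commuting_subalgebra : subalgebra [set S | right_commuting S]%classic.
Proof.
split=> [a f|c S T cS cT a f|S T cS cT a f].
- by rewrite (bop0 (Rpath a)).
- have -> g : (c *: S + T) g = c *: S g + T g by [].
  by rewrite cS cT bopD bopZ.
- by have -> g : bcomp S T g = S (T g) by []; rewrite cT cS.
Qed.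

Lemma matrix_coefs_continuous (I : choiceType) (f g : ell2 R I) :
  continuous (fun S : initial_topology (@matrix_coefs R I) => inner (S f) g : R[i]^o).
Proof.
have c1 : continuous (@matrix_coefs R I : initial_topology (@matrix_coefs R I) -> _).
  exact: initial_continuous.
have c2 := @proj_continuous _ (fun _ : ell2 R I * ell2 R I => R[i]^o) (f, g).
by move=> S; exact: (cvg_comp _ _ (c1 S) (c2 _)).
Qed.

Lemma inner_xi (I : choiceType) (f : ell2 R I) i : inner f (xi i) = f i.
Proof.
rewrite /inner /sum; apply: (cvg_lim (@norm_hausdorff _ (R[i]^o))).
apply: cvg_near_cst; exists [fset i]%fset => // A; rewrite /= fsub1set => iA.
rewrite /partial_sum -(big_seq_fsetE _ A predT (fun j => f j * (xi i j)^*))/=.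
rewrite (bigD1_seq i)//= ?fset_uniq//.
rewrite /basis_fun eqxx conjC1 mulr1 big1 ?addr0// => j /negbTE ->.
by rewrite conjC0 mulr0.
Qed.

(** Commutation with R_a is tested by equations between matrix coefficients of [S]: the coefficient
    of R_a S f at [b] is that of S f at [c] if b = c a, and 0 if there is no such [c]. *)
Lemma wot_closed_right_commuting : wot_closed [set S : bop R W | right_commuting S]%classic.
Proof.
rewrite /wot_closed.
have -> : [set S : bop R W | right_commuting S]%classic =
  (\bigcap_(abf in [set: W * W * H]) [set S : bop R W |
     inner (S (Rpath abf.1.1 abf.2)) (xi abf.1.2) =
     inner (Rpath abf.1.1 (S abf.2)) (xi abf.1.2)])%classic.
  apply/seteqP; split=> [S cS [[a b] f] _ /=|S cS a f]; first by rewrite cS.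
  apply/val_inj/funext => b; have := cS (a, b, f) I; by rewrite /= !inner_xi.
have cl (f g f' g' : H) : closed [set S : initial_topology (@matrix_coefs R W) |
    inner (S f) g = inner (S f') g']%classic.
  have -> : [set S : initial_topology (@matrix_coefs R W) |
      inner (S f) g = inner (S f') g']%classic =
      ((fun S : initial_topology (@matrix_coefs R W) =>
        (inner (S f) g - inner (S f') g' : R[i]^o)) @^-1` [set 0])%classic.
    apply/seteqP; split=> S /= /eqP; first by rewrite -subr_eq0 => /eqP.
    by rewrite subr_eq0 => /eqP.
  apply: preimage_closed; last exact/accessible_closed_set1/hausdorff_accessible/norm_hausdorff.
  move=> S _; apply: (@cvgB _ (R[i]^o) _ (nbhs S)); exact: matrix_coefs_continuous.
apply: closed_bigI => -[[a b] f] _ /=.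
have [[c cb]|nc] := pselect (exists c, right_map a c = Some b).
  have := cl (Rpath a f) (xi b) f (xi c).
  congr closed; apply/seteqP; split=> S /=; rewrite !inner_xi => ->;
    by rewrite (pushforward_some _ _ cb).
have := cl (Rpath a f) (xi b) 0 (xi b).
have none S : Rpath a (S f) b = 0.
  by apply: pushforward_none => c cb; case: nc; exists c.
congr closed; apply/seteqP; split=> S /=;
  by rewrite !inner_xi none bop0 => ->.
Qed.

End graph_operators.

(** * Words in the algebra and Fourier coefficients *)

Section tensor_algebra_words.
Variables (R : realType) (G : digraph).
Local Notation W := (dipath G).
Local Notation H := (ell2 R W).
Implicit Types (x y z : vertex G) (e : edge G) (p q s t u v w : seq (edge G))
  (a b : W) (f : H) (S T : bop R W).

Lemma right_commuting_generators :
  (@generators R G `<=` [set S | right_commuting S])%classic.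
Proof.
by move=> _ [[e _ <-]|[x _ <-]]; [exact: right_commuting_edge|exact: right_commuting_vertex].
Qed.

Lemma free_semigroupoid_right_commuting S :
  free_semigroupoid_algebra R G S -> right_commuting S.
Proof.
move=> /(_ [set S | right_commuting S]%classic); apply; split.
  by split; [exact: right_commuting_subalgebra|exact: wot_closed_right_commuting].
exact: right_commuting_generators.
Qed.

Lemma Lword_subalgebra (A : set (bop R W)) x w :
  subalgebra A -> (@generators R G `<=` A)%classic -> A (Lword R x w).
Proof.
move=> [_ _ AM] GA; elim: w => [|e w ih] /=; first by apply: GA; right; exists x.
by apply: AM => //; apply: GA; left; exists e.
Qed.

Lemma tensor_subalgebra : subalgebra (tensor_algebra R G).
Proof.
split=> [A [[[A0 _ _] _] _]//|c S T AS AT A AP|S T AS AT A AP].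
  by have [[[_ AZ _] _] _] := AP; apply: AZ; [exact: AS|exact: AT].
by have [[[_ _ AM] _] _] := AP; apply: AM; [exact: AS|exact: AT].
Qed.

Lemma generators_tensor : (@generators R G `<=` tensor_algebra R G)%classic.
Proof. exact: sub_gen_smallest. Qed.

Lemma tensor_word x w : tensor_algebra R G (Lword R x w).
Proof. exact: Lword_subalgebra tensor_subalgebra generators_tensor. Qed.

(** Since xi_a is R_a applied to the vector of the vertex [prng a], the operator [S] is determined
    by its values on vertex vectors. *)
Lemma right_commuting_xi S a b : right_commuting S ->
  S (xi a) b = if psrc b == psrc a then
    stripr (ev (S (xi (vpath (prng a)))) (prng a)) (pedges a) (pedges b) else 0.
Proof.
move=> cS; rewrite -{1}(Rpath_xi R a) cS -[LHS]ev_path ev_right//.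
exact: dipathP.
Qed.

Lemma ev_scale (c : R[i]) f x s : ev (c *: f) x s = c * ev f x s.
Proof. by rewrite /ev; case: pselect => // _; rewrite mulr0. Qed.

Lemma evD f g x s : ev (f + g) x s = ev f x s + ev g x s.
Proof. by rewrite /ev; case: pselect => // _; rewrite addr0. Qed.

Lemma ev_sum (J : Type) (r : seq J) (F : J -> H) x s :
  ev (\sum_(j <- r) F j) x s = \sum_(j <- r) ev (F j) x s.
Proof.
rewrite /ev; case: pselect => [c|nc]; first exact: ell2_sumE.
by rewrite big1.
Qed.

Lemma ev0 x s : ev (0 : H) x s = 0.
Proof. by rewrite /ev; case: pselect. Qed.

Lemma ev_xi a z q : composable z q ->
  ev (xi a : H) z q = ((z == psrc a) && (q == pedges a))%:R.
Proof.
move=> zq; rewrite (evE _ zq) xiE; congr ((nat_of_bool _)%:R).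
apply/eqP/andP => [<-//|[/eqP za /eqP qa]]; exact: dipath_inj.
Qed.

Lemma ev_sum_le f x (Q : seq (seq (edge G))) : uniq Q ->
  (forall q, q \in Q -> composable x q) ->
  \sum_(q <- Q) normc (ev f x q) ^+ 2 <= l2norm f ^+ 2.
Proof.
move=> uQ Qx.
pose F q : W := if pselect (composable x q) is left c then DiPath c else vpath x.
have FE q : q \in Q -> pedges (F q) = q /\ psrc (F q) = x.
  by move=> /Qx xq; rewrite /F; case: pselect.
rewrite (eq_big_seq (fun q => normc (f (F q)) ^+ 2)); last first.
  by move=> q /FE[Fe Fs]; rewrite -(ev_path f (F q)) Fe Fs.
rewrite -(big_map F xpredT (fun a => normc (f a) ^+ 2)); apply: sum_le_l2norm.
rewrite map_inj_in_uniq// => q q' /FE[Fq _] /FE[Fq' _] FF.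
by rewrite -Fq FF Fq'.
Qed.

Lemma Lword_cat x y v w : ispath x y w ->
  bcomp (Lword R y v) (Lword R x w) = Lword R x (v ++ w).
Proof.
move=> [xw wy]; apply: bop_ext => a; apply: ell2_ext => z q zq.
rewrite [LHS](ev_word _ _ (Lword R x w (xi a)) zq) ev_word// -stripl_comp.
apply: stripl_ext => p qE; subst q; have [zp _] := (composable_cat _ _ _).1 zq.
rewrite ev_word//; case: eqP => // py.
elim/striplP: (stripl _ _ _) => // p' pE; subst p; case: eqP => // p'x.
by case: py; rewrite path_rng_cat p'x.
Qed.

Lemma Lword_xi x y w a : ispath x y w -> prng a = x ->
  exists b, [/\ Lword R x w (xi a) = xi b, psrc b = psrc a,
    pedges b = w ++ pedges a & prng b = y].
Proof.
move=> [xw wy] ax.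
have aw : composable (psrc a) (w ++ pedges a).
  by apply/composable_cat; split; [exact: dipathP|rewrite (dipath_ispath a).2 ax].
exists (DiPath aw); split=> //; last by rewrite /prng/= path_rng_cat (dipath_ispath a).2 ax.
apply: ell2_ext => z q zq; rewrite ev_word// ev_xi//=.
elim/striplP: (stripl _ _ _) => [p qE|nq]; last first.
  by case: eqP => //= _; case: eqP nq => // ->; rewrite prefix_prefix.
subst q; have [zp _] := (composable_cat _ _ _).1 zq.
rewrite ev_xi//= eqseq_cat// eqxx/=.
case: (z =P psrc a) => [->|]; case: (p =P pedges a) => [->|]//=; rewrite ?if_same//.
by rewrite (dipath_ispath a).2 ax eqxx.
Qed.

Lemma Lword_xi0 x w a : prng a <> x -> Lword R x w (xi a) = 0.
Proof.
move=> ax; apply: ell2_ext => z q zq; rewrite ev_word// ev0.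
elim/striplP: (stripl _ _ _) => // p qE; subst q.
have [zp _] := (composable_cat _ _ _).1 zq.
case: eqP => // px; rewrite ev_xi//; case: eqP => //= za; case: eqP => // pa.
by case: ax; rewrite -px za pa.
Qed.

Lemma composable_src x y s : composable x s -> composable y s -> s <> [::] -> x = y.
Proof.
elim: s => // e [|e' s] ih; first by move=> /= [<- _] [].
by move=> [_ xs] [_ ys] _; apply: ih.
Qed.

Lemma opnorm_bcomp S T : opnorm S <= 1 -> opnorm T <= 1 -> opnorm (bcomp S T) <= 1.
Proof.
move=> S1 T1; apply: opnorm_le => f f1.
apply: le_trans (l2norm_bop S _) _; apply: mulr_ile1; rewrite ?opnorm_ge0 ?l2norm_ge0//.
apply: le_trans (l2norm_bop T _) _; apply: mulr_ile1; rewrite ?opnorm_ge0 ?l2norm_ge0//.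
Qed.

Lemma opnorm_Lword x w : opnorm (Lword R x w) <= 1.
Proof.
elim: w => [|e w ih] /=; first exact: opnorm_pushforward.
by apply: opnorm_bcomp => //; exact: opnorm_pushforward.
Qed.

(** The matrix of the formal series of the c_(x,u) L_u, with [u] a path from [x]. *)
Definition coef_kernel (c : vertex G -> seq (edge G) -> R[i]) b a : R[i] :=
  if psrc b == psrc a then stripr (c (prng a)) (pedges a) (pedges b) else 0.

Definition path_suffix b i : W := @DiPath G (psrc b) (drop i (pedges b))
  (proj1 ((composable_cat (psrc b) (take i (pedges b)) (drop i (pedges b))).1
    (eq_ind_r (composable (psrc b)) (dipathP b) (cat_take_drop i (pedges b))))).

Definition path_suffixes b : seq W :=
  undup [seq path_suffix b i | i <- iota 0 (size (pedges b)).+1].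

(** A nonzero entry in row [b] requires [a] to be a right end of [b], so rows are finite whatever
    the cardinality of the graph. *)
Lemma coef_kernel_suffix c b a : a \notin path_suffixes b -> coef_kernel c b a = 0.
Proof.
rewrite /coef_kernel; case: eqP => // ba; apply: contraNeq.
elim/striprP: (stripr _ _ _) => [p pE _|_]; last by rewrite eqxx.
rewrite mem_undup; apply/mapP; exists (size p).
  by rewrite mem_iota add0n /= ltnS pE size_cat leq_addr.
by apply: dipath_inj => //=; rewrite pE drop_size_cat.
Qed.

End tensor_algebra_words.

(** * The cocycle of a bounded derivation *)

Section derivation_cocycle.
Variables (R : realType) (G : digraph).
Local Notation W := (dipath G).
Variable d : bop R W -> bop R W.
Hypotheses
  (d_der : derivation (tensor_algebra R G) (free_semigroupoid_algebra R G) d)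
  (d_bounded : bounded_on (tensor_algebra R G) d).

Let M := normon (tensor_algebra R G) d.

Lemma le_normon S : tensor_algebra R G S -> opnorm S <= 1 -> opnorm (d S) <= M.
Proof.
move=> AS S1; apply: ub_le_sup; last by exists S.
have [B dB] := d_bounded; exists `|B| => _ [T [AT T1] <-].
apply: le_trans (dB T AT) _; apply: le_trans (ler_wpM2r (opnorm_ge0 T) (ler_norm B)) _.
by rewrite ler_piMr.
Qed.

Lemma normon_ge0 : 0 <= M.
Proof.
have [A0 _ _] := tensor_subalgebra R G.
apply: le_trans (opnorm_ge0 (d 0)) _; apply: le_normon => //.
apply: opnorm_le => f f1; have -> : (0 : bop R W) f = 0 by [].
by rewrite l2norm0 ler01.
Qed.

Lemma d_right_commuting S : tensor_algebra R G S -> right_commuting (d S).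
Proof. by have [dX _ _] := d_der => /dX/free_semigroupoid_right_commuting. Qed.

Definition dcoef x w q : R[i] := ev (d (Lword R x w) (xi (vpath x))) x q.

(** This is the Leibniz rule on the vector of [x]: d(L_v) commutes with right creation and gives the
    term c_v.w, and L_v d(L_w) gives v.c_w. *)
Lemma dcoef_cocycle : bounded_cocycle dcoef (M ^+ 2).
Proof.
split=> [x y z v w q xw yv xq|x y w Q xw uQ QP].
  have [_ _ dM] := d_der.
  rewrite /dcoef -(Lword_cat R v xw) dM; [|exact: tensor_word|exact: tensor_word].
  have [a [aE xa aw ay]] := Lword_xi R xw (erefl : prng (vpath x) = x).
  rewrite cats0 in aw.
  have -> (S T : bop R W) f : (S + T) f = S f + T f by [].
  have -> (S T : bop R W) f : bcomp S T f = S (T f) by [].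
  have -> (S T : bop R W) f : bcomp S T f = S (T f) by [].
  rewrite evD aE; congr (_ + _).
    have [xcq _] := xq; rewrite (evE _ xcq) right_commuting_xi; last first.
      by apply: d_right_commuting; exact: tensor_word.
    by rewrite /= xa eqxx ay aw.
  have [xcq xz] := xq; rewrite ev_word//; apply: stripl_ext => p qE; subst q.
  rewrite ifT//; apply/eqP.
  case: v yv {xq} xcq xz => [|e v] yv xq xz.
    by move: xz => /= ->; case: yv.
  have [[_ yq] [yv' _]] := ((composable_cat _ _ _).1 xq, yv).
  exact: composable_src yq yv' _.
apply: le_trans (ev_sum_le _ uQ (fun q qQ => (QP q qQ).1)) _.
have dw : opnorm (d (Lword R x w)) <= M.
  by apply: le_normon; [exact: tensor_word|exact: opnorm_Lword].
rewrite ler_pXn2r ?nnegrE ?l2norm_ge0 ?normon_ge0//.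
by apply: le_trans (l2norm_bop _ _) _; rewrite l2norm_xi mulr1.
Qed.

End derivation_cocycle.

(** * The coefficients of the implementing operator *)

Section inner_coefficients.
Variables (R : realType) (G : digraph).
Local Notation W := (dipath G).
Implicit Types (x y z : vertex G) (p q s t u v w : seq (edge G)) (a b : W).
Variable d : bop R W -> bop R W.
Hypothesis
  (d_der : derivation (tensor_algebra R G) (free_semigroupoid_algebra R G) d).
Variable sigma : vertex G -> seq (edge G) -> R[i].
Hypothesis sigmaP : forall x y w q, ispath x y w -> ispath x y q ->
  dcoef d x w q = stripl (sigma x) w q - stripr (sigma y) w q.

(** If d(L_x) = L_x T - T L_x, then at a path from [x] that does not end at [x] the first term
    vanishes, which forces the second branch. *)
Definition inner_coef x u : R[i] :=
  if path_rng x u == x then sigma x u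
  else - ev (d (Lword R x [::]) (xi (vpath x))) x u.

Lemma derivation0 : d 0 = 0.
Proof.
have [_ dZ _] := d_der; have [A0 _ _] := tensor_subalgebra R G.
have := dZ 1 0 0 A0 A0; rewrite !scale1r addr0.
by move=> /eqP; rewrite -subr_eq0 opprD addrA subrr sub0r oppr_eq0 => /eqP.
Qed.

Lemma derivation_bcomp S T f : tensor_algebra R G S -> tensor_algebra R G T ->
  d (bcomp S T) f = d S (T f) + S (d T f).
Proof. by move=> AS AT; have [_ _ ->] := d_der. Qed.

(** The identity d(L_w) = L_w T - T L_w on the vector of a vertex. For [x' = x] and [q] ending at
    [y] it is the equation for [sigma]; the other cases reduce to vertices by writing L_w as L_w L_x
    or L_y L_w. *)
Lemma inner_coef_vpath x' x y w q : ispath x y w -> composable x' q ->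
  ev (d (Lword R x w) (xi (vpath x'))) x' q =
  stripl (fun p => if path_rng x' p == x then inner_coef x' p else 0) w q -
  (if x' == x then stripr (inner_coef y) w q else 0).
Proof.
move=> xw xq; have xn : ispath x x [::] by [].
have [xx'|/eqP xx'] := eqVneq x' x; last first.
  rewrite subr0 -[in LHS](cats0 w) -(Lword_cat R w xn).
  rewrite derivation_bcomp; [|exact: tensor_word|exact: tensor_word].
  have -> : Lword R x [::] (xi (vpath x')) = 0.
    by apply: Lvertex_xi0; rewrite /prng/=.
  rewrite bop0 add0r ev_word//; apply: stripl_ext => p qE; subst q.
  case: eqP => // px; have [xp _] := (composable_cat _ _ _).1 xq.
  (* From d(L_x L_x') = 0, the value of d(L_x) on the vector of [x'] is the opposite of that of L_x
     d(L_x'), which [inner_coef x'] records. *)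
  have : d (bcomp (Lword R x [::]) (Lword R x' [::])) (xi (vpath x')) = 0.
    rewrite (_ : bcomp _ _ = 0) ?derivation0//; apply: bop_ext => a.
    apply: ell2_ext => z r zr; rewrite ev0 [LHS](ev_vertex _ _ zr) ev_vertex//.
    by case: eqP => // ->; case: eqP => // xE; case: xx'.
  rewrite derivation_bcomp; [|exact: tensor_word|exact: tensor_word].
  move=> /(congr1 (fun f => ev f x' p)); rewrite evD ev0 ev_vertex// px eqxx.
  have -> : Lword R x' [::] (xi (vpath x')) = xi (vpath x') by exact: Lvertex_xi.
  rewrite /inner_coef px; case: eqP => [xE|_]; first by case: xx'.
  by move=> /eqP; rewrite addr_eq0 => /eqP.
subst x'; have [qy|qy] := eqVneq (path_rng x q) y.
  rewrite -/(dcoef d x w q) (sigmaP xw (conj xq qy)); congr (_ - _).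
    apply: stripl_ext => p qE; subst q; have [xp pw] := (composable_cat _ _ _).1 xq.
    have px : path_rng x p = x.
      case: w {xq} xw pw qy => [|e w] xw pw qy.
        by rewrite -(ispath_nilP xw) in qy.
      exact: composable_src pw xw.1 _.
    by rewrite /inner_coef px eqxx.
  apply: stripr_ext => p qE; subst q; rewrite /inner_coef.
  by move: qy; rewrite path_rng_cat xw.2 => ->; rewrite eqxx.
have -> : stripl (fun p => if path_rng x p == x then inner_coef x p else 0) w q = 0.
  elim/striplP: (stripl _ _ _) => // p qE; subst q; case: eqP => // px.
  by move: qy; rewrite path_rng_cat px xw.2 eqxx.
(* In d(L_y L_w) the term L_y d(L_w) vanishes at [q], which does not end at [y]; d(L_y) L_w
   remains. *)
rewrite sub0r -[in LHS](cat0s w) -(Lword_cat R [::] xw).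
rewrite derivation_bcomp; [|exact: tensor_word|exact: tensor_word].
rewrite evD [X in _ + X](ev_vertex _ _ xq) (negbTE qy) addr0.
have [a [aE xa aw ay]] := Lword_xi R xw (erefl : prng (vpath x) = x).
rewrite cats0 in aw.
rewrite aE (evE _ xq) right_commuting_xi; last first.
  by apply: (d_right_commuting d_der); exact: tensor_word.
rewrite /= xa eqxx ay aw.
have -> : - stripr (inner_coef y) w q = stripr (fun p => - inner_coef y p) w q.
  elim/striprP: (stripr (inner_coef y) w q) => [p ->|nq].
    by rewrite stripr_cat.
  by rewrite stripr0// oppr0.
apply: stripr_ext => p qE; subst q; rewrite /inner_coef.
move: qy; rewrite path_rng_cat xw.2 => /negbTE ->.
by rewrite opprK.
Qed.

Lemma derivation_word_xi x y w a q : ispath x y w -> composable (psrc a) q ->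
  ev (d (Lword R x w) (xi a)) (psrc a) q =
  stripl (fun p => if path_rng (psrc a) p == x then
    stripr (inner_coef (prng a)) (pedges a) p else 0) w q -
  (if prng a == x then stripr (inner_coef y) (w ++ pedges a) q else 0).
Proof.
move=> xw zq; rewrite (evE _ zq) right_commuting_xi; last first.
  by apply: (d_right_commuting d_der); exact: tensor_word.
rewrite /= eqxx -stripr_comp.
rewrite (stripr_ext (h' := fun q => stripl (fun p => if path_rng (prng a) p == x
   then inner_coef (prng a) p else 0) w q -
   (if prng a == x then stripr (inner_coef y) w q else 0))); last first.
  move=> p qE; subst q; apply: inner_coef_vpath => //.
  by have [_] := (composable_cat _ _ _).1 zq.
have -> : stripl (fun p => if path_rng (psrc a) p == x
    then stripr (inner_coef (prng a)) (pedges a) p else 0) w q =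
   stripr (stripl (fun p => if path_rng (prng a) p == x
     then inner_coef (prng a) p else 0) w) (pedges a) q.
  rewrite -stripl_stripr; apply: stripl_ext => p qE.
  elim/striprP: (stripr _ _ p) => [p' pE|np]; last by rewrite stripr0// if_same.
  by subst p; rewrite stripr_cat path_rng_cat.
case: (boolP (suffix (pedges a) q)) => [/suffixP[p ->]|np].
  by rewrite !stripr_cat.
by rewrite !stripr0// if_same subrr.
Qed.

End inner_coefficients.

(** * The norm bound *)

Section signs.
Variable R : realType.

(** For distinct [i] and [j], flipping the sign at [i] is a bijection that negates every term. *)
Lemma sum_signs n (i j : 'I_n) :
  \sum_(s : {ffun 'I_n -> bool}) (-1) ^+ s i * (-1) ^+ s j =
  if i == j then #|{ffun 'I_n -> bool}|%:R else 0 :> R[i].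
Proof.
case: eqP => [->|/eqP ij].
  rewrite (eq_bigr (fun=> 1)) ?sumr_const// => s _.
  by rewrite -expr2 sqrr_sign.
pose flip (s : {ffun 'I_n -> bool}) : {ffun 'I_n -> bool} :=
  [ffun k => if k == i then ~~ s k else s k].
have flipK : involutive flip.
  move=> s; apply/ffunP => k; rewrite !ffunE; case: eqP => // _.
  by rewrite negbK.
set S := \sum_s _; suff : S = - S.
  by move/eqP; rewrite -addr_eq0 -mulr2n mulrn_eq0 => /eqP.
rewrite {1}/S (reindex_inj (inv_inj flipK))/= -sumrN; apply: eq_bigr => s _.
by rewrite !ffunE eqxx eq_sym (negbTE ij) signrN mulNr.
Qed.

Lemma normc_sign (b : bool) : normc ((-1) ^+ b : R[i]) = 1.
Proof. by case: b; rewrite ?expr0 ?expr1 ?normcN ?(normc1 R). Qed.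

End signs.

(** * Partial isometries from incomparable words *)

Section word_isometries.
Variables (R : realType) (G : digraph).
Local Notation W := (dipath G).
Implicit Types (x y z : vertex G) (p q s t u v w : seq (edge G)) (a b : W).
Variables (F : seq (vertex G)) (w : vertex G -> seq (edge G)).
Hypotheses (F_uniq : uniq F) (w_path : forall x, x \in F -> composable x (w x))
  (w_incomparable : forall x y z p p', x \in F -> y \in F -> ispath z x p ->
     ispath z y p' -> w x ++ p = w y ++ p' -> x = y).

(** A second nonzero term would give two words of the family that are prefixes of one path. *)
Lemma sum_words (h : vertex G -> seq (edge G) -> R[i]) y z p : y \in F ->
  ispath z y p ->
  \sum_(x <- F) stripl (fun p => if path_rng z p == x then h x p else 0)
                       (w x) (w y ++ p) = h y p.
Proof.
move=> yF zp; rewrite (bigD1_seq y)//= stripl_cat zp.2 eqxx big1_seq ?addr0//.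
move=> x /andP[xy xF].
case: (boolP (prefix (w x) (w y ++ p))) => [/prefixP[p' pE]|np]; last by rewrite stripl0.
rewrite pE stripl_cat; case: eqP => // zx; case/eqP: xy.
have zp' : ispath z x p'.
  split=> //; have : composable z (w y ++ p).
    by apply/composable_cat; rewrite zp.2; split; [exact: zp.1|exact: w_path].
  by rewrite pE => /composable_cat[].
exact: w_incomparable zp' zp (esym pE).
Qed.

Variable c : vertex G -> R[i].
Hypothesis c_norm : forall x, normc (c x) = 1.

Definition word_isometry : bop R W := \sum_(x <- F) c x *: Lword R x (w x).

Lemma bop_sumE (I : choiceType) (J : Type) (r : seq J) (T : J -> bop R I) f :
  (\sum_(j <- r) T j) f = \sum_(j <- r) T j f.
Proof. by elim: r => [|j r ih]; rewrite ?big_nil ?big_cons// -ih. Qed.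

Lemma ev_word_isometry f z q : composable z q ->
  ev (word_isometry f) z q = \sum_(x <- F) stripl
    (fun p => if path_rng z p == x then c x * ev f z p else 0) (w x) q.
Proof.
move=> zq; rewrite /word_isometry bop_sumE ev_sum; apply: eq_bigr => x _.
have -> : (c x *: Lword R x (w x)) f = c x *: Lword R x (w x) f by [].
rewrite ev_scale ev_word//.
elim/striplP: (stripl _ _ q) => [p ->|nq]; last by rewrite stripl0// mulr0.
by rewrite stripl_cat; case: ifP; rewrite ?mulr0.
Qed.

Definition word_map a : option W :=
  if pselect (prng a \in F) is left h then
    Some (@DiPath G (psrc a) (w (prng a) ++ pedges a)
      ((composable_cat _ _ _).2 (conj (dipathP a) (w_path h))))
  else None.

Lemma word_map_inj a b (r : W) : word_map a = Some r -> word_map b = Some r -> a = b.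
Proof.
rewrite /word_map; case: pselect => // aF; case: pselect => // bF [<-] [ab wab].
have bp := dipath_ispath b; rewrite ab in bp.
have ap := dipath_ispath a.
have rab := w_incomparable bF aF bp ap wab.
by apply: dipath_inj => //; move: wab; rewrite rab => /(cat_inj_size erefl)[].
Qed.

(** Up to factors of modulus 1 the operator is the pushforward along the injective partial map that
    puts the word of [prng a] in front of [a]. *)
Lemma normc_word_isometry f b :
  normc (word_isometry f b) = normc (pushforward word_map_inj f b).
Proof.
rewrite -[word_isometry f b]ev_path ev_word_isometry; last exact: dipathP.
have [[a ab]|nb] := pselect (exists a, word_map a = Some b).
  rewrite (pushforward_some _ _ ab); move: ab; rewrite /word_map.
  case: pselect => // aF [<-] /=.
  rewrite (sum_words (fun x p => c x * ev f (psrc a) p) aF (dipath_ispath a)).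
  by rewrite normcM c_norm mul1r ev_path.
rewrite pushforward_none => [|a ab]; last by case: nb; exists a.
congr normc; rewrite big1_seq// => x /andP[_ xF].
case: (boolP (prefix (w x) (pedges b))) => [/prefixP[p bE]|np]; last by rewrite stripl0.
rewrite bE stripl_cat; case: eqP => // bx; case: nb.
have bp : composable (psrc b) p.
  by have := dipathP b; rewrite bE => /composable_cat[].
exists (DiPath bp); rewrite /word_map; case: pselect => [h|[]]; last by rewrite /prng/= bx.
by congr Some; apply: dipath_inj => //=; rewrite bE /prng/= bx.
Qed.

Lemma opnorm_word_isometry : opnorm word_isometry <= 1.
Proof.
apply: opnorm_le => f f1; apply: le_trans (_ : l2norm (pushforward word_map_inj f) <= _).
  apply: l2norm_le => [|s us]; first exact: l2norm_ge0.
  apply: le_trans (sum_le_l2norm _ us); apply: ler_sum => b _.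
  by rewrite normc_word_isometry.
apply: le_trans (l2norm_bop _ _) _; apply: mulr_ile1; rewrite ?opnorm_ge0 ?l2norm_ge0//.
exact: opnorm_pushforward.
Qed.

End word_isometries.

(** * Boundedness of the implementing matrix *)

Section inner_kernel_bound.
Variables (R : realType) (G : digraph).
Local Notation W := (dipath G).
Implicit Types (x y z : vertex G) (p q t u v w : seq (edge G)) (a b : W).
Variable d : bop R W -> bop R W.
Hypotheses
  (d_der : derivation (tensor_algebra R G) (free_semigroupoid_algebra R G) d)
  (d_bounded : bounded_on (tensor_algebra R G) d).
Hypothesis path_sym :
  forall (x y : vertex G) w, ispath x y w -> exists r, ispath y x r.
Variable sigma : vertex G -> seq (edge G) -> R[i].
Hypotheses (sigmaP : forall x y w q, ispath x y w -> ispath x y q ->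
    dcoef d x w q = stripl (sigma x) w q - stripr (sigma y) w q)
  (sigma_avg : forall z, averaged_on (connected_to z) sigma).
Variable B : R.
Hypotheses (B_gt0 : 0 < B) (MB : normon (tensor_algebra R G) d <= B).

Local Notation K := (coef_kernel (inner_coef d sigma)).

Lemma derivation_sum (J : Type) (r : seq J) (c : J -> R[i]) (S : J -> bop R W) :
  (forall j, tensor_algebra R G (S j)) ->
  tensor_algebra R G (\sum_(j <- r) c j *: S j) /\
  d (\sum_(j <- r) c j *: S j) = \sum_(j <- r) c j *: d (S j).
Proof.
have [A0 AZ _] := tensor_subalgebra R G; have [_ dZ _] := d_der => AS.
elim: r => [|j r [Ar dr]]; first by rewrite !big_nil (derivation0 d_der).
by rewrite !big_cons; split; [exact: AZ|rewrite dZ ?dr].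
Qed.

(** On [s] the matrix is the average of the matrices of the products of the adjoint of V with d(V),
    each bounded by [B]; the corrections from compressing T by V average to zero. *)
Lemma inner_kernel_form_le s (f g : W -> R[i]) : uniq s ->
  (forall a b, a \in s -> b \in s ->
    connected_to (prng a) = connected_to (prng b)) ->
  normc (\sum_(b <- s) \sum_(a <- s) K b a * f a * g b) <=
  B / 2 * (\sum_(i <- s) normc (f i) ^+ 2 + \sum_(i <- s) normc (g i) ^+ 2).
Proof.
move=> us scl; case: s us scl => [|a0 s']; first by rewrite !big_nil (normc0 R) addr0 mulr0.
set s := a0 :: s' => us scl.
pose z := prng a0; pose F := undup [seq prng a | a <- s].
have sF a : a \in s -> prng a \in F by move=> ?; rewrite mem_undup map_f.
have FK x : x \in F -> connected_to z x.
  rewrite mem_undup => /mapP[a a_s ->]; rewrite /z (scl a0 a) ?mem_head//.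
  by exists [::].
pose N := (\max_(a <- s) size (pedges a))%N.
have sN a : a \in s -> (size (pedges a) <= N)%N.
  by move=> a_s; apply: leq_bigmax_seq.
have [m [w [m0 w_path w_inc w_avg]]] := sigma_avg N FK.
pose n := size F.
(* Averaging is over word families and signs. The extra sign makes the ordinal type nonempty, as
   [inord] demands. *)
pose T := ('I_m * {ffun 'I_n.+1 -> bool})%type.
pose ix x : 'I_n.+1 := inord (index x F).
have ix_inj x y : x \in F -> y \in F -> ix x = ix y -> x = y.
  move=> xF yF /(congr1 (@nat_of_ord _)); rewrite /ix !inordK ?ltnS ?index_size// => xy.
  by rewrite -(nth_index x xF) xy nth_index.
pose sg (e : {ffun 'I_n.+1 -> bool}) x : R[i] := (-1) ^+ e (ix x).
(* The default [b] is never taken for [b] in [s]. *)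
pose phi i b : W := if pselect (composable (psrc b) (w i (prng b) ++ pedges b))
  is left h then DiPath h else b.
have w_comp i b : b \in s -> composable (psrc b) (w i (prng b) ++ pedges b).
  move=> /sF bF; apply/composable_cat; split; first exact: dipathP.
  by rewrite (dipath_ispath b).2; exact: w_path.
have phiE i b : b \in s ->
    psrc (phi i b) = psrc b /\ pedges (phi i b) = w i (prng b) ++ pedges b.
  by move=> /(w_comp i) h; rewrite /phi; case: pselect.
have phi_inj i : {in s &, injective (phi i)}.
  move=> a b a_s b_s ab; have [sa pa] := phiE i a a_s; have [sb pb] := phiE i b b_s.
  have ap := dipath_ispath a; have bp := dipath_ispath b.
  have wab : w i (prng a) ++ pedges a = w i (prng b) ++ pedges b by rewrite -pa ab pb.
  have sab : psrc a = psrc b by rewrite -sa ab sb.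
  rewrite -sab in bp; have rab := w_inc i _ _ _ _ _ (sF _ a_s) (sF _ b_s) ap bp wab.
  by apply: dipath_inj => //; move: wab; rewrite rab => /(cat_inj_size erefl)[].
pose V (c : T) := word_isometry (R := R) F (w c.1) (sg c.2).
(* The entry of the adjoint of V times d(V): V sends xi_b to a sign times the vector of
   [phi c.1 b]. *)
pose Kt (c : T) b a : R[i] := sg c.2 (prng b) * d (V c) (xi a) (phi c.1 b).
have uF : uniq F by exact: undup_uniq.
have T0 : (0 < #|{: T}|)%N by apply/card_gt0P; exists (Ordinal m0, [ffun=> false]).
have dV i e : tensor_algebra R G (V (i, e)) /\
    d (V (i, e)) = \sum_(x <- F) sg e x *: d (Lword R x (w i x)).
  by apply: derivation_sum => x; exact: tensor_word.
have KtE i e a b : a \in s -> b \in s -> Kt (i, e) b a = K b a -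
    if psrc b == psrc a then (sg e (prng b) * sg e (prng a)) *
      stripr (inner_coef d sigma (path_rng (prng a) (w i (prng a))))
        (w i (prng a) ++ pedges a) (w i (prng b) ++ pedges b) else 0.
  move=> a_s b_s; have [sb pb] := phiE i b b_s.
  rewrite /Kt /= -[d _ _ _]ev_path sb pb /coef_kernel.
  case: eqP => [ba|nba]; last first.
    rewrite subr0 (evE _ (w_comp i b b_s)) right_commuting_xi; last first.
      by apply: (d_right_commuting d_der); exact: (dV i e).1.
    by rewrite /=; case: eqP => // _; rewrite mulr0.
  rewrite (dV i e).2 bop_sumE ev_sum ba.
  have wb := w_comp i b b_s; rewrite ba in wb.
  rewrite (eq_big_seq (fun x => stripl (fun p => if path_rng (psrc a) p == x then
      sg e x * stripr (inner_coef d sigma (prng a)) (pedges a) p else 0) (w i x)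
        (w i (prng b) ++ pedges b) -
      (if x == prng a then sg e x * stripr (inner_coef d sigma (path_rng x (w i x)))
        (w i x ++ pedges a) (w i (prng b) ++ pedges b) else 0))); last first.
    move=> x xF.
    have -> : (sg e x *: d (Lword R x (w i x))) (xi a) =
      sg e x *: d (Lword R x (w i x)) (xi a) by [].
    have xw : ispath x (path_rng x (w i x)) (w i x) by split=> //; exact: w_path.
    rewrite ev_scale (derivation_word_xi d_der sigmaP xw wb) mulrBr; congr (_ - _).
      elim/striplP: (stripl _ _ _) => [p ->|np]; last by rewrite stripl0// mulr0.
      by rewrite stripl_cat; case: ifP => // _; rewrite mulr0.
    by rewrite eq_sym; case: ifP => // _; rewrite mulr0.
  have bp := dipath_ispath b; rewrite ba in bp.
  rewrite sumrB (sum_words uF (w_path i) (w_inc i)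
    (fun x p => sg e x * stripr (inner_coef d sigma (prng a)) (pedges a) p) (sF _ b_s) bp).
  rewrite (bigD1_seq (prng a))//= ?sF// eqxx big1 ?addr0; last first.
    by move=> x /negbTE ->.
  rewrite mulrBr !mulrA; congr (_ - _).
  by rewrite /sg -expr2 sqrr_sign mul1r.
have KE a b : a \in s -> b \in s -> K b a = #|{: T}|%:R^-1 * \sum_c Kt c b a.
  move=> a_s b_s; pose X i := stripr (inner_coef d sigma (path_rng (prng a) (w i (prng a))))
    (w i (prng a) ++ pedges a) (w i (prng b) ++ pedges b).
  rewrite (eq_bigr (fun c : T => K b a - if psrc b == psrc a then
    sg c.2 (prng b) * sg c.2 (prng a) * X c.1 else 0)); last first.
    by case=> i e _; exact: KtE.
  rewrite sumrB sumr_const [X in _ - X](_ : _ = 0).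
    by rewrite subr0 -[K b a *+ _]mulr_natl mulKf// pnatr_eq0 -lt0n.
  case: eqP => [ba|_]; last exact: big1.
  (* Summing over the signs kills the entries with [prng a] and [prng b] distinct; for equal ranges
     the sum over the word families vanishes by [w_avg]. *)
  rewrite -(pair_bigA _ (fun (i : 'I_m) e => sg e (prng b) * sg e (prng a) * X i))/=.
  under eq_bigr do rewrite -mulr_suml sum_signs.
  rewrite -mulr_sumr; case: eqP => [/ix_inj|_]; last by rewrite mul0r.
  rewrite !sF// => /(_ isT isT) rba.
  have ap := dipath_ispath a; have bp := dipath_ispath b.
  rewrite rba ba in bp.
  rewrite [X in _ * X](_ : _ = 0) ?mulr0//.
  rewrite -[RHS](w_avg _ _ _ _ (sF _ a_s) ap bp (sN a a_s) (sN b b_s)).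
  apply: eq_bigr => i _; rewrite /X rba; apply: stripr_ext => p pE.
  rewrite /inner_coef; have -> : path_rng (path_rng (prng a) (w i (prng a))) p =
     path_rng (prng a) (w i (prng a)).
    have := congr1 (path_rng (psrc a)) pE.
    by rewrite !path_rng_cat ap.2 bp.2 => <-.
  by rewrite eqxx.
rewrite (eq_big_seq (fun b => \sum_(a <- s)
    #|{: T}|%:R^-1 * (\sum_c Kt c b a) * f a * g b)); last first.
  by move=> b b_s; apply: eq_big_seq => a a_s; rewrite -KE.
apply: form_le_avg => // c; apply: form_le_bop => //.
- apply: le_trans MB; apply: (le_normon d_bounded); first by case: (c) => i e; exact: (dV i e).1.
  by apply: (opnorm_word_isometry uF (w_path _) (w_inc _)) => x; exact: normc_sign.
- by move=> b; exact: normc_sign.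
Qed.

(** A nonzero entry joins two paths with a common source, whose ranges therefore lie in one
    component. *)
Lemma inner_kernel_bounded : form_bounded B K.
Proof.
apply: (form_bounded_block
  (cl := fun a : W => connected_to (prng a) : {classic (vertex G -> Prop)})).
  move=> b a /eqP ab; rewrite /coef_kernel; case: eqP => // ba.
  elim/striprP: (stripr _ _ _) => // p pE; case: ab.
  by rewrite -(connected_to_class path_sym (dipath_ispath a))
             -(connected_to_class path_sym (dipath_ispath b)) ba.
move=> s f g us scl; apply: inner_kernel_form_le => // a b; exact: scl.
Qed.

End inner_kernel_bound.

(** * Weak operator approximation *)

Section inner_bounds.
Context {R : realType} {I : choiceType}.
Implicit Types (f g h : ell2 R I).

Lemma innerDl f g h : inner (f + g) h = inner f h + inner g h.
Proof.
apply: (cvg_lim (@norm_hausdorff _ (R[i]^o))).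
have -> : partial_sum (fun i => (f + g) i * (h i)^* : R[i]^o) =
  (fun A => partial_sum (fun i => f i * (h i)^* : R[i]^o) A +
            partial_sum (fun i => g i * (h i)^* : R[i]^o) A).
  apply/funext => A; rewrite /partial_sum -big_split/=.
  by apply: eq_bigr => i _; rewrite -mulrDl.
by apply: cvgD; exact: cvg_inner.
Qed.

Lemma innerDr f g h : inner h (f + g) = inner h f + inner h g.
Proof.
apply: (cvg_lim (@norm_hausdorff _ (R[i]^o))).
have -> : partial_sum (fun i => h i * ((f + g) i)^* : R[i]^o) =
  (fun A => partial_sum (fun i => h i * (f i)^* : R[i]^o) A +
            partial_sum (fun i => h i * (g i)^* : R[i]^o) A).
  apply/funext => A; rewrite /partial_sum -big_split/=.
  by apply: eq_bigr => i _; rewrite -mulrDr -rmorphD.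
by apply: cvgD; exact: cvg_inner.
Qed.

Lemma inner_trunc h (c : I -> R[i]) s : uniq s ->
  inner h (trunc c s) = \sum_(i <- s) h i * (c i)^*.
Proof.
move=> us; apply: (cvg_lim (@norm_hausdorff _ (R[i]^o))).
apply: cvg_near_cst; exists [fset i in s]%fset => // A /= /fsubsetP sA.
rewrite /partial_sum -(big_seq_fsetE _ A predT (fun j => h j * (trunc c s j)^*))/=.
rewrite [RHS](sum_sub_seq _ us (fset_uniq A)); last first.
  by move=> i si; apply: sA; rewrite inE.
by apply: eq_bigr => i _; rewrite truncE//; case: ifP => // _; rewrite conjC0 mulr0.
Qed.

Lemma l2normN f : l2norm (- f) = l2norm f.
Proof. by rewrite -scaleN1r l2normZ normcN (normc1 R) mul1r. Qed.

Lemma l2norm_trunc_le f s : uniq s -> l2norm (trunc f s) <= l2norm f.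
Proof.
move=> us; rewrite -(@ler_pXn2r _ 2)// ?nnegrE ?l2norm_ge0// sqr_l2norm_trunc//.
exact: sum_le_l2norm.
Qed.

Lemma normc_inner f g : normc (inner f g) <= l2norm f * l2norm g.
Proof.
have [f0|f0] := eqVneq (l2norm f) 0.
  have -> : inner f g = 0.
    rewrite (l2norm_eq0 f0); apply: (addrI (inner 0 g)).
    by rewrite -innerDl !addr0.
  by rewrite (normc0 R) mulr_ge0 ?l2norm_ge0.
have [g0|g0] := eqVneq (l2norm g) 0.
  have -> : inner f g = 0.
    rewrite (l2norm_eq0 g0); apply: (addrI (inner f 0)).
    by rewrite -innerDr !addr0.
  by rewrite (normc0 R) mulr_ge0 ?l2norm_ge0.
have fp : 0 < l2norm f by rewrite lt_def f0 l2norm_ge0.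
have gp : 0 < l2norm g by rewrite lt_def g0 l2norm_ge0.
(* This weight turns the arithmetic-geometric bound into the Cauchy-Schwarz one. *)
pose t := l2norm g / l2norm f; have t0 : 0 < t by rewrite divr_gt0.
have fgE : l2norm f * l2norm g = t / 2 * l2norm f ^+ 2 + (2 * t)^-1 * l2norm g ^+ 2.
  by rewrite /t; field; rewrite f0 g0.
apply/ler_addgt0Pr => e e0.
have /cvgrPdist_lt/(_ e%:C%C) := @cvg_inner _ _ f g.
rewrite ltcR => /(_ e0) /filter_ex[A]; rewrite [X in X < _](_ : _ =
  (normc (inner f g - partial_sum (fun i => f i * (g i)^*) A))%:C%C)// ltcR => ltA.
rewrite -(subrK (partial_sum (fun i => f i * (g i)^*) A) (inner f g)).
apply: le_trans (le_normcD _ _) _; rewrite addrC lerD ?(ltW ltA)//.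
rewrite /partial_sum -(big_seq_fsetE _ A predT (fun i => f i * (g i)^*))/=.
apply: le_trans (sumr_normc _ _) _; rewrite fgE.
apply: (@le_trans _ _ (\sum_(i <- A) (t / 2 * normc (f i) ^+ 2 +
    (2 * t)^-1 * normc (g i) ^+ 2))).
  by apply: ler_sum => i _; rewrite normcM normc_conj amgm.
rewrite big_split/= -!mulr_sumr lerD// ler_wpM2l ?sum_le_l2norm//.
- by rewrite divr_ge0// ltW.
- by rewrite invr_ge0 mulr_ge0// ltW.
Qed.

End inner_bounds.

Section wot_approximation.
Local Open Scope classical_set_scope.
Local Open Scope ring_scope.
Context {R : realType} {I : choiceType}.
Implicit Types (S T : bop R I) (A : set (bop R I)).

Lemma cvg_initial (S : choiceType) (T : topologicalType) (f : S -> T)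
    (F : set_system S) (s : S) : Filter F ->
  f @ F --> f s -> F --> (s : initial_topology f).
Proof.
move=> FF fFs A [_ [[B oB <-] Bfs] sBA].
apply: (@filterS _ _ _ (f @^-1` B)%classic) => //.
by apply: fFs; exact: open_nbhs_nbhs.
Qed.

Lemma cvg_ptws (U : Type) (V : topologicalType) (F : set_system (U -> V)) (f : U -> V) :
  Filter F -> (forall x, (fun g : U -> V => g x) @ F --> f x) ->
  F --> (f : {ptws U -> V}).
Proof.
move=> FF Ff; apply/cvg_sup => x; apply: cvg_initial; exact: Ff.
Qed.

(** For a norm-bounded family, convergence of the entries on basis vectors is weak operator
    convergence. The filter is generated by the approximants to accuracy [e] on a finite set [s]. *)
Lemma wot_closed_approx A T (B : R) : wot_closed A ->
  (forall (s : seq I) (e : R), 0 < e -> exists S, [/\ A S, opnorm S <= B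
    & forall a b, a \in s -> b \in s ->
        normc (S (xi a) b - T (xi a) b) <= e]) -> A T.
Proof.
move=> clA approx.
pose D (se : seq I * R) : set (bop R I) := [set S | [/\ A S, opnorm S <= B
    & forall a b, a \in se.1 -> b \in se.1 ->
        normc (S (xi a) b - T (xi a) b) <= se.2]]%classic.
pose F := filter_from [set se : seq I * R | 0 < se.2]%classic D.
have FF : ProperFilter F.
  apply: filter_from_proper => [|[s e] /= e0]; last exact: approx.
  apply: filter_from_filter; first by exists ([::], 1) => /=; exact: ltr01.
  move=> [s e] [s' e'] /= e0 e'0; exists (s ++ s', Num.min e e').
    by rewrite /= lt_min e0.
  move=> S [AS SB h]; split; split=> // a b /= a_s b_s;
    (apply: le_trans (h a b _ _) _; rewrite /= ?mem_cat ?a_s ?b_s ?orbT//).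
    by rewrite ge_min lexx.
  by rewrite ge_min lexx orbT.
apply: (@closed_cvg _ (initial_topology (@matrix_coefs R I)) F FF id A clA).
  by exists ([::], 1) => [/=|S []//]; exact: ltr01.
apply: cvg_initial; apply: cvg_ptws => -[f g].
apply/(@cvgrPdist_le _ (R[i]^o)) => eps eps0.
have [e e0 ->] : exists2 e : R, 0 < e & eps = e%:C%C.
  have /complex_realP[e epsE] := gtr0_real eps0.
  by exists e => //; rewrite -ltcR -epsE.
pose C := `|B| + opnorm T; have C0 : 0 <= C by rewrite addr_ge0 ?opnorm_ge0.
pose n := l2norm f + l2norm g + 1; have n0 : 0 < n.
  by rewrite ltr_wpDl// addr_ge0 ?l2norm_ge0.
(* Two thirds of the error come from truncating [f] and [g]; [C] bounds the norm of the difference T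
   - S uniformly in S. The remaining third is the finite double sum, handled by [de]. *)
pose e1 := e / 3 / ((C + 1) * n).
have e1_gt0 : 0 < e1 by rewrite !divr_gt0 ?mulr_gt0// ltr_wpDl.
have [s us fs] := trunc_approx f e1_gt0; have [s' us' gs'] := trunc_approx g e1_gt0.
pose m := \sum_(b <- s') \sum_(a <- s) normc (f a) * normc (g b).
have m0 : 0 <= m.
  by do 2!(apply: sumr_ge0 => ? _); rewrite mulr_ge0 ?normc_ge0.
pose de := e / 3 / (m + 1); have de0 : 0 < de by rewrite !divr_gt0// ltr_wpDl.
exists (s ++ s', de) => // S [AS SB Sde].
suff : normc (inner (T f) g - inner (S f) g) <= e by rewrite -lecR.
pose Df := T - S; have DE h : Df h = T h - S h by [].
have Dh h : l2norm (Df h) <= C * l2norm h.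
  rewrite DE; apply: le_trans (l2normD _ _) _; rewrite l2normN /C addrC mulrDl.
  apply: lerD; apply: le_trans (l2norm_bop _ _) _ => //.
  by rewrite ler_wpM2r ?l2norm_ge0// (le_trans SB)// ler_norm.
have -> : inner (T f) g - inner (S f) g = inner (Df (trunc f s)) (trunc g s') +
    (inner (Df (trunc f s)) (g - trunc g s') + inner (Df (f - trunc f s)) g).
  have -> : inner (T f) g - inner (S f) g = inner (Df f) g.
    by rewrite -{1}(subrK (S f) (T f)) innerDl addrK.
  have -> : inner (Df f) g = inner (Df (f - trunc f s)) g + inner (Df (trunc f s)) g.
    by rewrite -innerDl -bopD subrK.
  by rewrite [RHS]addrA -innerDr [trunc g s' + _]addrC subrK addrC.
have small x y : 0 <= x -> x <= y -> 0 < y -> e / 3 / y * x <= e / 3.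
  move=> x0 xy y0; rewrite -mulrA ger_pMr ?divr_gt0//.
  by rewrite mulrC ler_pdivrMr// mul1r.
have n_ge : l2norm f <= n /\ l2norm g <= n.
  by split; rewrite /n; have := l2norm_ge0 f; have := l2norm_ge0 g; lra.
have term x : 0 <= x -> x <= n -> C * x * e1 <= e / 3.
  move=> x0 xn; rewrite mulrC; apply: small; rewrite ?mulr_ge0//.
    by rewrite ler_pM// lerDl.
  by rewrite mulr_gt0// ltr_wpDl.
rewrite [leRHS](_ : _ = e / 3 + (e / 3 + e / 3)); last by field.
apply: le_trans (le_normcD _ _) _; apply: lerD.
  rewrite inner_trunc//; under eq_bigr do rewrite bop_trunc mulr_suml.
  apply: le_trans (sumr_normc _ _) _.
  apply: (@le_trans _ _ (de * m)); last by apply: small; rewrite ?lerDl ?ltr_wpDl.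
  rewrite /m mulr_sumr big_seq [leRHS]big_seq; apply: ler_sum => b b_s.
  apply: le_trans (sumr_normc _ _) _; rewrite mulr_sumr big_seq [leRHS]big_seq.
  apply: ler_sum => a a_s; rewrite !normcM normc_conj [de * _]mulrC mulrAC.
  rewrite ler_wpM2l ?mulr_ge0 ?normc_ge0// DE ell2BE -normcN opprB.
  by apply: Sde; rewrite mem_cat ?a_s ?b_s ?orbT.
apply: le_trans (le_normcD _ _) _; apply: lerD.
  apply: le_trans (normc_inner _ _) _; apply: le_trans (term _ (l2norm_ge0 f) n_ge.1).
  apply: ler_pM; rewrite ?l2norm_ge0//; apply: le_trans (Dh _) _.
  by rewrite ler_wpM2l// l2norm_trunc_le.
apply: le_trans (normc_inner _ _) _; apply: le_trans (term _ (l2norm_ge0 g) n_ge.2).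
rewrite mulrAC; apply: ler_pM; rewrite ?l2norm_ge0//.
by apply: le_trans (Dh _) _; rewrite ler_wpM2l.
Qed.

End wot_approximation.

(** * Fejer means *)

Section block_counting.

Lemma sum_period (F : nat -> nat) k n : (forall i, F (i + k)%N = F i) ->
  (\sum_(j < k) F (n + j) = \sum_(j < k) F j)%N.
Proof.
move=> Fk; elim: n => [|n ih]; first by apply: eq_bigr => j _; rewrite add0n.
rewrite -ih; case: k Fk {ih} => [|k] Fk; first by rewrite !big_ord0.
rewrite big_ord_recr big_ord_recl /= addn0 addSnnS Fk addnC; congr (_ + _)%N.
by apply: eq_bigr => j _; rewrite addSnnS.
Qed.

Lemma sum_ltn k m : (\sum_(j < k) (j < m) = minn k m)%N.
Proof.
elim: k => [|k ih]; first by rewrite big_ord0 min0n.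
by rewrite big_ord_recr/= ih; case: ltnP => h; rewrite /minn; case: ltnP; case: ltnP => /=; lia.
Qed.

(** The summand has period [k], so [n] may be taken to be 0; then the quotients agree exactly for j
    < k - l. The subtraction is truncated, giving 0 for l >= k. *)
Lemma same_block_count k n l : (0 < k)%N ->
  (\sum_(j < k) ((l + n + j) %/ k == (n + j) %/ k) = k - l)%N.
Proof.
move=> k0; pose F i : nat := ((l + i) %/ k == i %/ k)%N.
rewrite (eq_bigr (fun j : 'I_k => F (n + j)%N)); last by move=> j _; rewrite /F addnA.
rewrite sum_period => [|i]; last first.
  by rewrite /F addnA !(divnDr _ (dvdnn k)) eqn_add2r.
rewrite (eq_bigr (fun j : 'I_k => (j < k - l)%N : nat)); last first.
  move=> j _; rewrite /F (divn_small (ltn_ord j)) -leqn0 -ltnS ltn_divLR// mul1n.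
  by congr nat_of_bool; lia.
by rewrite sum_ltn; apply/minn_idPr; exact: leq_subr.
Qed.

End block_counting.

Section bounded_words.
Variable T : eqType.
Implicit Types (E s t : seq T).

Fixpoint words E k : seq (seq T) :=
  if k is k'.+1 then [::] :: [seq e :: s | e <- E, s <- words E k'] else [::].

Lemma mem_words E k s : (s \in words E k) = all (mem E) s && (size s < k)%N.
Proof.
elim: k s => [|k ih] s; first by rewrite ltn0 andbF.
rewrite inE; case: s => [|e s] //=; apply/allpairsP/idP.
  by move=> [[e' s'] /= [eE]]; rewrite ih => sE [-> ->]; rewrite eE.
move=> /andP[/andP[eE sE] sk]; exists (e, s); split=> //=.
by rewrite ih sE.
Qed.

(** The invariant that makes the restriction to words over [E] a compression to diagonal blocks:
    prefixing [s] preserves it exactly when all letters of [s] are in [E]. *)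
Definition strip_prefix E s := drop (find [predC E] s) s.

Lemma strip_prefix_cat E s t :
  (strip_prefix E (s ++ t) == strip_prefix E t) = all (mem E) s.
Proof.
rewrite /strip_prefix find_cat; case: ifPn => [hs|]; last first.
  rewrite -all_predC => h; rewrite drop_cat ltnNge leq_addr/= addKn eqxx.
  by apply/esym; apply: sub_all h => e /=; rewrite negbK.
rewrite drop_cat -has_find hs.
have -> : all (mem E) s = false.
  by apply/negP => /allP h; move/hasP: hs => [e /h/= eE]; rewrite eE.
apply/negP => /eqP /(congr1 size); rewrite size_cat !size_drop.
by move: hs; rewrite has_find; lia.
Qed.

End bounded_words.

Section fejer.
Variables (R : realType) (G : digraph).
Local Notation W := (dipath G).
Implicit Types (x y z : vertex G) (p q u v w : seq (edge G)) (a b : W).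

Variables (t : vertex G -> seq (edge G) -> R[i]) (T : bop R W).
Hypothesis TE : forall a b, T (xi a) b = coef_kernel t b a.

(** The added 1 secures positivity; any bound uniform over the Fejer sums is enough here. *)
Let C := opnorm T + 1.

Let C_gt0 : 0 < C.
Proof. by rewrite ltr_wpDl// opnorm_ge0. Qed.

Definition fejer_index (F : seq (vertex G)) (E : seq (edge G)) k :=
  undup [seq (x, u) | x <- F, u <- words E k].

Definition fejer_coef F E k x u : R[i] :=
  if (x, u) \in fejer_index F E k then (k - size u)%:R / k%:R * t x u else 0.

Definition fejer_sum F E k : bop R W :=
  \sum_(c <- fejer_index F E k) fejer_coef F E k c.1 c.2 *: Lword R c.1 c.2.

Lemma subalgebra_sum (A : set (bop R W)) (J : Type) (r : seq J) (c : J -> R[i])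
  (S : J -> bop R W) : subalgebra A -> (forall j, A (S j)) ->
  A (\sum_(j <- r) c j *: S j).
Proof.
move=> [A0 AZ _] AS; elim: r => [|j r ih]; first by rewrite big_nil.
by rewrite big_cons; exact: AZ.
Qed.

Lemma fejer_sumE F E k a b : fejer_sum F E k (xi a) b = coef_kernel (fejer_coef F E k) b a.
Proof.
have rc : right_commuting (fejer_sum F E k).
  apply: (subalgebra_sum _ _ (right_commuting_subalgebra R G)) => c.
  exact: Lword_subalgebra (right_commuting_subalgebra R G) (@right_commuting_generators R G).
rewrite right_commuting_xi// /coef_kernel; case: eqP => // ba.
apply: stripr_ext => u uE; set x := prng a.
have xu : composable x u.
  by have := dipathP b; rewrite ba uE => /composable_cat[].
have E1 c : ev (Lword R c.1 c.2 (xi (vpath x))) x u = (c == (x, u))%:R.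
  case: c => y w; rewrite ev_word// xpair_eqE.
  elim/striplP: (stripl _ _ _) => [p pE|np]; last first.
    by case: eqP => //= _; case: eqP np => // ->; rewrite prefix_refl.
  have xp : composable x p by move: xu; rewrite pE => /composable_cat[].
  rewrite ev_xi//= eqxx pE -[X in X == _ ++ _]cats0 eqseq_cat// eqxx/=.
  rewrite [[::] == p]eq_sym; case: (p =P [::]) => [->|]/=.
    by rewrite andbT eq_sym; case: eqP.
  by rewrite ?andbF ?if_same.
rewrite /fejer_sum bop_sumE ev_sum.
rewrite (eq_bigr (fun c => fejer_coef F E k c.1 c.2 * (c == (x, u))%:R)); last first.
  by move=> c _; rewrite -E1 -ev_scale.
rewrite {2}/fejer_coef; case: ifPn => xuP.
  rewrite (bigD1_seq (x, u))//= ?undup_uniq// eqxx mulr1 big1 ?addr0.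
    by rewrite /fejer_coef xuP.
  by move=> c /negbTE ->; rewrite mulr0.
rewrite big1_seq// => c /andP[_ cP]; case: eqP => [cE|_]; last by rewrite mulr0.
by move: xuP; rewrite -cE cP.
Qed.

Definition block (E : seq (edge G)) k (j : nat) a :=
  (strip_prefix E (pedges a), (size (pedges a) + j) %/ k)%N.

(* The Fejer weight [k - l] counts the [j < k] for which two lengths at
   distance [l] lie in the same interval [[k i - j, k i - j + k)]. *)
Lemma fejer_kernelE F E k b a : (0 < k)%N -> coef_kernel (fejer_coef F E k) b a =
  #|'I_k|%:R^-1 * \sum_(j < k) (if block E k j b == block E k j a then
     (if prng a \in F then coef_kernel t b a else 0) else 0).
Proof.
move=> k0; rewrite /coef_kernel; case: eqP => [ba|_]; last first.
  by rewrite big1 ?mulr0// => j _; rewrite !if_same.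
case: (boolP (suffix (pedges a) (pedges b))) => [/suffixP[u uE]|nu]; last first.
  by rewrite !stripr0// big1 ?mulr0// => j _; rewrite !if_same.
rewrite uE !stripr_cat /fejer_coef mem_undup.
have -> : ((prng a, u) \in [seq (x, u) | x <- F, u <- words E k]) =
    (prng a \in F) && (all (mem E) u && (size u < k)%N).
  rewrite -mem_words; apply/allpairsP/andP.
    by move=> [[x u'] /= [xF u'P [-> ->]]].
  by move=> [aF uw]; exists (prng a, u).
case: (boolP (prng a \in F)) => aF /=; last first.
  by rewrite big1 ?mulr0// => j _; rewrite if_same.
rewrite (eq_bigr (fun j : 'I_k => (all (mem E) u)%:R *
   ((size u + size (pedges a) + j) %/ k == (size (pedges a) + j) %/ k)%N%:R *
    t (prng a) u)); last first.
  move=> j _; rewrite /block xpair_eqE uE strip_prefix_cat size_cat.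
  case: (all _ _); rewrite ?mul0r ?mul1r//=.
  by case: ifP; rewrite ?mul0r ?mul1r.
rewrite -mulr_suml -mulr_sumr -natr_sum same_block_count// card_ord.
case: (all _ _); rewrite ?mul0r ?mulr0//= mul1r mulrA [_^-1 * _]mulrC.
case: ltnP => // ku; have -> : (k - size u = 0)%N by apply/eqP; rewrite subn_eq0.
by rewrite !mul0r.
Qed.

Lemma fejer_form_bounded F E k : (0 < k)%N ->
  form_bounded C (coef_kernel (fejer_coef F E k)).
Proof.
move=> k0 s f g us.
(* Restricting to columns with range in [F] is multiplication by a projection on the right, absorbed
   into [f]. *)
have K0 : form_bounded C (fun b a => if prng a \in F then coef_kernel t b a else 0).
  move=> {s us} s {}f {}g us.
  have TC : opnorm T <= C by rewrite lerDl.
  have := form_bounded_bop C_gt0 TC (fun a => if prng a \in F then f a else 0) g us.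
  rewrite (eq_bigr (fun b => \sum_(a <- s)
      (if prng a \in F then coef_kernel t b a else 0) * f a * g b)); last first.
    move=> b _; apply: eq_bigr => a _; rewrite TE.
    by case: ifP => _; rewrite ?mulr0 ?mul0r.
  move=> /le_trans; apply; rewrite ler_wpM2l ?divr_ge0 ?(ltW C_gt0)// lerD2r.
  apply: ler_sum => a _; case: ifP => // _.
  by rewrite (normc0 R) expr0n sqr_ge0.
have K1 (j : 'I_k) := form_bounded_diag (block E k j) K0.
have k0' : (0 < #|'I_k|)%N by rewrite card_ord.
have := form_le_avg k0' (fun j => K1 j s f g us).
rewrite (eq_bigr (fun b => \sum_(a <- s) coef_kernel (fejer_coef F E k) b a * f a * g b))//.
by move=> b _; apply: eq_bigr => a _; rewrite fejer_kernelE.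
Qed.

Lemma opnorm_fejer_sum F E k : (0 < k)%N -> opnorm (fejer_sum F E k) <= C.
Proof.
move=> k0; have KB := @fejer_form_bounded F E k k0.
have us b : uniq (path_suffixes b) by exact: undup_uniq.
have ks b a := @coef_kernel_suffix R G (fejer_coef F E k) b a.
have -> : fejer_sum F E k = kernel_bop us ks C_gt0 KB.
  apply: bop_ext => a; apply/val_inj/funext => b.
  by rewrite [LHS]fejer_sumE [RHS]kernel_bop_xi.
exact: opnorm_kernel_bop.
Qed.

Lemma normc_coef_le a b : normc (coef_kernel t b a) <= opnorm T.
Proof.
rewrite -TE -(@ler_pXn2r _ 2)// ?nnegrE ?normc_ge0 ?opnorm_ge0//.
have := @sqr_l2norm_bop _ _ T (xi a) _ [:: b] (lexx _) isT.
by rewrite big_seq1 l2norm_xi expr1n mulr1.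
Qed.

Lemma coef_kernel_free_semigroupoid : free_semigroupoid_algebra R G T.
Proof.
move=> A [[subA clA] GA]; apply: (wot_closed_approx (B := C) clA) => s e e0.
(* With all edges and ranges of the test paths included, the cut-offs do not affect the entries on
   [s]; only the Fejer weights do. *)
pose E := flatten [seq pedges a | a <- s].
pose F := [seq prng a | a <- s].
pose N := (\max_(a <- s) size (pedges a))%N.
(* The first summand makes N |T| / k at most [e], and k > N keeps every relevant word among those of
   length below [k]. *)
pose k := (Num.bound (N%:R * opnorm T / e) + N).+1.
have k0 : (0 < k)%N by [].
exists (fejer_sum F E k); split.
- by apply: subalgebra_sum => // c; exact: Lword_subalgebra.
- exact: opnorm_fejer_sum.
move=> a b a_s b_s; rewrite fejer_sumE TE.
have nT := normc_coef_le a b; rewrite /coef_kernel in nT *.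
case: eqP nT => [ba|_] nT; last by rewrite subrr (normc0 R) ltW.
case: (boolP (suffix (pedges a) (pedges b))) => [/suffixP[u uE]|nu]; last first.
  by rewrite !stripr0// subrr (normc0 R) ltW.
move: nT; rewrite uE !stripr_cat /fejer_coef => nT.
have uN : (size u <= N)%N.
  apply: leq_trans (leq_bigmax_seq _ b_s isT).
  by rewrite uE size_cat leq_addr.
have uw : u \in words E k.
  rewrite mem_words; apply/andP; split; last by rewrite ltnS (leq_trans uN)// leq_addl.
  apply/allP => g gu; apply/flattenP; exists (pedges b); first exact: map_f.
  by rewrite uE mem_cat gu.
rewrite mem_undup ifT; last by apply/allpairsP; exists (prng a, u); split; first exact: map_f.
have uk : (size u <= k)%N by rewrite (leq_trans uN)// leqW// leq_addl.
have kR : k%:R != 0 :> R[i] by rewrite pnatr_eq0.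
have -> : (k - size u)%:R / k%:R * t (prng a) u - t (prng a) u =
   - ((size u)%:R / k%:R * t (prng a) u).
  by rewrite natrB//; field.
rewrite normcN normcM normcM normcV !normcMn (normc1 R).
rewrite mulrAC ler_pdivrMr ?ltr0n//.
apply: (@le_trans _ _ (N%:R * opnorm T)).
  by rewrite ler_pM// ?ler0n ?normc_ge0// ler_nat.
rewrite -ler_pdivrMl// mulrC ltW//.
apply: lt_le_trans (archi_boundP _) _.
  by rewrite divr_ge0 ?mulr_ge0 ?ler0n ?opnorm_ge0// ltW.
by rewrite ler_nat /k leqW// leq_addr.
Qed.

End fejer.

(** * Extension to the tensor algebra *)

Section derivation_extension.
Variables (R : realType) (G : digraph).
Local Notation W := (dipath G).
Local Notation TA := (tensor_algebra R G).
Implicit Types (x y z : vertex G) (p q u v w : seq (edge G)) (a b : W)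
  (S T : bop R W).

Lemma opnormB S T : opnorm (S - T) <= opnorm S + opnorm T.
Proof. by have := ler_normB S T; rewrite -rmorphD lecR. Qed.

Lemma opnorm_bcomp_le S T : opnorm (bcomp S T) <= opnorm S * opnorm T.
Proof.
apply: opnorm_le => f f1; apply: le_trans (l2norm_bop S _) _.
rewrite ler_wpM2l ?opnorm_ge0//; apply: le_trans (l2norm_bop T _) _.
by rewrite ler_piMr ?opnorm_ge0.
Qed.

Lemma bopB T f g : T (f - g) = T f - T g.
Proof. exact: linearB. Qed.

Lemma inner_derivationE T S f : inner_derivation T S f = S (T f) - T (S f).
Proof. by []. Qed.

Lemma inner_derivation_linear T (c : R[i]) S S' :
  inner_derivation T (c *: S + S') = c *: inner_derivation T S + inner_derivation T S'.
Proof.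
apply: bop_ext => i.
have -> : (c *: inner_derivation T S + inner_derivation T S') (xi i) =
  c *: inner_derivation T S (xi i) + inner_derivation T S' (xi i) by [].
rewrite !inner_derivationE.
have E g : (c *: S + S') g = c *: S g + S' g by [].
by rewrite !E bopD bopZ scalerBr opprD addrACA.
Qed.

Lemma inner_derivationM T S S' : inner_derivation T (bcomp S S') =
  bcomp (inner_derivation T S) S' + bcomp S (inner_derivation T S').
Proof.
apply: bop_ext => i.
have -> : (bcomp (inner_derivation T S) S' + bcomp S (inner_derivation T S')) (xi i) =
  inner_derivation T S (S' (xi i)) + S (inner_derivation T S' (xi i)) by [].
have E g : bcomp S S' g = S (S' g) by [].
by rewrite !inner_derivationE !E bopB [RHS]addrC addrA subrK.
Qed.

Lemma opnorm_inner_derivation T S :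
  opnorm (inner_derivation T S) <= 2 * opnorm T * opnorm S.
Proof.
apply: le_trans (opnormB _ _) _.
have := opnorm_bcomp_le S T; have := opnorm_bcomp_le T S; lra.
Qed.

Variable d : bop R W -> bop R W.
Hypotheses (d_der : derivation TA (free_semigroupoid_algebra R G) d)
  (d_bounded : bounded_on TA d).

Lemma tensor_norm_closed : norm_closed TA.
Proof. by apply: closed_bigI => A [[_ clA] _]. Qed.

(** The elements of the tensor algebra on which both derivations agree form a norm-closed algebra
    containing the generators. Membership is carried along because [d] is controlled only there. *)
Lemma derivation_inner_extend T :
  (forall S, generators S -> d S = inner_derivation T S) ->
  forall S, TA S -> d S = inner_derivation T S.
Proof.
move=> gen S TS; have [_ dZ dM] := d_der; have [A0 AZ AM] := tensor_subalgebra R G.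
suff : TA S /\ d S = inner_derivation T S by case.
apply: (TS [set S | TA S /\ d S = inner_derivation T S]%classic); split; last first.
  by move=> X GX; split; [exact: generators_tensor|exact: gen].
have d0 := derivation0 d_der.
split.
  split=> [|c X Y [AX dX] [AY dY]|X Y [AX dX] [AY dY]].
  - split=> //; rewrite d0; apply: bop_ext => i.
    rewrite inner_derivationE.
    have E g : (0 : bop R W) g = 0 by [].
    by rewrite !E bop0 subr0.
  - by split; [exact: AZ|rewrite dZ// inner_derivation_linear dX dY].
  - by split; [exact: AM|rewrite dM// inner_derivationM dX dY].
move=> X clX.
have AX : TA X.
  by apply: tensor_norm_closed => N /clX[Y [[AY _] NY]]; exists Y.
split=> //; have [B dB] := d_bounded.
apply/eqP; rewrite -subr_eq0; apply/eqP/normr0_eq0.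
suff D0 : opnorm (d X - inner_derivation T X) = 0 by congr (_%:C%C).
apply/eqP; rewrite eq_le opnorm_ge0 andbT; apply/ler_addgt0Pr => e e0; rewrite add0r.
(* A positive Lipschitz constant for the difference of the two derivations on the tensor algebra. *)
pose c := `|B| + 2 * opnorm T + 1.
have c0 : 0 < c.
  by rewrite ltr_wpDl// addr_ge0// mulr_ge0// opnorm_ge0.
have ec0 : 0 < (e / c)%:C%C :> R[i] by rewrite ltcR divr_gt0.
have [Y [[AY dY]]] := clX _ (nbhsx_ballx X _ ec0).
rewrite -ball_normE /= ltcR => XY.
have AXY : TA (X - Y) by rewrite addrC -scaleN1r; exact: AZ.
have -> : d X - inner_derivation T X = d (X - Y) - inner_derivation T (X - Y).
  have -> : X - Y = -1 *: Y + X by rewrite scaleN1r addrC.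
  rewrite dZ// inner_derivation_linear -dY.
  move: (inner_derivation T X) (d X) (d Y) => A' X' Y'.
  by rewrite !scaleN1r opprD opprK addrACA addNr add0r.
apply: le_trans (opnormB _ _) _.
apply: le_trans (lerD (dB _ AXY) (opnorm_inner_derivation T (X - Y))) _.
rewrite -mulrDl; apply: (@le_trans _ _ (c * opnorm (X - Y))).
  rewrite ler_wpM2r ?opnorm_ge0// /c; have := ler_norm B; lra.
by rewrite mulrC -ler_pdivlMr// ltW.
Qed.

Lemma LedgeE (e : edge G) : Ledge R e = Lword R (src e) [:: e].
Proof.
apply: bop_ext => a; apply: ell2_ext => z q zq; rewrite ev_word// ev_edge//.
by apply: stripl_ext => p qE; subst q; case: zq => -> _; rewrite eqxx.
Qed.

Variable sigma : vertex G -> seq (edge G) -> R[i].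
Hypothesis sigmaP : forall x y w q, ispath x y w -> ispath x y q ->
  dcoef d x w q = stripl (sigma x) w q - stripr (sigma y) w q.
Variable T : bop R W.
Hypothesis TE : forall a b, T (xi a) b = coef_kernel (inner_coef d sigma) b a.

(** Both sides commute with right creation, so only entries between paths with equal source remain,
    and there the coefficients of [T] give the identity. *)
Lemma derivation_word x y w : ispath x y w ->
  d (Lword R x w) = inner_derivation T (Lword R x w).
Proof.
move=> xw; apply: bop_ext => a; apply: ell2_ext => z q zq.
have [_ AZ AM] := right_commuting_subalgebra R G.
have rT : right_commuting T.
  apply: free_semigroupoid_right_commuting.
  exact: (coef_kernel_free_semigroupoid TE).
have rw : right_commuting (Lword R x w).
  exact: Lword_subalgebra (right_commuting_subalgebra R G) (@right_commuting_generators R G).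
have ri : right_commuting (inner_derivation T (Lword R x w)).
  rewrite /inner_derivation addrC -scaleN1r; apply: AZ; exact: AM.
have rd : right_commuting (d (Lword R x w)).
  by apply: (d_right_commuting d_der); exact: tensor_word.
have [za|za] := eqVneq z (psrc a); last first.
  by rewrite !(evE _ zq) !right_commuting_xi//= (negbTE za).
subst z; rewrite (derivation_word_xi d_der sigmaP xw zq) inner_derivationE.
have evB (f g : ell2 R W) z r : ev (f - g) z r = ev f z r - ev g z r.
  by rewrite evD -scaleN1r ev_scale mulN1r.
rewrite evB; congr (_ - _).
  rewrite ev_word//; apply: stripl_ext => p qE; subst q; case: eqP => // _.
  have [ap _] := (composable_cat _ _ _).1 zq.
  by rewrite (evE _ ap) TE /coef_kernel/= eqxx.
case: eqP => [ax|nax]; last by rewrite Lword_xi0// bop0 ev0.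
have [b [bE ba bw br]] := Lword_xi R xw ax.
by rewrite bE (evE _ zq) TE /coef_kernel/= ba eqxx bw br.
Qed.

End derivation_extension.

Theorem theorem1p1 (R : realType) (G : digraph)
    (hG : forall x : vertex G, strongly_connected (component x))
    (d : bop R (dipath G) -> bop R (dipath G))
    (d_der : derivation (tensor_algebra R G) (free_semigroupoid_algebra R G) d)
    (d_bounded : bounded_on (tensor_algebra R G) d) :
  exists T : bop R (dipath G),
    [/\ free_semigroupoid_algebra R G T,
        forall S : bop R (dipath G),
          tensor_algebra R G S -> d S = inner_derivation T S
      & opnorm T <= normon (tensor_algebra R G) d].
Proof.
have path_sym := strongly_connected_path_sym hG.
have [sigma [sigmaP sigma_avg]] :=
  cocycle_solution (dcoef_cocycle d_der d_bounded) path_sym.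
pose M := normon (tensor_algebra R G) d.
have M0 : 0 <= M by exact: normon_ge0.
pose K := coef_kernel (inner_coef d sigma).
(* The norm [M] may vanish while the form bounds need a positive constant. So an operator is built
   for each bound M + e; all have the same matrix and coincide, and letting e tend to 0 gives the
   bound [M]. *)
have KB (e : R) : 0 < e -> form_bounded (M + e) K.
  by move=> e0; apply: inner_kernel_bounded => //; rewrite ?ltr_wpDl// lerDl ltW.
have us (b : dipath G) : uniq (path_suffixes b) by exact: undup_uniq.
have ks b a := @coef_kernel_suffix _ _ (inner_coef d sigma) b a.
have e_gt0 (e : R) : 0 < e -> 0 < M + e by move=> e0; rewrite ltr_wpDl.
pose T (e : R) (e0 : 0 < e) := kernel_bop us ks (e_gt0 e e0) (KB e e0).
have TE e e0 a b : T e e0 (xi a) b = K b a by exact: kernel_bop_xi.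
exists (T 1 ltr01); split.
- exact: coef_kernel_free_semigroupoid (TE 1 ltr01).
- apply: (derivation_inner_extend d_der d_bounded) => _ [[e _ <-]|[x _ <-]].
    rewrite LedgeE; apply: (derivation_word d_der sigmaP (TE 1 ltr01)).
    exact: ispath_edge.
  exact: (derivation_word d_der sigmaP (TE 1 ltr01) (ispath_nil x)).
apply/ler_addgt0Pr => e e0.
have -> : T 1 ltr01 = T e e0.
  by apply: bop_ext => a; apply/val_inj/funext => b; rewrite [LHS]TE [RHS]TE.
exact: opnorm_kernel_bop.
Qed.
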